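(* Assume $\|\mathrm{div}\,V\|_{L^N(\mathbb{T}^N)}\le\frac1\chi$. Then for every $P\in\mathbb{R}^N$: (i) $\lim_{k\to\infty}\overline H_k(P)=\overline H(P)$; (ii) the equation $H(x,Du+P)=\overline H(P)$ in $\mathbb{R}^N$ admits a bounded $\mathbb{Z}^N$-periodic upper semicontinuous viscosity subsolution and a bounded $\mathbb{Z}^N$-periodic lower semicontinuous viscosity supersolution.
   Context: $V:\mathbb{R}^N\to\mathbb{R}^N$ is $\mathbb{Z}^N$-periodic and Lipschitz continuous; $\mathbb{T}^N=\mathbb{R}^N/\mathbb{Z}^N$; $\chi$ is the isoperimetric constant of $\mathbb{T}^N$ (smallest constant with $|\Theta|^{1-1/N}\le\chi\,\mathcal{H}^{N-1}(\partial\Theta)$ for all $\Theta\subset\mathbb{T}^N$ with Lipschitz boundary; equal to the relative isoperimetric constant of $(0,1/2)^N$). $H(x,p)=|p|+p\cdot V(x)$; for $k\ge1$, $H_k(x,p)=\max\{H(x,p),-k\}+f_k(p)$ with $f_k(p)=\max\{|p|-k,0\}$. For $G\in\{H,H_k\}$, $\overline G(P)=\inf\{a\in\mathbb{R}\mid G(x,Du+P)=a$ admits an upper semicontinuous, bounded, $\mathbb{Z}^N$-periodic viscosity subsolution on $\mathbb{R}^N\}$; $\overline H_k$ and $\overline H$ are those of $H_k$ and $H$.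
   Formalization: The isoperimetric inequality defining χ is required only for Θ with 0 < |Θ| ≤ 1/2: as written for all Θ ⊂ T^N no constant exists, since Θ = T^N has measure 1 and empty boundary. *)

(* Defs.v *)
(* Conventions: the paper's dimension N is written n.+1
   (N >= 1); points of R^N are row vectors 'rV[R]_(n.+1). *)
From HB Require Import structures.
From mathcomp Require Import all_boot all_order all_algebra.
From mathcomp Require Import all_classical all_reals all_analysis.
Set Implicit Arguments. Unset Strict Implicit. Unset Printing Implicit Defensive.
Import Order.TTheory GRing.Theory Num.Theory.
Import numFieldNormedType.Exports.
Local Open Scope classical_set_scope.
Local Open Scope ring_scope.

Section Defs.
Variable R : realType.

Definition edot (m : nat) (p q : 'rV[R]_m) : R := \sum_(i < m) p 0 i * q 0 i.
Definition enorm (m : nat) (p : 'rV[R]_m) : R := Num.sqrt (edot p p).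

Definition intvec (m : nat) (z : 'rV[int]_m) : 'rV[R]_m := map_mx (fun k => k%:~R) z.

Definition periodic_fun (m : nat) (T : Type) (f : 'rV[R]_m -> T) :=
  forall (z : 'rV[int]_m) x, f (x + intvec z) = f x.
Definition periodic_set (m : nat) (A : set 'rV[R]_m) :=
  forall (z : 'rV[int]_m) x, A (x + intvec z) <-> A x.

Definition lipschitz_map (m k : nat) (f : 'rV[R]_m -> 'rV[R]_k) :=
  exists L : R, forall x y, enorm (f x - f y) <= L * enorm (x - y).
Definition lipschitz_real (m : nat) (f : 'rV[R]_m -> R) :=
  exists L : R, forall x y, `|f x - f y| <= L * enorm (x - y).

Fixpoint cube_int (m : nat) : ('rV[R]_m -> \bar R) -> \bar R :=
  match m with
  | 0%N => fun f => f 0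
  | m'.+1 => fun f =>
      (\int[@lebesgue_measure R]_(t in `[0%R, 1%R]) cube_int (fun y : 'rV[R]_m' =>
          f (row_mx (const_mx t : 'rV[R]_1) y)))%E
  end.

(* Lebesgue measure of a (periodic) set, i.e. measure of its image in T^m *)
Definition tmeas (m : nat) (A : set 'rV[R]_m) : \bar R :=
  cube_int (fun x => (\1_A x)%:E).

Definition ecoord (m : nat) (i : 'I_m) : 'rV[R]_m := delta_mx 0 i.
Definition divergence (m : nat) (V : 'rV[R]_m -> 'rV[R]_m) (x : 'rV[R]_m) : R :=
  \sum_(i < m) 'D_(ecoord i) (fun y => V y 0 i) x.
Definition LN_norm_div (n : nat) (V : 'rV[R]_n.+1 -> 'rV[R]_n.+1) : \bar R :=
  ((cube_int (fun x => (`|divergence V x| ^+ n.+1)%:E)) `^ (n.+1%:R^-1))%E.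

(* volume of the closed unit ball of R^s *)
Definition omega (s : nat) : R :=
  2 ^+ s * fine (cube_int (fun x : 'rV[R]_s => (\1_[set y | enorm y <= 1] x)%:E)).
Definition ediam (m : nat) (C : set 'rV[R]_m) : \bar R :=
  ereal_sup [set (enorm (x - y))%:E | x in C & y in C].
Definition haus_term (m s : nat) (C : set 'rV[R]_m) : \bar R :=
  if pselect (C = set0) then 0%E else (omega s * (fine (ediam C) / 2) ^+ s)%:E.
Definition haus_delta (m s : nat) (d : R) (A : set 'rV[R]_m) : \bar R :=
  ereal_inf [set (\sum_(j <oo) haus_term s (C j))%E |
               C in [set C : nat -> set 'rV[R]_m |
                       A `<=` \bigcup_j C j /\ forall j, (ediam (C j) <= d%:E)%E]].
Definition hausdorff (m s : nat) (A : set 'rV[R]_m) : \bar R :=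
  ereal_sup [set haus_delta s d A | d in [set d : R | 0 < d]].

Definition topo_boundary (m : nat) (A : set 'rV[R]_m) : set 'rV[R]_m :=
  closure A `\` A°.
Definition orthogonal_mx (m : nat) (Q : 'M[R]_m) := Q *m Q^T = 1%:M.
Definition lipschitz_boundary (n : nat) (A : set 'rV[R]_n.+1) :=
  forall x, topo_boundary A x ->
    exists r : R, exists Q : 'M[R]_n.+1, exists g : 'rV[R]_n -> R,
      [/\ 0 < r, orthogonal_mx Q, lipschitz_real g &
        forall y, enorm (y - x) < r ->
          (A y <-> (y *m Q) 0 ord0 < g (@rsubmx R 1 1 n (y *m Q)))].
Definition unit_cube (m : nat) : set 'rV[R]_m :=
  [set x | forall i, 0 <= x 0 i /\ x 0 i < 1].

(* admissible subsets of T^N, represented by Z^N-periodic subsets of R^N *)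
Definition iso_admissible (n : nat) (Th : set 'rV[R]_n.+1) :=
  [/\ periodic_set Th, lipschitz_boundary Th &
      (0 < tmeas Th)%E /\ (tmeas Th <= (2^-1 : R)%:E)%E].
Definition iso_ineq (n : nat) (c : R) (Th : set 'rV[R]_n.+1) :=
  ((fine (tmeas Th) `^ (1 - n.+1%:R^-1))%:E
     <= c%:E * @hausdorff n.+1 n (topo_boundary Th `&` @unit_cube n.+1))%E.
Definition isoperimetric_constant (n : nat) (chi : R) :=
  (forall Th : set 'rV[R]_n.+1, iso_admissible Th -> iso_ineq chi Th) /\
  (forall c : R, (forall Th : set 'rV[R]_n.+1, iso_admissible Th -> iso_ineq c Th) -> chi <= c).

Definition Ham (m : nat) (V : 'rV[R]_m -> 'rV[R]_m) (x p : 'rV[R]_m) : R :=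
  enorm p + edot p (V x).
Definition Ham_k (m : nat) (V : 'rV[R]_m -> 'rV[R]_m) (k : R) (x p : 'rV[R]_m) : R :=
  Num.max (Ham V x p) (- k) + Num.max (enorm p - k) 0.

Definition grad (m : nat) (phi : 'rV[R]_m -> R) (x : 'rV[R]_m) : 'rV[R]_m :=
  \row_i 'D_(ecoord i) phi x.
Definition C1 (m : nat) (phi : 'rV[R]_m -> R) :=
  (forall x, differentiable phi x) /\
  (forall i : 'I_m, continuous (fun x => 'D_(ecoord i) phi x)).
Definition usc (m : nat) (u : 'rV[R]_m -> R) :=
  lower_semicontinuous (fun x => (- u x)%:E).
Definition lsc (m : nat) (u : 'rV[R]_m -> R) :=
  lower_semicontinuous (fun x => (u x)%:E).
Definition bdd_fun (m : nat) (u : 'rV[R]_m -> R) :=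
  exists M : R, forall x, `|u x| <= M.

Definition visc_sub (m : nat) (G : 'rV[R]_m -> 'rV[R]_m -> R) (P : 'rV[R]_m) (a : R)
    (u : 'rV[R]_m -> R) :=
  forall (phi : 'rV[R]_m -> R) (x0 : 'rV[R]_m), C1 phi ->
    (\forall y \near x0, u y - phi y <= u x0 - phi x0) ->
    G x0 (grad phi x0 + P) <= a.
Definition visc_super (m : nat) (G : 'rV[R]_m -> 'rV[R]_m -> R) (P : 'rV[R]_m) (a : R)
    (u : 'rV[R]_m -> R) :=
  forall (phi : 'rV[R]_m -> R) (x0 : 'rV[R]_m), C1 phi ->
    (\forall y \near x0, u y - phi y >= u x0 - phi x0) ->
    G x0 (grad phi x0 + P) >= a.

Definition Hbar (m : nat) (G : 'rV[R]_m -> 'rV[R]_m -> R) (P : 'rV[R]_m) : \bar R :=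
  ereal_inf [set a%:E | a in [set a : R | exists u : 'rV[R]_m -> R,
     [/\ usc u, bdd_fun u, periodic_fun u & visc_sub G P a u]]].

End Defs.

(* Main.v *)
Require Import Defs.
From HB Require Import structures.
From mathcomp Require Import all_boot all_order all_algebra.
From mathcomp Require Import all_classical all_reals all_analysis.
Import Order.TTheory GRing.Theory Num.Theory.
Import numFieldNormedType.Exports.
Local Open Scope classical_set_scope.
Local Open Scope ring_scope.
From mathcomp Require Import ring lra.
From mathcomp Require Import measurable_realfun.
Set Implicit Arguments. Unset Strict Implicit. Unset Printing Implicit Defensive.

(* A subset of the torus that is open and forward invariant under all velocities within distance 1 of V is
   empty or dense: mollifying its indicator gives f with V . Df >= (1 - e) |Df|; the superlevel sets of f have
   Lipschitz boundary, and integrating div V against f by layers, with the isoperimetric and Hoelder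
   inequalities and the co-area (Eilenberg) inequality, gives int V . Df <= q int |Df| with q < 1 (strictly,
   because div V has mean zero), so f is constant.  Hence any two points are joined modulo Z^N by a trajectory of
   uniformly bounded duration.  Values of the associated control problem then provide, at the critical level c, a
   bounded subsolution (infimum over all arriving trajectories) and a bounded supersolution (lower half-relaxed
   limit over long trajectories).  The same holds for the coercive majorants max(H, M |p| - k) of H_k, and a
   doubling of variables, at a well chosen penalization scale, shows that their critical levels converge to c. *)

(** * Euclidean norm *)

(** The gain [q < 1] is not quantified, so the co-area inequality is needed with its sharp constant.
    Inside a small ball each level set is therefore covered by sets whose diameter is at most that
    of the corresponding slice of the ball, and the rest of a cube is filled by smaller cubes,
    repeatedly. The isoperimetric inequality applies only to sets with Lipschitz boundary and at
    most half of the volume. The first condition holds at every level, critical or not, because [f]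
    increases along a whole cone of directions; the second is why levels are split at a median.
    Trajectories are polygonal, and the control of each segment stays admissible in a tube around
    it. Chains can therefore be translated slightly, which makes reachable sets open and values
    semicontinuous without solving a differential equation. Since $H$ is not coercive, sub- and
    supersolutions may be discontinuous, and the doubling of variables cannot rely on a modulus of
    continuity. *)

Section Euclid.
Variables (R : realType) (m : nat).
Implicit Types (x y z p q : 'rV[R]_m) (a : R).

Lemma edotC p q : edot p q = edot q p.
Proof. by apply: eq_bigr => i _; rewrite mulrC. Qed.

Lemma edotDl p q x : edot (p + q) x = edot p x + edot q x.
Proof. by rewrite -big_split; apply: eq_bigr => i _; rewrite mxE mulrDl. Qed.

Lemma edotDr x p q : edot x (p + q) = edot x p + edot x q.
Proof. by rewrite edotC edotDl !(edotC x). Qed.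

Lemma edotZl a p q : edot (a *: p) q = a * edot p q.
Proof. by rewrite /edot mulr_sumr; apply: eq_bigr => i _; rewrite mxE mulrA. Qed.

Lemma edotZr a p q : edot p (a *: q) = a * edot p q.
Proof. by rewrite edotC edotZl edotC. Qed.

Lemma edotNl p q : edot (- p) q = - edot p q.
Proof. by rewrite -scaleN1r edotZl mulN1r. Qed.

Lemma edotNr p q : edot p (- q) = - edot p q.
Proof. by rewrite edotC edotNl edotC. Qed.

Lemma edotBl p q x : edot (p - q) x = edot p x - edot q x.
Proof. by rewrite edotDl edotNl. Qed.

Lemma edotBr x p q : edot x (p - q) = edot x p - edot x q.
Proof. by rewrite edotDr edotNr. Qed.

Lemma edot0l p : edot 0 p = 0.
Proof. by rewrite -(scale0r p) edotZl mul0r. Qed.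

Lemma edot0r p : edot p 0 = 0.
Proof. by rewrite edotC edot0l. Qed.

Lemma edot_ge0 p : 0 <= edot p p.
Proof. by apply: sumr_ge0 => i _; rewrite -expr2 sqr_ge0. Qed.

Lemma enorm_ge0 p : 0 <= enorm p.
Proof. exact: sqrtr_ge0. Qed.

Lemma sqr_enorm p : enorm p ^+ 2 = edot p p.
Proof. by rewrite sqr_sqrtr ?edot_ge0. Qed.

Lemma enorm0 : enorm (0 : 'rV[R]_m) = 0.
Proof. by rewrite /enorm edot0l sqrtr0. Qed.

Lemma enormZ a p : enorm (a *: p) = `|a| * enorm p.
Proof.
by rewrite /enorm edotZl edotZr mulrA -expr2 sqrtrM ?sqr_ge0// sqrtr_sqr.
Qed.

Lemma enormN p : enorm (- p) = enorm p.
Proof. by rewrite -scaleN1r enormZ normrN1 mul1r. Qed.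

Lemma enormB x y : enorm (x - y) = enorm (y - x).
Proof. by rewrite -enormN opprB. Qed.

Lemma enorm_eq0 p : enorm p = 0 -> p = 0.
Proof.
move=> p0; have := sqr_enorm p; rewrite p0 expr0n/= => /esym/eqP.
rewrite psumr_eq0; last by move=> i _; rewrite -expr2 sqr_ge0.
move=> /allP h; apply/rowP => i; rewrite mxE.
have := h i (mem_index_enum _); rewrite /= mulf_eq0 orbb => /eqP.
by [].
Qed.

(** Cauchy-Schwarz, by expanding the squared length of [enorm q *: p - enorm p *: q]. *)
Lemma edot_le p q : edot p q <= enorm p * enorm q.
Proof.
have [->|q0] := eqVneq q 0; first by rewrite edot0r enorm0 mulr0.
have nq : 0 < enorm q.
  by rewrite lt_neqAle enorm_ge0 andbT eq_sym; apply: contra_neq q0; exact: enorm_eq0.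
have := edot_ge0 (enorm q *: p - enorm p *: q).
rewrite edotBl !edotBr !edotZl !edotZr -!sqr_enorm (edotC q p) => h.
have [p0|p0] := eqVneq p 0; first by rewrite p0 edot0l enorm0 mul0r.
have np : 0 < enorm p.
  by rewrite lt_neqAle enorm_ge0 andbT eq_sym; apply: contra_neq p0; exact: enorm_eq0.
have pq : 0 < enorm p * enorm q by exact: mulr_gt0.
rewrite -(ler_pM2l pq); nra.
Qed.

Lemma abs_edot_le p q : `|edot p q| <= enorm p * enorm q.
Proof.
by rewrite ler_norml edot_le andbT lerNl -edotNl (le_trans (edot_le _ _))// enormN.
Qed.

Lemma enormD p q : enorm (p + q) <= enorm p + enorm q.
Proof.
rewrite -(ler_sqr (enorm_ge0 _)) ?nnegrE ?addr_ge0 ?enorm_ge0//.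
rewrite sqr_enorm edotDl !edotDr (edotC q p) -!sqr_enorm.
by have := edot_le p q; nra.
Qed.

Lemma enorm_triangle y x z : enorm (x - z) <= enorm (x - y) + enorm (y - z).
Proof. by rewrite -(subrKA y) enormD. Qed.

Lemma abs_enormB p q : `|enorm p - enorm q| <= enorm (p - q).
Proof.
rewrite ler_norml; apply/andP; split.
  by have := enormD (q - p) p; rewrite subrK enormB; lra.
by have := enormD (p - q) q; rewrite subrK; lra.
Qed.

Lemma coord_le_enorm p i : `|p 0 i| <= enorm p.
Proof.
rewrite -(ler_sqr (normr_ge0 _)) ?nnegrE ?enorm_ge0//.
rewrite sqr_enorm real_normK ?num_real// expr2 /edot (bigD1 i)//= lerDl.
by apply: sumr_ge0 => j _; rewrite -expr2 sqr_ge0.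
Qed.

Lemma enorm_le_const p a : 0 <= a -> (forall i, `|p 0 i| <= a) -> enorm p <= m%:R * a.
Proof.
move=> a0 h; rewrite -(ler_sqr (enorm_ge0 _)) ?nnegrE ?mulr_ge0//.
rewrite sqr_enorm /edot.
have : \sum_(i < m) p 0 i * p 0 i <= \sum_(i < m) a ^+ 2.
  apply: ler_sum => i _; rewrite -expr2 -real_normK ?num_real//.
  by rewrite ler_sqr ?nnegrE.
move=> /le_trans; apply; rewrite sumr_const card_ord -[_ ^+ 2 *+ m]mulr_natl exprMn.
apply: ler_wpM2r; first exact: sqr_ge0.
case: (m) => [|k]; first by rewrite expr0n.
by rewrite expr2 -natrM ler_nat leq_pmulr.
Qed.

Lemma coord_le_norm p i : `|p 0 i| <= `|p|.
Proof.
change (`|p 0 i| <= mx_norm p); rewrite mx_normrE.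
by apply: (le_bigmax _ (fun ij : 'I_1 * 'I_m => `|p ij.1 ij.2|) (0, i)).
Qed.

Lemma norm_le_enorm p : `|p| <= enorm p.
Proof.
change (mx_norm p <= enorm p); rewrite mx_normrE; apply: bigmax_le.
  exact: enorm_ge0.
by move=> [i j] _ /=; rewrite (ord1 i) coord_le_enorm.
Qed.

Lemma enorm_le_norm p : enorm p <= m%:R * `|p|.
Proof. by apply: enorm_le_const => // i; exact: coord_le_norm. Qed.

(** The topology of row vectors comes from the sup norm, which [norm_le_enorm] and [enorm_le_norm]
    make comparable with [enorm]; from here on neighbourhoods are Euclidean balls. *)
Lemma nbhs_enormP x (A : set 'rV[R]_m) :
  nbhs x A <-> exists2 d, 0 < d & forall y, enorm (y - x) < d -> A y.
Proof.
split=> [/nbhs_normP[d /= d0 h]|[d d0 h]].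
  exists d => // y yx; apply: h; rewrite /ball_/= -normrN opprB.
  exact: le_lt_trans (norm_le_enorm _) yx.
(* [m.+1] rather than [m], so that the division makes sense in dimension zero. *)
have m0 : 0 < (m.+1%:R : R) by [].
apply: (nbhs_normP x A).2; exists (d / m.+1%:R); first by rewrite /= divr_gt0.
move=> y; rewrite /ball_/= => yx; apply: h.
rewrite enormB; apply: le_lt_trans (enorm_le_norm _) _.
move: yx; rewrite ltr_pdivlMr// mulrC; apply: le_lt_trans.
by apply: ler_wpM2r => //; rewrite ler_nat.
Qed.

Lemma near_enorm x (A : set 'rV[R]_m) d : 0 < d ->
  (forall y, enorm (y - x) < d -> A y) -> \forall y \near x, A y.
Proof. by move=> d0 h; apply/nbhs_enormP; exists d. Qed.

Lemma open_enormP (A : set 'rV[R]_m) : open A <->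
  forall x, A x -> exists2 d, 0 < d & forall y, enorm (y - x) < d -> A y.
Proof.
rewrite openE; split => h x Ax; first by apply/nbhs_enormP; exact: h.
by apply/nbhs_enormP; exact: h.
Qed.

Lemma continuous_enormP (f : 'rV[R]_m -> R) :
  continuous f <-> forall x e, 0 < e ->
    exists2 d, 0 < d & forall y, enorm (y - x) < d -> `|f y - f x| < e.
Proof.
split=> [cf x e e0|h x].
  have /cvgrPdist_lt/(_ _ e0)/nbhs_enormP[d d0 hd] := cf x.
  by exists d => // y /hd; rewrite distrC.
apply: (@cvgrPdist_lt _ _ _ (nbhs x) _ f (f x)).2 => e /(h x)[d d0 hd]; apply/nbhs_enormP; exists d => // y.
by move=> /hd; rewrite distrC.
Qed.

Lemma continuous_rV_enorm k (F : 'rV[R]_m -> 'rV[R]_k) :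
  (forall x e, 0 < e -> exists2 d, 0 < d & forall y, enorm (y - x) < d -> `|F y - F x| < e) ->
  continuous F.
Proof.
move=> h x A /nbhs_normP[e /= e0 he]; have [d d0 hd] := h x e e0.
by apply/nbhs_enormP; exists d => // y /hd yx; apply: he; rewrite /ball_/= distrC.
Qed.

Lemma compact_enorm_ball x (r : R) : compact [set y | enorm (y - x) <= r].
Proof.
apply: bounded_closed_compact.
  exists (r + enorm x); split; first exact: num_real.
  move=> M rM y /= yx; apply: le_trans (ltW rM).
  apply: le_trans (norm_le_enorm _) _.
  by rewrite -{1}(subrK x y) (le_trans (enormD _ _))// lerD2r.
rewrite -(setCK [set y | _]); apply: open_closedC; apply/open_enormP => y /= /negP.
rewrite -ltNge => ry; exists (enorm (y - x) - r); first by rewrite subr_gt0.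
move=> z zy; apply/negP; rewrite -ltNge.
by have := enorm_triangle z y x; rewrite (enormB y z); lra.
Qed.

End Euclid.

(** * Lebesgue measure on the cube *)

Section BorelRow.
Variable R : realType.

(** A copy of the row vectors that carries the Borel sigma-algebra; functions are cast to it only
    where measurability matters. *)
Definition borel_rV (m : nat) := g_sigma_algebraType (@open 'rV[R]_m).
HB.instance Definition _ (m : nat) := Measurable.on (borel_rV m).

Lemma open_measurable_rV m (U : set 'rV[R]_m) : open U -> measurable (U : set (borel_rV m)).
Proof. by move=> oU; apply: sub_sigma_algebra. Qed.

Lemma closed_measurable_rV m (U : set 'rV[R]_m) : closed U -> measurable (U : set (borel_rV m)).
Proof.
move=> cU; rewrite -(setCK U); apply: measurableC; apply: open_measurable_rV.
exact: closed_openC.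
Qed.

Lemma continuous_measurable_rV m (f : 'rV[R]_m -> R) :
  continuous f -> measurable_fun setT (f : borel_rV m -> R).
Proof.
move=> cf; apply: (measurability _ (RGenOInfty.measurableE R)) => _ [_ [x ->] <-].
rewrite setTI; apply: open_measurable_rV.
by apply: open_comp; [move=> z _; exact: cf | exact: interval_open].
Qed.

Lemma continuous_measurable_rVrV m k (F : 'rV[R]_m -> 'rV[R]_k) :
  continuous F -> measurable_fun setT (F : borel_rV m -> borel_rV k).
Proof.
move=> cF; apply: (@measurability _ _ _ (borel_rV k) _ _ (@open 'rV[R]_k)) => //.
move=> _ [U oU <-]; rewrite setTI; apply: open_measurable_rV.
by apply: open_comp => // z _; exact: cF.
Qed.

Definition ratrow m (q : 'rV[rat]_m) : 'rV[R]_m := map_mx ratr q.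

Lemma ratrow_dense m (x : 'rV[R]_m) (e : R) : 0 < e ->
  exists q : 'rV[rat]_m, `|x - ratrow q| < e.
Proof.
move=> e0; have hq i : exists q : rat, `|x 0 i - ratr q| < e.
  have /rat_in_itvoo[q] : x 0 i - e < x 0 i + e by lra.
  rewrite in_itv/= => /andP[q1 q2]; exists q.
  by rewrite ltr_norml; apply/andP; split; lra.
have [q hq'] := choice hq.
exists (\row_i q i).
change (mx_norm (x - ratrow (\row_i q i)) < e); rewrite mx_normrE.
rewrite bigmax_lt //= => -[i j] _; rewrite /= !mxE (ord1 i); exact: hq'.
Qed.

(** Countably many balls suffice, so preimages of open sets are measurable as soon as preimages of
    balls are. *)
Lemma open_ratballs m (U : set 'rV[R]_m) : open U ->
  U = \bigcup_(p in [set p : 'rV[rat]_m * nat | ball (ratrow p.1) (p.2.+1%:R^-1) `<=` U])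
      ball (ratrow p.1) (p.2.+1%:R^-1).
Proof.
move=> oU; apply/seteqP; split => [x Ux|x [p /= pU]]; last exact: pU.
move: (oU); rewrite openE => /(_ x Ux) /nbhs_ballP[e /= e0 he].
have [k hk] : exists k : nat, k.+1%:R^-1 < e / 2.
  have /archimedean.Num.Theory.archi_boundP h0 : 0 <= (e / 2)^-1 by rewrite invr_ge0 divr_ge0 ?ltW.
  exists (Num.bound (e / 2)^-1); rewrite invf_plt ?posrE ?divr_gt0//.
  by apply: lt_trans h0 _; rewrite ltr_nat.
have k0 : 0 < (k.+1%:R^-1 : R) by rewrite invr_gt0.
have [q hq] := ratrow_dense x k0.
exists (q, k) => /=.
  move=> y; rewrite mx_norm_ball /ball_/= => qy; apply: he; rewrite mx_norm_ball /ball_/=.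
  rewrite -(subrKA (ratrow q)) (le_lt_trans (ler_normD _ _))//.
  by apply: lt_trans (ltrD hq qy) _; rewrite [ltRHS]splitr; exact: ltrD.
by rewrite mx_norm_ball /ball_/= distrC.
Qed.

Definition cons_row m (z : R * 'rV[R]_m) : 'rV[R]_m.+1 :=
  @row_mx R 1 1 m (const_mx z.1) z.2.

Lemma cons_row0 m (z : R * 'rV[R]_m) : cons_row z 0 ord0 = z.1.
Proof.
rewrite /cons_row (_ : ord0 = lshift m (0 : 'I_1)); last exact/val_inj.
by rewrite (@row_mxEl R 1 1 m) mxE.
Qed.

Lemma cons_rowS m (z : R * 'rV[R]_m) (j : 'I_m) : cons_row z 0 (lift ord0 j) = z.2 0 j.
Proof.
rewrite /cons_row (_ : lift ord0 j = rshift 1 j); last exact/val_inj.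
by rewrite (@row_mxEr R 1 1 m).
Qed.

Lemma rsubmx_lift m (p : 'rV[R]_m.+1) (j : 'I_m) :
  @rsubmx R 1 1 m p 0 j = p 0 (lift ord0 j).
Proof. by rewrite mxE; congr (p _ _); apply/val_inj. Qed.

Lemma cons_row_eta m (p : 'rV[R]_m.+1) : p = cons_row (p 0 ord0, @rsubmx R 1 1 m p).
Proof.
apply/rowP => i; case: (unliftP ord0 i) => [j ->|->].
  by rewrite cons_rowS rsubmx_lift.
by rewrite cons_row0.
Qed.

Lemma cons_row_ball m (p : 'rV[R]_m.+1) (e : R) (z : R * 'rV[R]_m) : 0 < e ->
  ball p e (cons_row z) <->
  ball (p 0 ord0) e z.1 /\ ball (@rsubmx R 1 1 m p) e z.2.
Proof.
move=> e0; split.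
  rewrite /ball/=/mx_ball => -[_ h]; split.
    by have := h 0 ord0; rewrite cons_row0.
  by split=> // i j; have := h i (lift ord0 j); rewrite (ord1 i) cons_rowS rsubmx_lift.
move=> [h1 [_ h2]]; rewrite /ball/=/mx_ball; split=> // i j; rewrite (ord1 i).
case: (unliftP ord0 j) => [k ->|->]; last by rewrite cons_row0.
by rewrite cons_rowS -rsubmx_lift.
Qed.

(** In the sup norm the preimage of a ball is a product of two balls, and [open_ratballs] reduces
    open sets to countably many balls. *)
Lemma measurable_cons_row m :
  measurable_fun setT (@cons_row m : measurableTypeR R * borel_rV m -> borel_rV m.+1).
Proof.
apply: (@measurability _ _ _ (borel_rV m.+1) _ _ (@open 'rV[R]_m.+1)) => //.
move=> _ [U oU <-]; rewrite setTI (open_ratballs oU).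
rewrite preimage_bigcup bigcup_mkcond.
apply: countable_bigcupT_measurable; first exact: countableP.
move=> [q k]; case: ifPn => // _ /=.
have k0 : 0 < (k.+1%:R^-1 : R) by rewrite invr_gt0.
rewrite (_ : _ @^-1` _ = (ball (ratrow q 0 ord0) k.+1%:R^-1) `*`
    (ball (@rsubmx R 1 1 m (ratrow q)) k.+1%:R^-1)).
  apply: measurableX; first exact: measurable_ball.
  by apply: open_measurable_rV; exact: ball_open.
by apply/seteqP; split => z /=; move/(cons_row_ball _ _ k0).
Qed.

HB.instance Definition _ m := isMeasurableFun.Build _ _ _ _
  (@cons_row m : measurableTypeR R * borel_rV m -> borel_rV m.+1) (@measurable_cons_row m).

Definition unifR : probability (measurableTypeR R) R := uniform_prob (@ltr01 R).

(** The uniform law on the unit cube, built by the same recursion as [cube_int]; as a probability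
    measure it gives access to Tonelli, Fatou and dominated convergence. *)
Fixpoint cubeP (m : nat) : probability (borel_rV m) R :=
  match m with
  | 0%N => @dirac _ (borel_rV 0) (0 : 'rV[R]_0) R
  | m'.+1 => distribution (unifR \x cubeP m')%E (@cons_row m')
  end.

Lemma integral_cubeP0 (f : borel_rV 0 -> \bar R) : measurable_fun setT f ->
  (\int[cubeP 0]_x f x = f (0%R : 'rV[R]_0))%E.
Proof. by move=> mf; rewrite /= integral_dirac// diracT mul1e. Qed.

Lemma integral_cubePS m (f : borel_rV m.+1 -> \bar R) : measurable_fun setT f ->
  (forall x, 0 <= f x)%E ->
  (\int[cubeP m.+1]_x f x =
   \int[lebesgue_measure]_(t in `[0%R, 1%R]) \int[cubeP m]_y f (cons_row (t, y)))%E.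
Proof.
move=> mf f0; rewrite [LHS]ge0_integral_pushforward//.
rewrite preimage_setT.
have mfc := measurableT_comp mf (@measurable_cons_row m).
have fc0 z : (0 <= (f \o @cons_row m) z)%E by exact: f0.
rewrite (@fubini_tonelli1 _ _ _ _ _ unifR (cubeP m))// integral_uniform//.
- by rewrite subr0 invr1 mul1e; reflexivity.
- exact: (@measurable_fun_fubini_tonelli_F _ _ _ _ _ (cubeP m) (f \o @cons_row m)).
- by move=> t; apply: integral_ge0 => ? _; exact: fc0.
Qed.

Lemma measurable_section m (f : borel_rV m.+1 -> \bar R) (t : R) :
  measurable_fun setT f -> measurable_fun setT ((fun y => f (cons_row (t, y))) : borel_rV m -> \bar R).
Proof.
move=> mf; apply: (measurableT_comp mf).
by apply: (measurableT_comp (@measurable_cons_row m)); exact: measurable_pair1.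
Qed.

Lemma cube_intE m (f : borel_rV m -> \bar R) : measurable_fun setT f ->
  (forall x, 0 <= f x)%E -> (cube_int f = \int[cubeP m]_x f x)%E.
Proof.
elim: m f => [|m IH] f mf f0; first by rewrite integral_cubeP0.
rewrite integral_cubePS//=; apply: eq_integral => t _.
by rewrite (IH (fun y => f (cons_row (t, y))))//; exact: measurable_section.
Qed.

End BorelRow.

(** * Almost everywhere differentiability and changes of variable on the line *)

Section LineLebesgue.
Variable R : realType.
Local Notation mu := (@lebesgue_measure R).

(** Slopes lie in [0, c], so that both [g] and [c * x - g x] are cumulative functions of Stieltjes
    measures. *)
Definition monotone_lipschitz (c : R) (g : R -> R) :=
  forall x y, x <= y -> 0 <= g y - g x <= c * (y - x).

Lemma monotone_lipschitz_nd c g : monotone_lipschitz c g -> {homo g : x y / x <= y}.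
Proof. by move=> h x y /h /andP[]; rewrite subr_ge0. Qed.

Lemma monotone_lipschitz_rc c g : monotone_lipschitz c g -> right_continuous g.
Proof.
move=> h; apply/right_continuousW => x.
apply/cvgrPdist_le => e e0; near=> y.
have hc : `|g x - g y| <= `|c| * `|x - y|.
  have [xy|/ltW yx] := leP x y.
    have /andP[h1 h2] := h _ _ xy.
    rewrite distrC ger0_norm// (le_trans h2)// distrC (ger0_norm (_ : 0 <= y - x)) ?subr_ge0//.
    by rewrite ler_wpM2r ?subr_ge0 ?ler_norm.
  have /andP[h1 h2] := h _ _ yx.
  rewrite ger0_norm// (le_trans h2)// (ger0_norm (_ : 0 <= x - y)) ?subr_ge0//.
  by rewrite ler_wpM2r ?subr_ge0 ?ler_norm.
apply: (le_trans hc).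
have : `|x - y| <= e / (`|c| + 1).
  near: y; apply: (@cvgr_dist_le _ _ _ (nbhs x) _ id x); [exact: cvg_id|by rewrite divr_gt0 ?ltr_wpDl].
rewrite ler_pdivlMr ?ltr_wpDl// mulrDr mulr1 mulrC => he.
by apply: le_trans he; rewrite lerDl.
Unshelve. all: by end_near. Qed.

Section MonotoneLipschitz.
Variables (c : R) (g : R -> R) (gh : monotone_lipschitz c g).

Let g_ : R -> R := g.
HB.instance Definition _ := isCumulative.Build R _ R g_
  (monotone_lipschitz_nd gh) (monotone_lipschitz_rc gh).

Let g' x := c * x - g x.
Let g'h : monotone_lipschitz c g'.
Proof.
by move=> x y /gh /andP[h1 h2]; rewrite /g'; apply/andP; split; lra.
Qed.
HB.instance Definition _ := isCumulative.Build R _ R g'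
  (monotone_lipschitz_nd g'h) (monotone_lipschitz_rc g'h).

Let c_ge0 : 0 <= c.
Proof. by have /andP[h1 h2] := gh (@ler01 R); move: (le_trans h1 h2); rewrite subr0 mulr1. Qed.

Let ls_itv (f : cumulative R R) (a b : R) : a <= b ->
  lebesgue_stieltjes_measure f `]a, b]%classic = (f b - f a)%:E.
Proof.
move=> ab; rewrite /lebesgue_stieltjes_measure /measure_extension measurable_mu_extE//=.
  exact: wlength_itv_bnd.
exact: is_ocitv.
Qed.

Let nu := lebesgue_stieltjes_measure g_.

(** The Stieltjes measures of [g] and of [g'] add up to [c] times the Lebesgue measure, by
    uniqueness on half-open intervals, and the second one is nonnegative. *)
Let nu_le A : measurable A -> (nu A <= c%:E * mu A)%E.
Proof.
move=> mA.
pose nn : {nonneg R} := NngNum c_ge0.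
pose cid x := c * x.
have cidh : monotone_lipschitz c cid.
  by move=> x y xy; rewrite /cid -mulrBr lexx andbT mulr_ge0// subr_ge0.
pose cidm := isCumulative.Build R _ R cid (monotone_lipschitz_nd cidh) (monotone_lipschitz_rc cidh).
pose cidc : cumulative R R := HB.pack cid cidm.
have E1 : forall A, measurable A -> lebesgue_stieltjes_measure cidc A = mscale nn mu A.
  apply: lebesgue_stieltjes_measure_unique => X [[a b] _ <-]/=.
  rewrite /mscale/= lebesgue_measure_itv/= lte_fin.
  have [ab|ba] := ltP a b.
    by rewrite ls_itv ?(ltW ab)// /cidc/= /cid -mulrBr EFinM.
  rewrite mule0 set_itv_ge ?measure0// -leNgt bnd_simp//.
have E2 : forall A, measurable A -> lebesgue_stieltjes_measure cidc A =
    measure_add nu (lebesgue_stieltjes_measure g') A.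
  apply: lebesgue_stieltjes_measure_unique => X [[a b] _ <-].
  rewrite [RHS]measure_addE /nu [(_, _).1]/= [(_, _).2]/=.
  have [ab|ba] := ltP a b.
    rewrite /= !ls_itv ?(ltW ab)// -EFinD; congr (_%:E).
    by rewrite /cidc/= /cid /g' /g_; ring.
  by rewrite set_itv_ge ?measure0 ?adde0// -leNgt bnd_simp//.
have := E1 _ mA; rewrite E2// measure_addE /mscale/= => <-.
by rewrite leeDl.
Qed.

(** The bound [nu_le] makes [nu] absolutely continuous on the interval; its Radon-Nikodym density
    has [g - g a] as a primitive, and the fundamental theorem of calculus differentiates that
    primitive almost everywhere. *)
Lemma monotone_lipschitz_ae_derivable (a b : R) :
  {ae mu, forall x, a < x -> x < b -> derivable g x 1}.
Proof.
have [ba|ab] := leP b a.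
  by apply/aeW => x ax xb; have := lt_trans ax xb; rewrite ltNge ba.
pose D : set R := `]a, b]%classic.
have mD : measurable (D : set (measurableTypeR R)) by exact: measurable_itv.
have Dfin : (nu D < +oo)%E by rewrite /nu ls_itv ?ltry// ltW.
pose rho := mfrestr mD Dfin.
have rhomu : rho `<< mu.
  apply/null_content_dominatesP => A mA A0; rewrite /rho /mfrestr /mrestr /=.
  apply/eqP; rewrite eq_le measure_ge0 andbT.
  have mAD : measurable (A `&` D) by exact: measurableI.
  apply: (le_trans (nu_le mAD)).
  suff -> : mu (A `&` D) = 0 by rewrite mule0.
  by apply/eqP; rewrite eq_le measure_ge0 andbT -A0 le_measure// inE.
have [f [f0 ffin fint frho]] := radon_nikodym_sigma_finite rhomu.
have finE : EFin \o (fine \o f) = f.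
  by apply/funext => x /=; rewrite fineK.
have H1 : forall y, mu.-integrable [set` Interval (BRight a) (BRight y)] (EFin \o (fine \o f)).
  by move=> y; rewrite finE; apply: integrableS fint.
have H2 : locally_integrable setT (fine \o f).
  by apply: open_integrable_locally; [exact: openT|rewrite finE].
have := FTC1 H1 H2; apply: (@filterS _ _ (ae_filter_ringOfSetsType mu)).
move=> x h ax xb; have [dF _] := h ax.
have : derivable (fun x => (\int[mu]_(t in [set` Interval (BRight a) (BRight x)]) ((fine \o f) t)) + g a) x 1.
  by apply: derivableD; [exact: dF|exact: derivable_cst].
apply: near_eq_derivable; near=> y.
have ay : a < y by near: y; exact: lt_nbhsr.
have yb : y < b by near: y; exact: lt_nbhsl.
have rhoE : rho `]a, y]%classic = nu `]a, y]%classic.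
  change (nu (`]a, y]%classic `&` D) = nu `]a, y]%classic); congr nu; apply: setIidl.
  move=> z; rewrite /D /= !in_itv/= => /andP[-> zy]/=.
  exact: le_trans zy (ltW yb).
rewrite /Rintegral (eq_integral f) => [|z _]; last by rewrite /= fineK.
rewrite -frho; last exact: measurable_itv.
rewrite [X in fine X](_ : _ = nu `]a, y]%classic); last exact: rhoE.
rewrite /nu ls_itv ?(ltW ay)//=.
by rewrite subrK.
Unshelve. all: by end_near. Qed.

End MonotoneLipschitz.

(** Adding [L * x] to [f] gives a function with slopes between 0 and [L + L]. *)
Lemma lipschitz_ae_derivable (L : R) (f : R -> R) (a b : R) :
  (forall x y, `|f x - f y| <= L * `|x - y|) ->
  {ae mu, forall x, a < x -> x < b -> derivable f x 1}.
Proof.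
move=> fL; pose g x := f x + L * x.
have gh : monotone_lipschitz (L + L) g.
  move=> x y xy; have := fL y x; rewrite (ger0_norm (_ : 0 <= y - x)) ?subr_ge0//.
  rewrite ler_norml => /andP[h1 h2]; rewrite /g; apply/andP; split; lra.
have := monotone_lipschitz_ae_derivable gh a b.
apply: (@filterS _ _ (ae_filter_ringOfSetsType mu)) => x h ax xb.
rewrite (_ : f = g \- (fun x => L * x)); last by apply/funext => y; rewrite /g/= addrK.
by apply: derivableB; [exact: h|apply: derivableM => //; exact: derivable_cst].
Qed.

Lemma measurable_affine (a b : R) :
  measurable_fun setT ((fun x => a * x + b) : measurableTypeR R -> measurableTypeR R).
Proof. by apply: measurable_funD; [exact: measurable_funM|exact: measurable_cst]. Qed.

Lemma lebesgue_affine (a b : R) (A : set (measurableTypeR R)) : 0 < a -> measurable A ->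
  (a%:E * mu ((fun x => a * x + b)%R @^-1` A) = mu A)%E.
Proof.
move=> a0 mA.
have mT := measurable_affine a b.
pose nn : {nonneg R} := NngNum (ltW a0).
pose nu := mscale nn (pushforward mu ((fun x => a * x + b) : measurableTypeR R -> measurableTypeR R)).
have -> : (a%:E * mu ((fun x => a * x + b)%R @^-1` A) = nu mT A)%E by [].
apply/esym; apply: lebesgue_measure_unique => // X [[x y] _ <-]/=.
rewrite /mscale/= /pushforward (_ : _ @^-1` _ = `](x - b) / a, (y - b) / a]%classic); last first.
  apply/seteqP; split => z /=; rewrite !in_itv/=.
    by rewrite ltr_pdivrMr// ler_pdivlMr// ltrBlDr lerBrDr mulrC.
  by rewrite ltr_pdivrMr// ler_pdivlMr// ltrBlDr lerBrDr mulrC.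
rewrite !lebesgue_measure_itv/= !lte_fin ltr_pM2r ?invr_gt0// ltrD2r; case: ltP => // _.
  by rewrite -EFinD -EFinM -mulrBl mulrCA mulfV ?gt_eqF// mulr1 opprB addrA subrK.
by rewrite mule0.
Qed.

Lemma integral_affine (a b : R) (D : set (measurableTypeR R)) (f : measurableTypeR R -> \bar R) :
  0 < a -> measurable D -> measurable_fun setT f -> (forall x, 0 <= f x)%E ->
  (a%:E * \int[mu]_(x in (fun x : R => (a * x + b)%R) @^-1` D) f (a * x + b)%R = \int[mu]_(x in D) f x)%E.
Proof.
move=> a0 mD mf f0.
have mT := measurable_affine a b.
pose nn : {nonneg R} := NngNum (ltW a0).
rewrite -(ge0_integral_pushforward mT mu)//; last exact: measurable_funTS.
rewrite -(@ge0_integral_mscale _ _ _ _ _ mD nn)//; last exact: measurable_funTS.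
apply: eq_measure_integral => A mA _.
by rewrite /mscale/= /pushforward [LHS](lebesgue_affine b a0 mA).
Qed.

Lemma integral_translation (a : R) (D : set (measurableTypeR R)) (f : measurableTypeR R -> \bar R) :
  measurable D -> measurable_fun setT f -> (forall x, 0 <= f x)%E ->
  (\int[mu]_(x in (fun x : R => (x + a)%R) @^-1` D) f (x + a)%R = \int[mu]_(x in D) f x)%E.
Proof.
move=> mD mf f0; rewrite -(integral_affine a ltr01 mD mf f0) mul1e.
rewrite (_ : _ @^-1` D = (fun x : R => x + a) @^-1` D); last first.
  by apply/funext => x /=; rewrite mul1r.
by apply: eq_integral => x _; rewrite mul1r.
Qed.

Lemma integral_opp (D : set (measurableTypeR R)) (f : measurableTypeR R -> \bar R) :
  measurable D -> measurable_fun setT f -> (forall x, 0 <= f x)%E ->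
  (\int[mu]_(x in (fun x : R => - x)%R @^-1` D) f (- (x : R))%R = \int[mu]_(x in D) f x)%E.
Proof.
move=> mD mf f0.
have mT : measurable_fun setT ((fun x => - x) : measurableTypeR R -> measurableTypeR R).
  exact: oppr_measurable.
rewrite -(ge0_integral_pushforward mT mu)//; last exact: measurable_funTS.
apply: eq_measure_integral => A mA _.
apply/esym; apply: lebesgue_measure_unique => // X [[x y] _ <-]/=.
rewrite /pushforward (_ : _ @^-1` _ = `[- y, - x[%classic); last first.
  by apply/seteqP; split => z /=; rewrite !in_itv/= lerNl ltrNr andbC.
by rewrite !lebesgue_measure_itv/= !lte_fin ltrN2 -!EFinD opprK addrC.
Qed.

Lemma integral_unit_periodic (a : R) (f : measurableTypeR R -> \bar R) :
  measurable_fun setT f -> (forall x, 0 <= f x)%E -> (forall x (k : int), f (x + k%:~R) = f x) ->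
  (\int[mu]_(x in `[0%R, 1%R]) f (x + a)%R = \int[mu]_(x in `[0%R, 1%R]) f x)%E.
Proof.
move=> mf f0 fper.
(* Periodicity lets [a] be replaced by its fractional part; the interval [a, a + 1] is then cut at 1
   and its right piece moved back by one. *)
wlog : a / 0 <= a <= 1.
  move=> H; rewrite -(H (a - (Num.floor a)%:~R)).
    apply: eq_integral => x _; rewrite -[in RHS](fper _ (Num.floor a)); congr f.
    by rewrite -addrA subrK.
  have := floor_le a; have := floorD1_gt a; rewrite intrD => h1 h2.
  by apply/andP; split; [rewrite subr_ge0|rewrite lerBlDl ltW].
move=> /andP[a0 a1].
have E1 : (\int[mu]_(x in `[0%R, 1%R]) f (x + a)%R = \int[mu]_(x in `[a, (a + 1)%R]) f x)%E.
  rewrite -[RHS](integral_translation a)//.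
  rewrite (_ : _ @^-1` _ = `[0, 1]%classic)//.
  by apply/seteqP; split => x /=; rewrite !in_itv/=;
    move=> /andP[? ?]; apply/andP; split; lra.
have splitI (x y z : R) : x <= y -> y <= z ->
   (\int[mu]_(t in `[x, z]) f t = \int[mu]_(t in `[x, y[) f t + \int[mu]_(t in `[y, z]) f t)%E.
  move=> xy yz; rewrite -ge0_integral_setU//=.
  - by congr (integral _ _ _); rewrite -itv_bndbnd_setU// bnd_simp.
  - exact: measurable_funTS.
  - apply/disj_setPS => t /=; rewrite !in_itv/= => -[/andP[_ h1] /andP[h2 _]].
    by have := lt_le_trans h1 h2; rewrite ltxx.
rewrite E1 (splitI a 1 (a + 1)) ?lerDr//.
rewrite (splitI 0 a 1)// addeC; congr (_ + _)%E.
  rewrite -[LHS](integral_translation 1)//.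
  rewrite [RHS]integral_itv_bndo_bndc; last exact: measurable_funTS.
  rewrite (_ : _ @^-1` _ = `[0, a]%classic); last first.
    by apply/seteqP; split => x /=; rewrite !in_itv/=;
      move=> /andP[? ?]; apply/andP; split; lra.
  by apply: eq_integral => x _; exact: (fper x 1).
by rewrite integral_itv_bndo_bndc//; exact: measurable_funTS.
Qed.

End LineLebesgue.

(** * Slices, translations and null sets of the cube *)

Section CubeMeasure.
Variable R : realType.
Local Notation mu := (@lebesgue_measure R).

Lemma tmeasE m (A : set 'rV[R]_m) : measurable (A : set (borel_rV R m)) ->
  tmeas A = cubeP R m A.
Proof.
move=> mA; rewrite /tmeas (@cube_intE R m (fun x => (\1_A x)%:E))//.
  by rewrite integral_indic// setIT.
exact/measurable_EFinP/measurable_indic.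
Qed.

Lemma measurable_cube_slice m (f : borel_rV R m.+1 -> \bar R) : measurable_fun setT f ->
  (forall x, 0 <= f x)%E ->
  measurable_fun setT ((fun t => \int[cubeP R m]_y f (cons_row (t, y)))%E : measurableTypeR R -> \bar R).
Proof.
move=> mf f0.
apply: (@measurable_fun_fubini_tonelli_F _ _ _ _ _ (cubeP R m) (f \o @cons_row R m)) => //.
  exact: measurableT_comp mf (@measurable_cons_row R m).
by move=> z; exact: f0.
Qed.

Lemma cons_rowD m (z w : R * 'rV[R]_m) : cons_row z + cons_row w = cons_row (z.1 + w.1, z.2 + w.2).
Proof.
apply/rowP => i; rewrite mxE; case: (unliftP ord0 i) => [j ->|->].
  by rewrite !cons_rowS mxE.
by rewrite !cons_row0.
Qed.

Lemma add_ecoordE m (x : 'rV[R]_m) (s : R) (i k : 'I_m) :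
  (x + s *: ecoord R i) 0 k = x 0 k + s * (k == i)%:R.
Proof. by rewrite !mxE. Qed.

Lemma cons_row_ecoord0 m (t : R) (y : 'rV[R]_m) :
  cons_row (t, y) = cons_row (0, y) + t *: ecoord R ord0.
Proof.
apply/rowP => i; rewrite add_ecoordE.
case: (unliftP ord0 i) => [j ->|->].
  by rewrite !cons_rowS eq_sym (negbTE (neq_lift _ _)) mulr0 addr0.
by rewrite !cons_row0 eqxx mulr1 add0r.
Qed.

Lemma cons_row_ecoordS m (t s : R) (y : 'rV[R]_m) (j : 'I_m) :
  cons_row (t, y + s *: ecoord R j) = cons_row (t, y) + s *: ecoord R (lift ord0 j).
Proof.
apply/rowP => i; rewrite add_ecoordE.
case: (unliftP ord0 i) => [k ->|->].
  by rewrite !cons_rowS add_ecoordE (inj_eq lift_inj).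
by rewrite !cons_row0 (negbTE (neq_lift _ _)) mulr0 addr0.
Qed.

Lemma cons_row_intvec m (k : int) (z : 'rV[int]_m) :
  intvec R (@row_mx int 1 1 m (const_mx k) z) = cons_row (k%:~R, intvec R z).
Proof.
apply/rowP => i; rewrite mxE; case: (unliftP ord0 i) => [j ->|->].
  rewrite cons_rowS [RHS]mxE (_ : lift ord0 j = rshift 1 j); last exact/val_inj.
  by rewrite (@row_mxEr int 1 1 m).
rewrite cons_row0 (_ : ord0 = lshift m (0 : 'I_1)); last exact/val_inj.
by rewrite (@row_mxEl int 1 1 m) mxE.
Qed.

Lemma measurable_addr_rV m (a : 'rV[R]_m) :
  measurable_fun setT ((fun x => x + a) : borel_rV R m -> borel_rV R m).
Proof.
apply: continuous_measurable_rVrV; apply: continuous_rV_enorm => x e e0; exists e => // y yx.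
by rewrite opprD addrACA subrr addr0 (le_lt_trans (norm_le_enorm _)).
Qed.

(** One coordinate at a time: the induction hypothesis translates the tail and
    [integral_unit_periodic] the first coordinate. *)
Lemma integral_cubeP_periodic m (f : borel_rV R m -> \bar R) (a : 'rV[R]_m) :
  measurable_fun setT f -> (forall x, 0 <= f x)%E -> periodic_fun f ->
  (\int[cubeP R m]_x f (x + a)%R = \int[cubeP R m]_x f x)%E.
Proof.
elim: m f a => [|m IH] f a mf f0 fper.
  by apply: eq_integral => x _; congr f; apply/rowP => -[].
have mfa : measurable_fun setT ((fun x => f (x + a)) : borel_rV R m.+1 -> \bar R).
  exact: measurableT_comp mf (measurable_addr_rV a).
have fa0 (x : borel_rV R m.+1) : (0 <= f (x + a)%R)%E by exact: f0.
rewrite (integral_cubePS mfa fa0) (integral_cubePS mf f0).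
pose g t := (\int[cubeP R m]_y f (cons_row (t, y)))%E.
have per1 t y (k : int) : f (cons_row (t + k%:~R, y)) = f (cons_row (t, y)).
  rewrite -(fper (@row_mx int 1 1 m (const_mx k) 0) (cons_row (t, y))).
  by rewrite cons_row_intvec cons_rowD /= (_ : intvec R 0 = 0) ?addr0//; apply/rowP => i; rewrite !mxE.
have per2 t y (z : 'rV[int]_m) : f (cons_row (t, y + intvec R z)) = f (cons_row (t, y)).
  rewrite -(fper (@row_mx int 1 1 m (const_mx 0) z) (cons_row (t, y))).
  by rewrite cons_row_intvec cons_rowD /= addr0.
rewrite -[RHS](@integral_unit_periodic R (a 0 ord0) g).
- apply: eq_integral => t _; rewrite /g.
  pose a' : 'rV[R]_m := @rsubmx R 1 1 m a.
  rewrite -(IH (fun y => f (cons_row (t + a 0 ord0, y))) a')//.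
  + by apply: eq_integral => y _; rewrite {1}(cons_row_eta a) cons_rowD.
  + exact: measurable_section.
- exact: measurable_cube_slice.
- by move=> t; apply: integral_ge0.
- by move=> t k; apply: eq_integral => y _; exact: per1.
Qed.

Lemma measurable_cons_row_section m (A : set (borel_rV R m.+1)) t : measurable A ->
  measurable ([set y | A (cons_row (t, y))] : set (borel_rV R m)).
Proof.
move=> mA.
have mf : measurable_fun setT ((fun y => cons_row (t, y)) : borel_rV R m -> borel_rV R m.+1).
  by apply: (measurableT_comp (@measurable_cons_row R m)); exact: measurable_pair1.
by have := mf measurableT _ mA; rewrite setTI.
Qed.

Lemma cubePS m (A : set (borel_rV R m.+1)) : measurable A ->
  cubeP R m.+1 A =
  (\int[mu]_(t in `[0%R, 1%R]) cubeP R m [set y | A (cons_row (t, y))])%E.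
Proof.
move=> mA; rewrite -[in LHS](setIT A) -integral_indic// integral_cubePS//.
  apply: eq_integral => t _.
  rewrite (_ : (fun y => _) = (fun y => (\1_[set y | A (cons_row (t, y))] y)%:E)); last first.
    by apply/funext => y; rewrite !indicE.
  rewrite integral_indic ?setIT//; exact: measurable_cons_row_section.
exact/measurable_EFinP/measurable_indic.
Qed.

(** Fubini with direction [i] innermost: the induction peels off leading coordinates until [i] is
    the first one. *)
Lemma cubeP_null_lines m (A : set (borel_rV R m)) (i : 'I_m) : measurable A ->
  (forall x : 'rV[R]_m, mu [set s : R | 0 <= s <= 1 /\ A (x + s *: ecoord R i)] = 0%E) ->
  cubeP R m A = 0%E.
Proof.
elim: m A i => [|m IH] A i mA; first by case: i.
case: (unliftP ord0 i) => [j ->|->] h.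
  rewrite cubePS//; apply: integral0_eq => t _; apply: (IH _ j).
    exact: measurable_cons_row_section.
  move=> y; rewrite -[RHS](h (cons_row (t, y))); congr (mu _).
  by apply/seteqP; split => s /=; rewrite cons_row_ecoordS.
have mI : measurable_fun setT ((fun z => (\1_A (cons_row z))%:E) : measurableTypeR R * borel_rV R m -> \bar R).
  apply/measurable_EFinP; apply: (measurableT_comp (measurable_indic mA)).
  exact: (@measurable_cons_row R m).
rewrite -(setIT A) -integral_indic//.
rewrite [LHS]ge0_integral_pushforward//; last exact/measurable_EFinP/measurable_indic.
rewrite preimage_setT.
(* Tonelli in the other order, so that the inner integral runs along the first coordinate. *)
rewrite (@fubini_tonelli2 _ _ _ _ _ (unifR R) (cubeP R m) _ mI)//.
apply: integral0_eq => y _; rewrite /fubini_G integral_uniform//; last first.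
  exact: (measurableT_comp mI (measurable_pair2 y)).
rewrite subr0 invr1 mul1e -[RHS](h (cons_row (0, y))).
rewrite (eq_integral (fun t => (\1_[set t : measurableTypeR R | A (cons_row (t, y))] t)%:E)) => [|t _]; last first.
  by rewrite !indicE.
have mS : measurable [set t : measurableTypeR R | A (cons_row (t, y))].
  have mc := measurableT_comp (@measurable_cons_row R m) (measurable_pair2 y).
  by have := mc measurableT _ mA; rewrite setTI.
rewrite integral_indic//; congr (mu _); apply/seteqP; split => t /=; rewrite -cons_row_ecoord0 in_itv/=.
  by move=> [? ?].
by move=> [? ?].
Qed.

End CubeMeasure.

(** * Volumes of boxes, grid cells and balls *)

Section BoxesAndBalls.
Variable R : realType.
Local Notation mu := (@lebesgue_measure R).

Definition box m (a b : 'I_m -> R) : set 'rV[R]_m :=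
  [set x | forall i, a i <= x 0 i /\ x 0 i < b i].

Lemma coord_continuous_rV m (i : 'I_m) : continuous (fun x : 'rV[R]_m => x 0 i).
Proof.
apply/continuous_enormP => x e e0; exists e => // y yx; apply: le_lt_trans yx.
by have := coord_le_enorm (y - x) i; rewrite !mxE.
Qed.

Lemma measurable_coord m (i : 'I_m) : measurable_fun setT ((fun x => x 0 i) : borel_rV R m -> R).
Proof. by apply: continuous_measurable_rV; exact: coord_continuous_rV. Qed.

Lemma measurable_box m (a b : 'I_m -> R) : measurable (box a b : set (borel_rV R m)).
Proof.
have -> : box a b = \bigcap_(i in [set: 'I_m]) ((fun x : borel_rV R m => x 0 i) @^-1` `[a i, b i[%classic).
  apply/seteqP; split => [x h i _|x h i]; first by rewrite /= in_itv/=; apply/andP; exact: h.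
  by have := h i I; rewrite /= in_itv/= => /andP.
apply: fin_bigcap_measurable => [|i _]; first exact: finite_finset.
by rewrite -[X in measurable X]setTI; apply: measurable_coord => //; exact: measurable_itv.
Qed.

Lemma cons_row_box m (a b : 'I_m.+1 -> R) (t : R) (y : 'rV[R]_m) :
  box a b (cons_row (t, y)) <->
  (a ord0 <= t /\ t < b ord0) /\ box (fun i => a (lift ord0 i)) (fun i => b (lift ord0 i)) y.
Proof.
split=> [h|[h1 h2] i].
  by split=> [|i]; [have := h ord0|have := h (lift ord0 i)]; rewrite ?cons_row0 ?cons_rowS.
by case: (unliftP ord0 i) => [j ->|->]; rewrite ?cons_row0 ?cons_rowS.
Qed.

Lemma cubeP_box m (a b : 'I_m -> R) :
  (forall i, 0 <= a i /\ a i <= b i /\ b i <= 1) ->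
  cubeP R m (box a b) = (\prod_(i < m) (b i - a i))%:E.
Proof.
elim: m a b => [|m IH] a b h.
  rewrite big_ord0 /= diracE (_ : _ \in _ = true)//.
  by apply/mem_set => -[].
rewrite cubePS; last exact: measurable_box.
set a' := fun i => a (lift ord0 i); set b' := fun i => b (lift ord0 i).
have [h1 [h2 h3]] := h ord0.
rewrite (eq_integral (fun t => (\prod_(i < m) (b' i - a' i))%:E * (\1_(`[a ord0, b ord0[%classic : set (measurableTypeR R)) t)%:E)%E) => [|t _]; last first.
  rewrite indicE; have [tab|tab] := boolP (t \in _).
    rewrite mule1 -IH => [|i]; last exact: h.
    move: tab; rewrite inE/= in_itv/= => /andP[t1 t2].
    congr (cubeP R m _); apply/seteqP; split => y /=; first by case/cons_row_box.
    by move=> hy; apply/cons_row_box.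
  rewrite mule0 (_ : [set y | _] = set0) ?measure0//.
  apply/seteqP; split => y //= /cons_row_box[[t1 t2] _]; move/negP: tab; apply.
  by rewrite inE/= in_itv/= t1 t2.
rewrite ge0_integralZl//; last 2 first.
- exact/measurable_funTS/measurable_EFinP/measurable_indic.
- by rewrite lee_fin; apply: prodr_ge0 => i _; have [_ []] := h (lift ord0 i); rewrite subr_ge0.
rewrite integral_indic// setIidl; last first.
  move=> t /=; rewrite !in_itv/= => /andP[t1 t2]; apply/andP; split.
    exact: le_trans t1.
  exact: le_trans (ltW t2) _.
rewrite [X in (_ * X)%E]lebesgue_measure_itv/= lte_fin big_ord_recl.
have [ab|ba] := ltP (a ord0) (b ord0); first by rewrite -EFinD -EFinM mulrC.
have -> : b ord0 - a ord0 = 0 by apply/eqP; rewrite subr_eq0 eq_le h2 ba.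
by rewrite mule0 mul0r.
Qed.

Definition grid_cell m (M : nat) (k : 'I_m -> 'I_M) : set 'rV[R]_m :=
  box (fun i => (k i)%:R / M%:R) (fun i => (k i).+1%:R / M%:R).

Lemma cubeP_grid_cell m M (k : 'I_m -> 'I_M) : (0 < M)%N ->
  cubeP R m (grid_cell k) = ((M%:R^-1) ^+ m)%:E.
Proof.
move=> M0; have M0' : 0 < M%:R :> R by rewrite ltr0n.
rewrite cubeP_box => [|i].
  congr (_%:E); rewrite -[m in RHS]card_ord -prodr_const; apply: eq_bigr => i _.
  by rewrite -mulrBl -natr1 addrAC subrr add0r mul1r.
split; first by rewrite divr_ge0.
split; first by rewrite ler_pM2r ?invr_gt0// ler_nat.
by rewrite ler_pdivrMr// mul1r ler_nat ltn_ord.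
Qed.

Lemma grid_cell_ex m M (x : 'rV[R]_m) : (0 < M)%N -> unit_cube x ->
  exists k : {ffun 'I_m -> 'I_M}, grid_cell k x.
Proof.
move=> M0 hx; have M0' : 0 < M%:R :> R by rewrite ltr0n.
have lt i : (Num.truncn (x 0 i * M%:R)%R < M)%N.
  have [x0 x1] := hx i.
  have : (Num.truncn (x 0 i * M%:R))%:R <= x 0 i * M%:R by rewrite truncn_le mulr_ge0.
  by move=> h; rewrite -(ltr_nat R) (le_lt_trans h)// gtr_pMl.
exists [ffun i => Ordinal (lt i)] => i; rewrite !ffunE/=.
have [x0 x1] := hx i.
have xM : 0 <= x 0 i * M%:R by rewrite mulr_ge0.
split; first by rewrite ler_pdivrMr// truncn_le.
by rewrite ltr_pdivlMr//; have := truncnS_gt (x 0 i * M%:R).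
Qed.

Lemma grid_cell_inj m M (k k' : 'I_m -> 'I_M) x : (0 < M)%N ->
  grid_cell k x -> grid_cell k' x -> k =1 k'.
Proof.
move=> M0 h h' i; have M0' : 0 < M%:R :> R by rewrite ltr0n.
have [h1 h2] := h i; have [h3 h4] := h' i.
have := le_lt_trans h1 h4; have := le_lt_trans h3 h2.
rewrite !ltr_pM2r ?invr_gt0// !ltr_nat !ltnS => e1 e2.
by apply/val_inj/eqP; rewrite /= eqn_leq e1 e2.
Qed.

Lemma grid_cell_diam m M (k : 'I_m -> 'I_M) x y : (0 < M)%N ->
  grid_cell k x -> grid_cell k y -> enorm (x - y) <= m%:R / M%:R.
Proof.
move=> M0 h h'; have M0' : 0 < M%:R :> R by rewrite ltr0n.
apply: enorm_le_const; first by rewrite invr_ge0.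
move=> i; rewrite !mxE; have [] := h i; have [] := h' i.
rewrite -[(k i).+1]addn1 natrD mulrDl mul1r ler_norml => *; apply/andP; split; lra.
Qed.

Lemma unit_cube_shift m (x : 'rV[R]_m) : exists z : 'rV[int]_m, unit_cube (x + intvec R z).
Proof.
exists (\row_i - Num.floor (x 0 i)) => i; rewrite !mxE rmorphN/=.
by have := floor_le (x 0 i); have := floorD1_gt (x 0 i); rewrite intrD => ? ?; split; lra.
Qed.

(** Move a point of [U] into the unit cube by periodicity; a sufficiently fine grid cell containing
    it lies in [U]. *)
Lemma cubeP_open_gt0 m (U : set 'rV[R]_m) : open U -> U !=set0 -> periodic_set U ->
  (0 < cubeP R m U)%E.
Proof.
move=> oU [x0 Ux0] perU.
have [z hz] := unit_cube_shift x0; set x := x0 + _ in hz.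
have Ux : U x by apply/perU.
have [d d0 hd] := (open_enormP U).1 oU x Ux.
have [M hM] : exists M : nat, m%:R / M.+1%:R < d.
  have /archi_boundP h0 : 0 <= m%:R / d by rewrite divr_ge0// ltW.
  exists (Num.bound (m%:R / d)); rewrite ltr_pdivrMr// mulrC -ltr_pdivrMr//.
  by apply: lt_trans h0 _; rewrite ltr_nat.
have [k kx] := @grid_cell_ex m M.+1 x isT hz.
apply: (@lt_le_trans _ _ (cubeP R m (grid_cell k))).
  by rewrite cubeP_grid_cell// lte_fin exprn_gt0// invr_gt0.
apply: le_measure; rewrite ?inE.
- exact: measurable_box.
- exact: open_measurable_rV.
- by move=> y ky; apply: hd; apply: le_lt_trans hM; exact: grid_cell_diam kx.
Qed.

(** Since [cubeP] only sees the unit cube, this is the volume of the part of the unit ball in the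
    positive orthant; the whole ball is [2 ^+ m] times larger, see [omegaE]. *)
Definition ball_vol m : R := fine (cubeP R m [set x : 'rV[R]_m | enorm x <= 1]).

Lemma closed_enorm_ball m (x : 'rV[R]_m) (r : R) : closed [set y | enorm (y - x) <= r].
Proof. by apply: compact_closed; [exact: norm_hausdorff|exact: compact_enorm_ball]. Qed.

Lemma measurable_enorm_ball m (r : R) : measurable ([set y : 'rV[R]_m | enorm y <= r] : set (borel_rV R m)).
Proof.
apply: closed_measurable_rV; have := @closed_enorm_ball m 0 r.
by congr closed; apply/funext => y /=; rewrite subr0.
Qed.

Lemma sqr_enorm_cons m (t : R) (y : 'rV[R]_m) : enorm (cons_row (t, y)) ^+ 2 = t ^+ 2 + enorm y ^+ 2.
Proof.
rewrite !sqr_enorm /edot big_ord_recl cons_row0 -expr2; congr (_ + _).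
by apply: eq_bigr => i _; rewrite cons_rowS.
Qed.

(** The ratio of the orthant volumes of consecutive dimensions, obtained by slicing the ball
    orthogonally to an axis. It reappears in the co-area estimate, where it recombines into the ball
    volume. *)
Definition cap_int m : R := fine (\int[mu]_(t in `[0%R, 1%R]) (Num.sqrt (1 - t ^+ 2) ^+ m)%:E)%E.

Lemma measurable_cap (s : R) m :
  measurable_fun setT ((fun t => (Num.sqrt (s - t ^+ 2) ^+ m)%:E) : measurableTypeR R -> \bar R).
Proof.
apply/measurable_EFinP; apply: measurable_funX.
apply: (@measurableT_comp _ _ _ _ _ _ (@Num.sqrt R)).
  by apply: continuous_measurable_fun; exact: sqrt_continuous.
by apply: measurable_funB; [exact: measurable_cst|exact: measurable_funX].
Qed.

Lemma cap_intE m : (\int[mu]_(t in `[0%R, 1%R]) (Num.sqrt (1 - t ^+ 2) ^+ m)%:E)%E = (cap_int m)%:E.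
Proof.
rewrite fineK// ge0_fin_numE; last by apply: integral_ge0 => t _; rewrite lee_fin exprn_ge0// sqrtr_ge0.
apply: (@le_lt_trans _ _ (\int[mu]_(t in `[0%R, 1%R]) (cst 1 t)))%E.
  apply: ge0_le_integral => //=.
  - by apply: measurable_funTS; exact: measurable_cap.
  - move=> t _; rewrite lee_fin exprn_ile1 ?sqrtr_ge0//.
    by rewrite -[leRHS]sqrtr1 ler_wsqrtr// gerBl sqr_ge0.
by rewrite integral_cst//= mul1e lebesgue_measure_itv/= lte_fin ltr01 -EFinB ltry.
Qed.

(** The slice at height [t] is a ball of radius [Num.sqrt (s ^+ 2 - t ^+ 2)], and the substitution
    of [s * t] for [t] extracts the power of [s]. *)
Lemma cubeP_ball_step m : (forall s : R, 0 <= s <= 1 ->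
    cubeP R m [set x : 'rV[R]_m | enorm x <= s] = (s ^+ m * ball_vol m)%:E) ->
  forall s : R, 0 <= s <= 1 ->
    cubeP R m.+1 [set x : 'rV[R]_m.+1 | enorm x <= s] = (s ^+ m.+1 * (ball_vol m * cap_int m))%:E.
Proof.
move=> IH s /andP[s0 s1].
have bv0 : 0 <= ball_vol m by rewrite /ball_vol fine_ge0.
pose h (t : R) : \bar R := ((ball_vol m)%:E * (Num.sqrt (s ^+ 2 - t ^+ 2) ^+ m)%:E)%E.
have h0 t : (0 <= h t)%E by rewrite /h -EFinM lee_fin mulr_ge0// exprn_ge0// sqrtr_ge0.
have mh : measurable_fun setT (h : measurableTypeR R -> \bar R).
  by apply: measurable_funeM; exact: measurable_cap.
rewrite cubePS; last exact: measurable_enorm_ball.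
transitivity (\int[mu]_(t in `[0%R, s]) h t)%E.
  rewrite (_ : `[0, s]%classic = `[0, 1]%classic `&` `[0, s]%classic); last first.
    apply/seteqP; split => t /=; rewrite !in_itv/=; last by case.
    by move=> /andP[-> ts]; rewrite ts (le_trans ts s1).
  rewrite integral_mkcondr; apply: eq_integral => t; rewrite inE/= in_itv/= => /andP[t0 t1].
  rewrite patchE; case: ifPn => [|tn].
    rewrite inE/= in_itv/= => /andP[_ ts].
    have st : 0 <= s ^+ 2 - t ^+ 2 by rewrite subr_ge0 ler_sqr.
    rewrite (_ : [set y | _] = [set y | enorm y <= Num.sqrt (s ^+ 2 - t ^+ 2)]).
      rewrite IH; first by rewrite /h -EFinM mulrC.
      rewrite sqrtr_ge0/= -[leRHS]sqrtr1 ler_wsqrtr//.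
      by have := sqr_ge0 t; have : s ^+ 2 <= 1 by [rewrite exprn_ile1|]; lra.
    apply/seteqP; split => y /=.
      rewrite -(ler_sqr (enorm_ge0 _)) ?nnegrE// sqr_enorm_cons => hy.
      by rewrite -(ler_sqr (enorm_ge0 _)) ?nnegrE ?sqrtr_ge0// [leRHS]sqr_sqrtr// lerBrDl.
    rewrite -(ler_sqr (enorm_ge0 _)) ?nnegrE ?sqrtr_ge0// [leRHS]sqr_sqrtr// => hy.
    by rewrite -(ler_sqr (enorm_ge0 _)) ?nnegrE// sqr_enorm_cons -lerBrDl.
  rewrite (_ : [set y | _] = set0) ?measure0//; apply/seteqP; split => y //=.
  rewrite -(ler_sqr (enorm_ge0 _)) ?nnegrE// sqr_enorm_cons => hy.
  move/negP: tn; apply; rewrite inE/= in_itv/= t0/= -(ler_sqr t0) ?nnegrE//.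
  by apply: le_trans hy; rewrite lerDl sqr_ge0.
have [s00|sn0] := eqVneq s 0.
  by rewrite s00 set_itv1 integral_set1 expr0n mul0r.
have sp : 0 < s by rewrite lt_neqAle eq_sym sn0.
rewrite -(integral_affine 0 sp)//.
rewrite (_ : _ @^-1` _ = `[0, 1]%classic); last first.
  apply/seteqP; split => t /=; rewrite !in_itv/= addr0.
    by rewrite pmulr_rge0// ger_pMr.
  by rewrite pmulr_rge0// ger_pMr.
rewrite (eq_integral (fun t : measurableTypeR R => (s ^+ m * ball_vol m)%:E * (Num.sqrt (1 - (t : R) ^+ 2) ^+ m)%:E)%E) => [|t _]; last first.
  rewrite /h -!EFinM; congr (_%:E); rewrite addr0.
  rewrite -[in LHS](mulr1 (s ^+ 2)) exprMn -mulrBr sqrtrM ?sqr_ge0// sqrtr_sqr ger0_norm// exprMn; ring.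
rewrite ge0_integralZl//; last 2 first.
- by apply: measurable_funTS; exact: measurable_cap.
- by rewrite lee_fin mulr_ge0// exprn_ge0.
by rewrite cap_intE -!EFinM exprS; congr (_%:E); ring.
Qed.

Lemma cubeP_ball m (s : R) : 0 <= s <= 1 ->
  cubeP R m [set x : 'rV[R]_m | enorm x <= s] = (s ^+ m * ball_vol m)%:E.
Proof.
elim: m s => [s s01|m IH s s01].
  have h (r : R) : 0 <= r -> cubeP R 0 [set x : 'rV[R]_0 | enorm x <= r] = 1%E.
    by move=> r0; rewrite /= diracE (_ : _ \in _ = true)//; apply/mem_set; rewrite /= enorm0.
  by rewrite /ball_vol !h//= ?expr0 ?mulr1//; case/andP: s01.
have st := cubeP_ball_step IH.
by rewrite (st _ s01) [in RHS]/ball_vol st ?ler01 ?lexx// expr1n mul1r.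
Qed.

Lemma ball_volS m : ball_vol m.+1 = ball_vol m * cap_int m.
Proof.
rewrite [LHS]/ball_vol (cubeP_ball_step (@cubeP_ball m)) ?ler01 ?lexx//.
by rewrite expr1n mul1r.
Qed.

Lemma omegaE m : omega R m = 2 ^+ m * ball_vol m.
Proof.
rewrite /omega /ball_vol; congr (_ * fine _); apply: tmeasE.
exact: measurable_enorm_ball.
Qed.

(** The grid cell of side 1/(m + 1) at the origin lies in the unit ball. *)
Lemma ball_vol_gt0 m : 0 < ball_vol m.
Proof.
have M0 : (0 < m.+1)%N by [].
pose k : 'I_m -> 'I_m.+1 := fun=> ord0.
have : (cubeP R m (grid_cell k) <= cubeP R m [set x : 'rV[R]_m | (enorm x <= 1)%R])%E.
  apply: le_measure; rewrite ?inE; [exact: measurable_box|exact: measurable_enorm_ball|].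
  move=> x kx /=.
  apply: (@le_trans _ _ (m%:R * m.+1%:R^-1)).
    apply: enorm_le_const; first by rewrite invr_ge0.
    by move=> i; have [] := kx i; rewrite mul0r mul1r => x0 x1; rewrite ger0_norm// ltW.
  by rewrite ler_pdivrMr// mul1r ler_nat.
rewrite cubeP_grid_cell//.
have : cubeP R m [set x : 'rV[R]_m | (enorm x <= 1)%R] \is a fin_num.
  by apply: fin_num_measure; exact: measurable_enorm_ball.
rewrite /ball_vol; case: (cubeP R m _) => //= r _; rewrite lee_fin; apply: lt_le_trans.
by rewrite exprn_gt0// invr_gt0.
Qed.

End BoxesAndBalls.

(** * Eilenberg inequality for level sets *)

Section HausdorffCovers.
Variables (R : realType) (m s : nat).
Implicit Types (A C : set 'rV[R]_m) (l : seq (set 'rV[R]_m)).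

Definition in_cover l (x : 'rV[R]_m) := exists2 i, (i < size l)%N & nth set0 l i x.

(** A witness that [haus_delta s d A] is at most [b]. Finite lists can be concatenated, which makes
    such bounds additive over unions. *)
Definition fin_cover (d : R) A (b : \bar R) := exists l,
  [/\ forall x, A x -> in_cover l x, forall i, (ediam (nth set0 l i) <= d%:E)%E &
      (\sum_(C <- l) haus_term s C <= b)%E].

Lemma omega_ge0 k : 0 <= omega R k.
Proof. by rewrite omegaE mulr_ge0 ?exprn_ge0// ltW// ball_vol_gt0. Qed.

Lemma ediam0 : ediam (set0 : set 'rV[R]_m) = -oo%E.
Proof.
apply/eqP; rewrite -leeNy_eq; apply: ub_ereal_sup => x [y []].
Qed.

Lemma ediam_ge0 C : C !=set0 -> (0 <= ediam C)%E.
Proof.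
move=> [x Cx]; apply: ereal_sup_ubound; exists x => //; exists x => //.
by rewrite subrr enorm0.
Qed.

Lemma ediam_le C (r : R) : (forall x y, C x -> C y -> enorm (x - y) <= r) -> (ediam C <= r%:E)%E.
Proof.
by move=> h; apply: ub_ereal_sup => _ [x Cx [y Cy <-]]; rewrite lee_fin; exact: h.
Qed.

Lemma haus_term0 : haus_term s (set0 : set 'rV[R]_m) = 0%E.
Proof. by rewrite /haus_term; case: pselect. Qed.

Lemma haus_term_ge0 C : (0 <= haus_term s C)%E.
Proof.
rewrite /haus_term; case: pselect => // C0.
rewrite lee_fin mulr_ge0 ?omega_ge0// exprn_ge0// divr_ge0// fine_ge0// ediam_ge0//.
exact/set0P/eqP.
Qed.

Lemma haus_term_le C (r : R) : 0 <= r -> (forall x y, C x -> C y -> enorm (x - y) <= 2 * r) ->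
  (haus_term s C <= (omega R s * r ^+ s)%:E)%E.
Proof.
move=> r0 h; rewrite /haus_term; case: pselect => C0.
  by rewrite lee_fin mulr_ge0 ?omega_ge0// exprn_ge0.
have C0' : C !=set0 by exact/set0P/eqP.
have := ediam_le h; have := ediam_ge0 C0'; case: (ediam C) => //= a.
rewrite !lee_fin => a0 ar; rewrite ler_wpM2l ?omega_ge0// lerXn2r ?nnegrE ?divr_ge0//.
by rewrite ler_pdivrMr// mulrC.
Qed.

(** The default value [set0] pads the list to a sequence; the empty set costs nothing and its
    diameter, a supremum over nothing, is [-oo]. *)
Lemma fin_cover_haus d A b : 0 < d -> fin_cover d A b -> (haus_delta s d A <= b)%E.
Proof.
move=> d0 [l [cov diam sum]]; apply: le_trans sum.
have -> : (\sum_(C <- l) haus_term s C = \sum_(j <oo) haus_term s (nth set0 l j))%E.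
  rewrite (@nneseries_split _ _ 0 (size l)) => [|k _]; last exact: haus_term_ge0.
  rewrite add0n eseries0 ?adde0 ?(big_nth set0)// => i il _.
  by rewrite nth_default// haus_term0.
apply: ereal_inf_lbound; exists (nth set0 l) => //; split => // x /cov[i _ xi].
by exists i.
Qed.

Lemma fin_cover_sub d A B b : A `<=` B -> fin_cover d B b -> fin_cover d A b.
Proof. by move=> AB [l [h1 h2 h3]]; exists l; split => // x /AB; exact: h1. Qed.

Lemma fin_cover_le d A b c : (b <= c)%E -> fin_cover d A b -> fin_cover d A c.
Proof. by move=> bc [l [h1 h2 h3]]; exists l; split => //; exact: le_trans bc. Qed.

Lemma fin_coverU d A B a b : fin_cover d A a -> fin_cover d B b -> fin_cover d (A `|` B) (a + b)%E.
Proof.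
move=> [l [h1 h2 h3]] [k [g1 g2 g3]]; exists (l ++ k); split.
- move=> x [/h1[i il xi]|/g1[i ik xi]].
    by exists i; rewrite ?nth_cat ?il// size_cat ltn_addr.
  by exists (size l + i)%N; rewrite ?size_cat ?ltn_add2l// nth_cat ltnNge leq_addr/= addKn.
- by move=> i; rewrite nth_cat; case: ifP.
- by rewrite big_cat/= leeD.
Qed.

Lemma fin_cover0 d : fin_cover d set0 0%E.
Proof.
exists [::]; split => //; last by rewrite big_nil.
by move=> i; rewrite nth_nil ediam0 leNye.
Qed.

Lemma fin_cover1 d C (r : R) : 0 <= r -> (forall x y, C x -> C y -> enorm (x - y) <= 2 * r) ->
  (forall x y, C x -> C y -> enorm (x - y) <= d) ->
  fin_cover d C (omega R s * r ^+ s)%:E.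
Proof.
move=> r0 h hd; exists [:: C]; split.
- by move=> x Cx; exists 0%N.
- by case=> [|i] /=; [exact: ediam_le|rewrite nth_nil ediam0 leNye].
- by rewrite big_seq1; exact: haus_term_le.
Qed.

Variables (d : R) (f : 'rV[R]_m -> R).
Local Notation mu := (@lebesgue_measure R).

(** Eilenberg's inequality at scale [d]: the integral over [t] of the Hausdorff content of the level
    [t] inside [A] is at most [b]. The majorant [h] avoids the question whether that content is
    measurable in [t]. *)
Definition level_bound A (b : R) := exists h : measurableTypeR R -> \bar R,
  [/\ measurable_fun setT h, forall x, (0 <= h x)%E,
      forall t : R, fin_cover d ([set x | f x = t] `&` A) (h t) &
      (\int[mu]_t h t <= b%:E)%E].

Lemma level_boundU A B a b : level_bound A a -> level_bound B b -> level_bound (A `|` B) (a + b).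
Proof.
move=> [h [h1 h2 h3 h4]] [k [k1 k2 k3 k4]]; exists (fun t => h t + k t)%E; split.
- exact: emeasurable_funD.
- by move=> x; rewrite adde_ge0.
- by move=> t; rewrite setIUr; exact: fin_coverU.
- by rewrite ge0_integralD// EFinD leeD.
Qed.

Lemma level_bound_sub A B a b : A `<=` B -> a <= b -> level_bound B a -> level_bound A b.
Proof.
move=> AB ab [h [h1 h2 h3 h4]]; exists h; split => //.
  by move=> t; apply: fin_cover_sub (h3 t) => x [fx /AB].
by apply: le_trans h4 _; rewrite lee_fin.
Qed.

Lemma level_bound0 : level_bound set0 0.
Proof.
exists (cst 0%E); split => //; first by move=> t; rewrite setI0; exact: fin_cover0.
by rewrite integral0.
Qed.

Lemma level_bound_seq (I : eqType) (r : seq I) (F : I -> set 'rV[R]_m) (b : I -> R) :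
  (forall i, i \in r -> level_bound (F i) (b i)) ->
  level_bound [set x | exists2 i, i \in r & F i x] (\sum_(i <- r) b i).
Proof.
elim: r => [|i r IH] h.
  by rewrite big_nil; apply: level_bound_sub level_bound0 => // x [].
rewrite big_cons; have hi := h i (mem_head _ _).
apply: level_bound_sub (level_boundU hi (IH _)) => //.
  move=> x [j]; rewrite inE => /predU1P[->|jr] Fx; [by left|by right; exists j].
by move=> j jr; apply: h; rewrite inE jr orbT.
Qed.

End HausdorffCovers.

Section SliceIntegrals.
Variable R : realType.
Local Notation mu := (@lebesgue_measure R).

(** The [n]-th power of the radius of the slice at height (t - c)/a of a ball of radius [rho]; a
    function that leaves the value [c] with slope at most [a] can reach [t] only at that height or
    higher. *)
Definition cap_fun (n : nat) (rho : R) (a c : R) (t : R) : \bar R :=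
  if (c <= t <= c + a * rho) then (Num.sqrt (rho ^+ 2 - ((t - c) / a) ^+ 2) ^+ n)%:E else 0%E.

Lemma measurable_cap_fun n rho a c : measurable_fun setT (cap_fun n rho a c : measurableTypeR R -> \bar R).
Proof.
apply: measurable_fun_if => //=.
  by apply: measurable_and; exact: measurable_fun_ler.
apply: measurable_funTS; apply: (@measurableT_comp _ _ _ _ _ _ (fun u : measurableTypeR R => (Num.sqrt (rho ^+ 2 - u ^+ 2) ^+ n)%:E)).
  exact: measurable_cap.
apply: measurable_funM; last exact: measurable_cst.
by apply: measurable_funB => //; exact: measurable_cst.
Qed.

Lemma cap_fun_ge0 n rho a c t : (0 <= cap_fun n rho a c t)%E.
Proof. by rewrite /cap_fun; case: ifP => // _; rewrite lee_fin exprn_ge0// sqrtr_ge0. Qed.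

Lemma integral_cap_fun n rho a c : 0 < rho -> 0 < a ->
  (\int[mu]_t cap_fun n rho a c t = (a * rho ^+ n.+1 * cap_int R n)%:E)%E.
Proof.
move=> rho0 a0; have ar : 0 < a * rho by rewrite mulr_gt0.
rewrite -(integral_affine c ar)//; last 2 first.
- exact: measurable_cap_fun.
- by move=> x; exact: cap_fun_ge0.
rewrite preimage_setT.
rewrite [X in (_ * X)%E](_ : _ = \int[mu]_(t in `[0%R, 1%R]) ((rho ^+ n)%:E * (Num.sqrt (1 - (t : R) ^+ 2) ^+ n)%:E))%E; last first.
  rewrite [RHS]integral_mkcond; apply: eq_integral => t _.
  rewrite /cap_fun patchE lerDr pmulr_rge0// addrC lerD2l ger_pMr//.
  rewrite (_ : (t \in _) = (0 <= t <= 1)); last by apply/idP/idP; rewrite inE/= in_itv/=.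
  case: ifP => // _; rewrite -EFinM; congr (_%:E).
  rewrite (_ : (c + a * rho * t - c) / a = rho * t); last by field; rewrite gt_eqF.
  by rewrite exprMn -[X in X - _]mulr1 -mulrBr sqrtrM ?sqr_ge0// sqrtr_sqr gtr0_norm// exprMn.
rewrite ge0_integralZl//; last 2 first.
- by apply: measurable_funTS; exact: measurable_cap.
- by rewrite lee_fin exprn_ge0// ltW.
by rewrite cap_intE -!EFinM exprS; congr (_%:E); ring.
Qed.

End SliceIntegrals.

(** * Level sets of nearly affine functions in balls and cubes *)

Section LevelBoundCubes.
Variables (R : realType) (n : nat).
Local Notation mu := (@lebesgue_measure R).
Local Notation N := n.+1.
Implicit Types (f : 'rV[R]_N -> R) (A : set 'rV[R]_N).

(** One cover serves every level, and only levels within [w] of [c] occur. *)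
Lemma level_bound_const d f A (c w b : R) : 0 <= w -> 0 <= b ->
  (forall x, A x -> `|f x - c| <= w) -> fin_cover n d A b%:E -> level_bound n d f A (2 * w * b).
Proof.
move=> w0 b0 hw hA.
exists (fun t => b%:E * (\1_(`[c - w, c + w]%classic : set (measurableTypeR R)) t)%:E)%E; split.
- by apply: measurable_funeM; exact/measurable_EFinP/measurable_indic.
- by move=> t; rewrite mule_ge0.
- move=> t; have [tc|tc] := boolP (t \in (`[c - w, c + w]%classic : set R)).
    by rewrite indicE tc mule1; apply: fin_cover_sub hA => x [].
  apply: (@fin_cover_sub _ _ _ _ _ set0); last first.
    by apply: fin_cover_le (fin_cover0 _ _ _); rewrite mule_ge0.
  move=> x [/= fx Ax]; move/negP: tc; apply.
  by rewrite inE/= in_itv/= -ler_distlC distrC -fx hw.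
- rewrite ge0_integralZl//; last exact/measurable_EFinP/measurable_indic.
  rewrite integral_indic// setIT [X in (_ * X)%E]lebesgue_measure_itv/= lte_fin.
  case: ifP => _; last by rewrite mule0 lee_fin !mulr_ge0.
  by rewrite -EFinD -EFinM lee_fin; nra.
Qed.

Lemma level_bound_opp d f A b : level_bound n d (fun x => - f x) A b -> level_bound n d f A b.
Proof.
move=> [h [h1 h2 h3 h4]]; exists (fun t : R => h (- t)%R); split.
- by apply: (measurableT_comp h1); exact: oppr_measurable.
- by move=> t; exact: h2.
- by move=> t; apply: fin_cover_sub (h3 (- t)) => x [/= -> Ax].
- have := @integral_opp R setT h measurableT h1 h2.
  by rewrite preimage_setT => ->.
Qed.

(** The source of the sharp constant. A point of [A] where [f] equals [t] lies in the ball and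
    beyond the hyperplane at height (t - K)/a; such points are no farther apart than the diameter of
    the slice, so a single covering set is enough. *)
Lemma level_bound_cap d f A (p c : 'rV[R]_N) (a K rho : R) : 0 < a -> 0 < rho -> enorm p <= a ->
  (forall x, A x -> [/\ enorm (x - c) <= rho, K <= f x & f x - K <= edot p (x - c)]) ->
  (forall x y, A x -> A y -> enorm (x - y) <= d) ->
  level_bound n d f A (omega R n * (a * rho ^+ N * cap_int R n)).
Proof.
move=> a0 rho0 pa hA hd.
have om0 := omega_ge0 R n.
exists (fun t => (omega R n)%:E * cap_fun n rho a K t)%E; split.
- by apply: measurable_funeM; exact: measurable_cap_fun.
- by move=> t; rewrite mule_ge0// cap_fun_ge0.
- move=> t; rewrite /cap_fun; case: ifPn => [/andP[Kt tK]|tn]; last first.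
    apply: (@fin_cover_sub _ _ _ _ _ set0); last by rewrite mule0; exact: fin_cover0.
    move=> x [/= fx /hA[xc Kx px]]; move/negP: tn; apply.
    rewrite -fx Kx/= -lerBlDl (le_trans px)// (le_trans (edot_le _ _))//.
    by apply: ler_pM => //; exact: enorm_ge0.
  have w0 : 0 <= (t - K) / a by rewrite divr_ge0// ?subr_ge0// ltW.
  have wrho : (t - K) / a <= rho by rewrite ler_pdivrMr// lerBlDl mulrC.
  rewrite -EFinM; apply: fin_cover1; first exact: sqrtr_ge0.
    move=> x y [/= fx /hA[xc _ px]] [/= fy /hA[yc _ py]].
    set w := (t - K) / a in w0 wrho *.
    have wa : a * w = t - K by rewrite /w mulrC divfK// gt_eqF.
    have hs : 2 * w <= enorm ((x - c) + (y - c)).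
      rewrite -(ler_pM2l a0) mulrCA wa.
      apply: (@le_trans _ _ (edot p ((x - c) + (y - c)))).
        by rewrite edotDr; move: px py; rewrite fx fy; lra.
      apply: le_trans (edot_le _ _) _.
      by apply: ler_wpM2r => //; exact: enorm_ge0.
    (* The parallelogram law turns the lower bound on the sum into an upper bound on the
       difference. *)
    have par : enorm (x - y) ^+ 2 + enorm ((x - c) + (y - c)) ^+ 2 =
        2 * enorm (x - c) ^+ 2 + 2 * enorm (y - c) ^+ 2.
      have -> : x - y = (x - c) - (y - c) by rewrite opprB addrA subrK.
      move: (x - c) (y - c) => X Y.
      by rewrite !sqr_enorm !edotBl !edotBr !edotDl !edotDr (edotC Y); ring.
    rewrite -(ler_sqr (enorm_ge0 _)) ?nnegrE ?mulr_ge0 ?sqrtr_ge0// exprMn [X in _ * X]sqr_sqrtr; last first.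
      by rewrite subr_ge0 ler_sqr ?nnegrE// ltW.
    have h1 : enorm (x - c) ^+ 2 <= rho ^+ 2 by rewrite ler_sqr ?nnegrE ?enorm_ge0// ltW.
    have h2 : enorm (y - c) ^+ 2 <= rho ^+ 2 by rewrite ler_sqr ?nnegrE ?enorm_ge0// ltW.
    have h3 : (2 * w) ^+ 2 <= enorm ((x - c) + (y - c)) ^+ 2.
      by apply: lerXn2r hs; rewrite nnegrE ?enorm_ge0// mulr_ge0.
    move: par h1 h2 h3.
    move: (enorm (x - y)) (enorm (x - c + (y - c))) (enorm (x - c)) (enorm (y - c)) => X Y Z W.
    rewrite exprMn; lra.
  by move=> x y [_ Ax] [_ Ay]; exact: hd.
- rewrite ge0_integralZl//; last 2 first.
  + exact: measurable_cap_fun.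
  + by move=> t _; exact: cap_fun_ge0.
  by rewrite integral_cap_fun// -EFinM.
Qed.

Definition cubeQ (x0 : 'rV[R]_N) (r : R) : set 'rV[R]_N :=
  [set x | forall i, x0 0 i <= x 0 i /\ x 0 i <= x0 0 i + r].

Lemma cubeQ_diam x0 r x y : 0 <= r -> cubeQ x0 r x -> cubeQ x0 r y -> enorm (x - y) <= N%:R * r.
Proof.
move=> r0 hx hy; apply: enorm_le_const => // i; rewrite !mxE.
have [h1 h2] := hx i; have [h3 h4] := hy i.
by rewrite ler_norml; apply/andP; split; lra.
Qed.

Definition cube_center (x0 : 'rV[R]_N) (r : R) : 'rV[R]_N := x0 + const_mx (r / 2).

Variables (f : 'rV[R]_N -> R) (g : 'rV[R]_N -> 'rV[R]_N) (d e r0 G : R).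
Hypotheses (e0 : 0 < e) (r00 : 0 < r0) (Nr0 : N%:R * r0 <= d).
Hypothesis Hf : forall x0 r, 0 < r -> r <= r0 -> forall x y, cubeQ x0 r x -> cubeQ x0 r y ->
  `|f x - f y - edot (g x0) (x - y)| <= e * r.
Hypothesis Hg : forall x0 r, 0 < r -> r <= r0 -> forall x, cubeQ x0 r x ->
  `|enorm (g x) - enorm (g x0)| <= e.
Hypothesis HG : forall x, enorm (g x) <= G.

Let cubeQ_corner x0 r : 0 < r -> cubeQ x0 r x0.
Proof. by move=> r1 i; split=> //; rewrite lerDl ltW. Qed.

Let cubeQ_d x0 r x y : 0 < r -> r <= r0 -> cubeQ x0 r x -> cubeQ x0 r y -> enorm (x - y) <= d.
Proof.
move=> r1 rr hx hy; apply: le_trans (cubeQ_diam (ltW r1) hx hy) _.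
by apply: le_trans Nr0; rewrite ler_pM2l.
Qed.

Definition crude_cst : R := 2 * (G * N%:R + e) * (omega R n * (N%:R / 2) ^+ n).

Lemma level_bound_crude x0 r : 0 < r -> r <= r0 ->
  level_bound n d f (cubeQ x0 r) (crude_cst * r ^+ N).
Proof.
move=> r1 rr.
have G0 : 0 <= G by apply: le_trans (HG x0); exact: enorm_ge0.
rewrite (_ : crude_cst * _ = 2 * ((G * N%:R + e) * r) * (omega R n * (N%:R * r / 2) ^+ n)); last first.
  by rewrite /crude_cst exprS !exprMn; ring.
apply: (@level_bound_const _ _ _ (f x0)).
- by apply: mulr_ge0; [apply: addr_ge0; [exact: mulr_ge0|exact: ltW]|exact: ltW].
- by rewrite mulr_ge0 ?omega_ge0// exprn_ge0// divr_ge0// mulr_ge0// ltW.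
- move=> x hx; have h1 := Hf r1 rr hx (cubeQ_corner x0 r1).
  have h2 : `|edot (g x0) (x - x0)| <= G * (N%:R * r).
    apply: le_trans (abs_edot_le _ _) _; apply: ler_pM => //; try exact: enorm_ge0.
    exact: (cubeQ_diam (ltW r1) hx (cubeQ_corner x0 r1)).
  move: h1 h2; rewrite !ler_norml => /andP[h1 h2] /andP[h3 h4].
  by apply/andP; split; lra.
- apply: fin_cover1; first by rewrite divr_ge0// mulr_ge0// ltW.
    move=> x y hx hy; rewrite mulrC divfK//.
    exact: (cubeQ_diam (ltW r1) hx hy).
  by move=> x y; exact: cubeQ_d.
Qed.

Lemma cubeQ_centerP x0 r : 0 < r -> cubeQ x0 r (cube_center x0 r).
Proof. by move=> r1 i; rewrite !mxE; split; lra. Qed.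

(** The points where [f] exceeds its central value by more than the linearization error form one
    cap, those below it a second one, and the two bounds together give the volume of the ball; the
    thin layer between them costs a multiple of [e]. *)
Lemma level_bound_ball x0 r : 0 < r -> r <= r0 ->
  level_bound n d f (cubeQ x0 r `&` [set x | enorm (x - cube_center x0 r) <= r / 2])
    (((enorm (g x0) + e) * ball_vol R N + 2 * e * ball_vol R n) * r ^+ N).
Proof.
move=> r1 rr; set c := cube_center x0 r; set A := _ `&` _.
have rho0 : 0 < r / 2 by rewrite divr_gt0.
have a0 : 0 < enorm (g x0) + e by rewrite ltr_wpDl ?enorm_ge0.
have hA x y : A x -> A y -> enorm (x - y) <= d by move=> [hx _] [hy _]; exact: cubeQ_d hx hy.
have hc x : A x -> `|f x - f c - edot (g x0) (x - c)| <= e * r.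
  by move=> [hx _]; apply: Hf => //; exact: cubeQ_centerP.
pose B (k : R) := omega R n * ((enorm (g x0) + e) * (r / 2) ^+ N * cap_int R n).
have b1 : level_bound n d f [set x | A x /\ `|f x - f c| <= e * r]
    (2 * (e * r) * (omega R n * (r / 2) ^+ n)).
  apply: (@level_bound_const _ _ _ (f c)).
  - by rewrite mulr_ge0// ltW.
  - by rewrite mulr_ge0 ?omega_ge0// exprn_ge0// ltW.
  - by move=> x [].
  - apply: fin_cover1; first exact: ltW.
      move=> x y [[_ /= hx] _] [[_ /= hy] _].
      by apply: le_trans (enorm_triangle c _ _) _; rewrite (enormB c y); lra.
    by move=> x y [Ax _] [Ay _]; exact: hA.
have b2 : level_bound n d f [set x | A x /\ f c + e * r <= f x] (B 0).
  apply: (@level_bound_cap _ _ _ (g x0) c _ (f c + e * r)) => //.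
  - by rewrite lerDl ltW.
  - move=> x [Ax fx]; split=> //; first by case: Ax.
    by have := hc _ Ax; rewrite ler_norml => /andP[]; lra.
  - by move=> x y [Ax _] [Ay _]; exact: hA.
have b3 : level_bound n d f [set x | A x /\ f x <= f c - e * r] (B 0).
  apply: level_bound_opp.
  apply: (@level_bound_cap _ _ _ (- g x0) c _ (- (f c - e * r))) => //.
  - by rewrite enormN lerDl ltW.
  - move=> x [Ax fx]; split=> //; [by case: Ax|by rewrite lerN2|].
    by rewrite edotNl; have := hc _ Ax; rewrite ler_norml => /andP[]; lra.
  - by move=> x y [Ax _] [Ay _]; exact: hA.
apply: level_bound_sub (level_boundU b1 (level_boundU b2 b3)).
  move=> x Ax; have [h|h] := leP `|f x - f c| (e * r); first by left.
  right; move: h; rewrite lter_normr => /orP[h|h]; [left|right]; split=> //; lra.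
rewrite /B omegaE ball_volS exprS !expr_div_n exprS; set b := ball_vol R n.
have two : (2 : R) ^+ n != 0 by rewrite expf_neq0.
rewrite le_eqVlt; apply/orP; left; apply/eqP; field.
by rewrite two.
Qed.

End LevelBoundCubes.

Section DisjointPieces.
Context d (T : measurableType d) (R : realType) (mu : {measure set T -> \bar R}).

Lemma sum_integral_le (I : eqType) (r : seq I) (F : I -> set T) (B : set T) (h : T -> \bar R) :
  uniq r -> (forall i, measurable (F i)) -> (forall i j x, F i x -> F j x -> i = j) ->
  measurable B -> measurable_fun setT h -> (forall x, 0 <= h x)%E ->
  (forall i, i \in r -> F i `<=` B) ->
  (\sum_(i <- r) \int[mu]_(x in F i) h x <= \int[mu]_(x in B) h x)%E.
Proof.
move=> + mF dF + mh h0; elim: r B => [|i r IH] B.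
  by move=> _ mB _; rewrite big_nil integral_ge0.
move=> /= /andP[ir ur] mB FB; rewrite big_cons.
have mBF : measurable (B `\` F i) by exact: measurableD.
have FiB : F i `<=` B by apply: FB; rewrite mem_head.
rewrite -[in leRHS](setDUK FiB) ge0_integral_setU//; last 2 first.
- exact: measurable_funTS.
- by apply/disj_setPS => x [Fx [_]].
rewrite leeD2l//; apply: IH => // j jr x Fx; split.
  by apply: (FB j) => //; rewrite inE jr orbT.
by move=> Fi; move: ir; rewrite (dF _ _ _ Fi Fx) jr.
Qed.

End DisjointPieces.

(** * Counting the grid cells that leave the ball *)

Section GridCounting.
Variables (R : realType) (m : nat).

(** The corner of the cell farthest from the origin. *)
Definition grid_row (M : nat) (j : {ffun 'I_m -> 'I_M}) : 'rV[R]_m := \row_i ((j i).+1%:R / M%:R).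

(** Cells whose far corner leaves the unit ball are disjoint and avoid the ball of radius 1 - m/M,
    so their total volume is at most that of its complement; Bernoulli's inequality bounds the
    power. *)
Lemma bad_cell_count (M : nat) : (0 < M)%N -> (m <= M)%N ->
  #|[pred j : {ffun 'I_m -> 'I_M} | 1 < enorm (grid_row j)]|%:R * (M%:R^-1) ^+ m <=
  1 - ball_vol R m + ball_vol R m * m%:R ^+ 2 / M%:R :> R.
Proof.
move=> M0 mM; have M0' : 0 < M%:R :> R by rewrite ltr0n.
set P := [pred j | _]; pose s : R := 1 - m%:R / M%:R.
have s01 : 0 <= s <= 1.
  by rewrite /s subr_ge0 gerBl divr_ge0// ler_pdivrMr// mul1r ler_nat mM.
set Bs := [set x : 'rV[R]_m | enorm x <= s].
have mBs : measurable (Bs : set (borel_rV R m)) by exact: measurable_enorm_ball.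
have h : (\sum_(j <- enum P) \int[cubeP R m]_(x in grid_cell j) cst 1%E x <=
    \int[cubeP R m]_(x in ~` Bs) cst 1%E x)%E.
  apply: sum_integral_le => //.
  - exact: enum_uniq.
  - by move=> j; exact: measurable_box.
  - by move=> i j x hi hj; apply/ffunP => k; exact: (grid_cell_inj M0 hi hj).
  - exact: measurableC.
  - move=> j; rewrite mem_enum inE => hj x xj /=; apply/negP; rewrite -ltNge /s.
    have : enorm (grid_row j - x) <= m%:R / M%:R.
      apply: enorm_le_const; first by rewrite invr_ge0.
      move=> i; rewrite !mxE; have [h1 h2] := xj i.
      have : (j i)%:R / M%:R = (j i).+1%:R / M%:R - M%:R^-1 :> R.
        by rewrite -[(j i).+1]addn1 natrD mulrDl mul1r addrK.
      by move=> e; rewrite ler_norml; apply/andP; split; lra.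
    have := enormD (grid_row j - x) x; rewrite subrK.
    move: hj; rewrite /P/=; move: (enorm _) (enorm _) (enorm _) => a b c; lra.
move: h; rewrite integral_cst ?mul1e; last exact: measurableC.
rewrite [X in (_ <= X)%E](_ : _ = 1 - (s ^+ m * ball_vol R m)%:E)%E; last first.
  by rewrite -cubeP_ball//; exact: (probability_setC (cubeP R m) mBs).
rewrite (eq_bigr (fun=> ((M%:R^-1) ^+ m)%:E)) => [|j _]; last first.
  by rewrite integral_cst; [rewrite mul1e; exact: cubeP_grid_cell|exact: measurable_box].
rewrite sumEFin -EFinB lee_fin big_const_seq count_predT -cardE iter_addr addr0.
move=> h; rewrite [leLHS]mulr_natl; apply: (le_trans h).
have bern : 1 - m%:R * (m%:R / M%:R) <= s ^+ m.
  have x01 : 0 <= (m%:R / M%:R : R) <= 1 by move: s01; rewrite /s => /andP[? ?]; apply/andP; split; lra.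
  rewrite /s; move: (m%:R / M%:R) x01 => x /andP[x0 x1].
  elim: (m) => [|k IH]; first by rewrite mul0r subr0 expr0.
  have := IH; rewrite exprS -natr1 => {}IH.
  apply: (@le_trans _ _ ((1 - x) * (1 - k%:R * x))).
    have : 0 <= k%:R * x ^+ 2 by rewrite mulr_ge0// sqr_ge0.
    by rewrite expr2; nra.
  by rewrite ler_wpM2l// subr_ge0.
have b0 := ltW (ball_vol_gt0 R m).
rewrite -addrA lerD2l -lerN2 opprK opprD opprK.
have := ler_wpM2r b0 bern; rewrite expr2; lra.
Qed.

End GridCounting.

(** * Iteration of the covering estimate *)

Section LevelBoundIteration.
Variables (R : realType) (n : nat).
Local Notation N := n.+1.
Variables (f : 'rV[R]_N -> R) (g : 'rV[R]_N -> 'rV[R]_N) (d e r0 G : R).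
Hypotheses (e0 : 0 < e) (r00 : 0 < r0) (Nr0 : N%:R * r0 <= d).
Hypothesis Hf : forall x0 r, 0 < r -> r <= r0 -> forall x y, cubeQ x0 r x -> cubeQ x0 r y ->
  `|f x - f y - edot (g x0) (x - y)| <= e * r.
Hypothesis Hg : forall x0 r, 0 < r -> r <= r0 -> forall x, cubeQ x0 r x ->
  `|enorm (g x) - enorm (g x0)| <= e.
Hypothesis HG : forall x, enorm (g x) <= G.

Let theta := ball_vol R N.
Let b := ball_vol R n.

(** The cube is cut at its centre into orthants, chosen by [ij.1], and each orthant into a grid
    whose index [ij.2] counts cells away from the centre; by symmetry one count of bad cells serves
    all orthants. *)
Definition sub_corner (x0 : 'rV[R]_N) (r : R) M
    (ij : {ffun 'I_N -> bool} * {ffun 'I_N -> 'I_M}) : 'rV[R]_N :=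
  \row_i (cube_center x0 r 0 i +
    (if ij.1 i then (ij.2 i)%:R else - (ij.2 i).+1%:R) / M%:R * (r / 2)).

Lemma sub_cube_cover x0 r M x : 0 < r -> (0 < M)%N -> cubeQ x0 r x ->
  exists ij : {ffun 'I_N -> bool} * {ffun 'I_N -> 'I_M},
    cubeQ (sub_corner x0 r ij) (r / (2 * M%:R)) x /\
    enorm (x - cube_center x0 r) <= r / 2 * enorm (grid_row R ij.2).
Proof.
move=> r1 M0 hx; have M0' : 0 < M%:R :> R by rewrite ltr0n.
have r2 : 0 < r / 2 by rewrite divr_gt0.
pose u i := (x 0 i - cube_center x0 r 0 i) / (r / 2).
have uE i : x 0 i = cube_center x0 r 0 i + u i * (r / 2).
  by rewrite /u divfK ?gt_eqF// addrC subrK.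
have u1 i : `|u i| <= 1.
  have [h1 h2] := hx i; rewrite /u normrM [X in _ * X]gtr0_norm ?invr_gt0// ler_pdivrMr// mul1r.
  by rewrite /cube_center !mxE ler_norml; apply/andP; split; lra.
pose j i := minn (Num.truncn (`|u i| * M%:R)) M.-1.
have jM i : (j i < M)%N by rewrite /j (leq_ltn_trans (geq_minr _ _))// prednK.
have ju i : (j i)%:R <= `|u i| * M%:R <= (j i).+1%:R.
  have uM : 0 <= `|u i| * M%:R by rewrite mulr_ge0.
  have t1 : (Num.truncn (`|u i| * M%:R))%:R <= `|u i| * M%:R by rewrite truncn_le.
  have t2 := truncnS_gt (`|u i| * M%:R).
  apply/andP; split; first by apply: le_trans t1; rewrite ler_nat geq_minl.
  rewrite /j; case: (leqP (Num.truncn (`|u i| * M%:R)) M.-1) => _; first exact: ltW.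
  by rewrite prednK// ger_pMl.
exists ([ffun i => 0 <= u i], [ffun i => Ordinal (jM i)]); split.
  move=> i; rewrite !mxE !ffunE /= uE !mxE.
  have /andP[j1 j2] := ju i.
  have M2 : r / (2 * M%:R) = M%:R^-1 * (r / 2) by rewrite invfM; ring.
  rewrite M2 -!addrA !lerD2l -mulrDl !ler_pM2r//.
  case: (leP 0 (u i)) j1 j2 => [u0|u0].
    rewrite ger0_norm// => j1 j2; split; first by rewrite ler_pdivrMr.
    by rewrite -[X in _ + X]mul1r -mulrDl ler_pdivlMr// natr1.
  rewrite ltr0_norm// => j1 j2; split; first by rewrite ler_pdivrMr// lerNl -mulNr.
  by rewrite -[X in _ + X]mul1r -mulrDl ler_pdivlMr// -natr1 opprD subrK lerNr -mulNr.
rewrite -[r / 2]gtr0_norm// -enormZ -(ler_sqr (enorm_ge0 _)) ?nnegrE ?enorm_ge0// !sqr_enorm.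
apply: ler_sum => i _; rewrite -!expr2 -real_normK ?num_real// -[leRHS]real_normK ?num_real//.
rewrite ler_sqr ?nnegrE//.
have E1 : (x - cube_center x0 r) 0 i = r / 2 * u i.
  by rewrite /u mulrC divfK ?gt_eqF// !mxE.
have E2 : ((r / 2) *: grid_row R [ffun i => Ordinal (jM i)]) 0 i = r / 2 * ((j i).+1%:R / M%:R).
  by rewrite !mxE ffunE.
rewrite E1 E2 !(normrM (r / 2)) ler_pM2l ?normr_gt0 ?gt_eqF// [leRHS]ger0_norm ?divr_ge0//.
by rewrite ler_pdivlMr//; have /andP[_] := ju i.
Qed.

Lemma sub_corner_in x0 r M (ij : {ffun 'I_N -> bool} * {ffun 'I_N -> 'I_M}) : 0 < r -> (0 < M)%N ->
  cubeQ x0 r (sub_corner x0 r ij).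
Proof.
move=> r1 M0 i; have M0' : 0 < M%:R :> R by rewrite ltr0n.
have r2 : 0 < r / 2 by rewrite divr_gt0.
have h1 : 0 <= (ij.2 i)%:R / M%:R :> R by rewrite divr_ge0.
have h2 : (ij.2 i).+1%:R / M%:R <= 1 :> R by rewrite ler_pdivrMr// mul1r ler_nat.
have h3 : (ij.2 i)%:R / M%:R <= (ij.2 i).+1%:R / M%:R :> R by rewrite ler_pM2r ?invr_gt0// ler_nat.
rewrite !mxE; case: (ij.1 i).
  by move: ((ij.2 i)%:R / M%:R) ((ij.2 i).+1%:R / M%:R) h1 h2 h3 => a c h1 h2 h3; split; nra.
rewrite mulNr; move: ((ij.2 i)%:R / M%:R) ((ij.2 i).+1%:R / M%:R) h1 h2 h3 => a c h1 h2 h3; split; nra.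
Qed.

(** The inscribed ball fills a fraction [theta] of the cube and is treated with the sharp constant;
    only the subcubes that leave it keep the excess [beta], so the excess contracts by the factor
    [1 - theta / 2] up to a multiple of [e]. *)
Lemma level_bound_step (beta : R) : 0 <= beta ->
  (forall x0 r, 0 < r -> r <= r0 -> level_bound n d f (cubeQ x0 r) ((enorm (g x0) + beta) * r ^+ N)) ->
  forall x0 r, 0 < r -> r <= r0 ->
  level_bound n d f (cubeQ x0 r)
    ((enorm (g x0) + ((1 - theta / 2) * beta + e * (2 + 2 * b))) * r ^+ N).
Proof.
move=> beta0 IH x0 r r1 rr.
have G0 : 0 <= G by apply: le_trans (HG x0); exact: enorm_ge0.
have th0 : 0 < theta by exact: ball_vol_gt0.
have b0 : 0 < b by exact: ball_vol_gt0.
(* The error [sig] of the cell count must leave half of the gain [theta], and cost at most [e] when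
   multiplied by [G + e]. *)
pose sig := Num.min (theta / 2) (e / (G + e + 1)).
have Ge : 0 < G + e + 1 by rewrite ltr_wpDl// addr_ge0// ltW.
have sig0 : 0 < sig by rewrite lt_min !divr_gt0.
have [M [M0 NM sigM]] : exists M : nat, [/\ (0 < M)%N, (N <= M)%N & theta * N%:R ^+ 2 / M%:R <= sig].
  have /archi_boundP h0 : 0 <= theta * N%:R ^+ 2 / sig by rewrite divr_ge0 ?mulr_ge0// ltW.
  set k := Num.bound _ in h0; exists (k + N)%N.
  have kN0 : (0 < k + N)%N by rewrite addnS.
  split=> //; first exact: leq_addl.
  rewrite ler_pdivrMr ?ltr0n// [leRHS]mulrC -ler_pdivrMr//.
  by apply: (le_trans (ltW h0)); rewrite ler_nat leq_addr.
have M0' : 0 < M%:R :> R by rewrite ltr0n.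
pose bad : pred {ffun 'I_N -> 'I_M} := [pred j | 1 < enorm (grid_row R j)].
pose I := ({ffun 'I_N -> bool} * {ffun 'I_N -> 'I_M})%type.
pose S : seq I := enum [pred ij : I | bad ij.2].
have rM : 0 < r / (2 * M%:R) by rewrite divr_gt0// mulr_gt0.
have rM0 : r / (2 * M%:R) <= r0.
  have M1 : 1 <= M%:R :> R by rewrite ler1n.
  by apply: le_trans rr; rewrite ler_pdivrMr ?mulr_gt0// ler_peMr ?ltW//; lra.
have hS (ij : I) : ij \in S -> level_bound n d f (cubeQ (sub_corner x0 r ij) (r / (2 * M%:R)))
    ((enorm (g x0) + e + beta) * (r / (2 * M%:R)) ^+ N).
  move=> _; apply: (level_bound_sub (@subset_refl _ _) _ (IH _ _ rM rM0)).
  apply: ler_wpM2r; first by rewrite exprn_ge0// ltW.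
  rewrite lerD2r; have := Hg r1 rr (sub_corner_in x0 ij r1 M0).
  by rewrite ler_norml => /andP[_]; rewrite lerBlDl addrC.
have hB := level_bound_ball e0 Nr0 Hf x0 r1 rr.
apply: level_bound_sub (level_boundU hB (level_bound_seq hS)).
  move=> x hx; have [ij [h1 h2]] := sub_cube_cover r1 M0 hx.
  have [hb|hb] := ltP 1 (enorm (grid_row R ij.2)).
    by right; exists ij => //; rewrite mem_enum inE.
  left; split => //=; apply: le_trans h2 _.
  by rewrite ger_pMr// divr_gt0.
rewrite big_const_seq count_predT iter_addr addr0.
have -> : size S = (2 ^ N * #|bad|)%N.
  rewrite -cardE -sum1_card.
  rewrite -(pair_big_dep xpredT (fun _ j => bad j) (fun _ _ => 1%N))/=.
  by rewrite sum_nat_const sum1_card card_ffun card_bool card_ord.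
rewrite -[_ *+ (2 ^ N * _)]mulr_natr natrM natrX.
have cnt := @bad_cell_count R N M M0 NM.
set K := #|bad|%:R in cnt *.
have E : (enorm (g x0) + e + beta) * (r / (2 * M%:R)) ^+ N * (2 ^+ N * K) =
   (enorm (g x0) + e + beta) * (K * M%:R^-1 ^+ N) * r ^+ N.
  rewrite invfM !exprMn !exprVn; have : (2 : R) ^+ N != 0 by rewrite expf_neq0.
  have : M%:R ^+ N != 0 :> R by rewrite expf_neq0// gt_eqF.
  move: (2 ^+ N) (M%:R ^+ N) (r ^+ N) => t w z w0 t0.
  by field; rewrite w0 t0.
rewrite [X in _ + X]E.
have rN : 0 < r ^+ N by rewrite exprn_gt0.
set p := enorm (g x0); have p0 : 0 <= p by exact: enorm_ge0.
have pG : p <= G by exact: HG.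
rewrite -mulrDl ler_pM2r//.
have cnt2 : K * M%:R^-1 ^+ N <= 1 - theta + sig.
  by apply: le_trans cnt _; rewrite lerD2l.
have s1 : sig <= theta / 2 by rewrite /sig ge_min lexx.
have s2 : sig * (p + e) <= e.
  apply: (@le_trans _ _ (sig * (G + e + 1))).
    by rewrite ler_pM2l//; lra.
  by rewrite -ler_pdivlMr// /sig ge_min lexx orbT.
have h3 : (p + e + beta) * (K * M%:R^-1 ^+ N) <= (p + e + beta) * (1 - theta + sig).
  by rewrite ler_wpM2l// !addr_ge0// ltW.
rewrite -/theta -/b.
have h4 : beta * sig <= beta * (theta / 2) by rewrite ler_wpM2l.
apply: le_trans (lerD (lexx _) h3) _.
nra.
Qed.

End LevelBoundIteration.

Lemma integral_cubeP_cst (R : realType) m (r : \bar R) : (\int[cubeP R m]_x r = r)%E.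
Proof.
rewrite integral_cst// [X in (_ * X)%E](_ : _ = 1%E) ?mule1//.
exact: (@probability_setT _ _ _ (cubeP R m)).
Qed.

Section LevelBoundLimit.
Variables (R : realType) (n : nat).
Local Notation N := n.+1.
Variables (f : 'rV[R]_N -> R) (g : 'rV[R]_N -> 'rV[R]_N) (d e r0 G : R).
Hypotheses (e0 : 0 < e) (r00 : 0 < r0) (Nr0 : N%:R * r0 <= d).
Hypothesis Hf : forall x0 r, 0 < r -> r <= r0 -> forall x y, cubeQ x0 r x -> cubeQ x0 r y ->
  `|f x - f y - edot (g x0) (x - y)| <= e * r.
Hypothesis Hg : forall x0 r, 0 < r -> r <= r0 -> forall x, cubeQ x0 r x ->
  `|enorm (g x) - enorm (g x0)| <= e.
Hypothesis HG : forall x, enorm (g x) <= G.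

Lemma ball_vol_le1 m : ball_vol R m <= 1.
Proof.
have := @probability_le1 _ _ _ (cubeP R m) [set x : 'rV[R]_m | enorm x <= 1] (@measurable_enorm_ball R m 1).
by rewrite cubeP_ball ?ler01 ?lexx// expr1n mul1r lee_fin.
Qed.

Definition limit_cst : R := 1 + (2 + 2 * ball_vol R n) * (2 / ball_vol R N).

Lemma level_bound_cube x0 r : 0 < r -> r <= r0 ->
  level_bound n d f (cubeQ x0 r) ((enorm (g x0) + limit_cst * e) * r ^+ N).
Proof.
move=> r1 rr; set th := ball_vol R N.
have th0 : 0 < th by exact: ball_vol_gt0.
have th1 : th <= 1 by exact: ball_vol_le1.
have b0 := ball_vol_gt0 R n.
have G0 : 0 <= G by apply: le_trans (HG x0); exact: enorm_ge0.
(* [E] is the fixed point of the contraction in [level_bound_step]; the crude constant [B] decays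
   geometrically. *)
pose B := crude_cst n e G; pose E := e * (2 + 2 * ball_vol R n) * (2 / th).
have B0 : 0 <= B.
  rewrite /B /crude_cst mulr_ge0//; last by rewrite mulr_ge0 ?omega_ge0.
  by rewrite mulr_ge0// addr_ge0 ?mulr_ge0// ltW.
have E0 : 0 <= E by rewrite /E !mulr_ge0 ?addr_ge0 ?invr_ge0 ?mulr_ge0 ?ltW.
have q0 : 0 <= 1 - th / 2 by lra.
have H k : forall x0 r, 0 < r -> r <= r0 ->
    level_bound n d f (cubeQ x0 r) ((enorm (g x0) + ((1 - th / 2) ^+ k * B + E)) * r ^+ N).
  elim: k => [|k IH] y s s1 sr.
    apply: (level_bound_sub (@subset_refl _ _) _ (level_bound_crude e0 Nr0 Hf HG y s1 sr)).
    rewrite expr0 mul1r; apply: ler_wpM2r; first by rewrite exprn_ge0// ltW.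
    by rewrite -/B; have := enorm_ge0 (g y); lra.
  have bk : 0 <= (1 - th / 2) ^+ k * B + E by rewrite addr_ge0// mulr_ge0// exprn_ge0.
  have := level_bound_step e0 Nr0 Hf Hg HG bk IH y s1 sr.
  congr level_bound; congr (_ * _); congr (_ + _).
  by rewrite /E exprS -/th; field; rewrite gt_eqF.
have [k hk] : exists k, (1 - th / 2) ^+ k * B <= e.
  have /cvg_expr : `|1 - th / 2| < 1 by rewrite ger0_norm//; lra.
  have Bp : 0 < B + 1 by rewrite ltr_wpDl.
  move=> /cvgrPdist_lt/(_ (e / (B + 1)))[]; first by rewrite divr_gt0.
  move=> k _ /(_ k (leqnn k)); rewrite sub0r normrN ger0_norm ?exprn_ge0// ltr_pdivlMr// => h.
  by exists k; apply: le_trans (ltW h); rewrite ler_wpM2l ?exprn_ge0// lerDl.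
apply: (level_bound_sub (@subset_refl _ _) _ (H k _ _ r1 rr)).
apply: ler_wpM2r; first by rewrite exprn_ge0// ltW.
rewrite lerD2l /limit_cst mulrDl mul1r lerD//.
by rewrite /E -/th -[leLHS]mulrA [leLHS]mulrC.
Qed.

Hypothesis mg : measurable_fun setT ((fun x => enorm (g x)) : borel_rV R N -> R).

Lemma integral_norm_fin : (\int[cubeP R N]_x (enorm (g x))%:E)%E \is a fin_num.
Proof.
rewrite ge0_fin_numE; last by apply: integral_ge0 => x _; rewrite lee_fin enorm_ge0.
apply: (@le_lt_trans _ _ (\int[cubeP R N]_x cst G%:E x)%E).
  apply: ge0_le_integral => //=.
  - by move=> x _; rewrite lee_fin enorm_ge0.
  - exact/measurable_EFinP.
  - by move=> x _; rewrite lee_fin HG.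
by rewrite /cst integral_cubeP_cst ltry.
Qed.

(** A Riemann sum over a grid of small cubes; comparing the corner value with the values in the cell
    costs one more [e]. *)
Lemma level_bound_unit_cube :
  level_bound n d f (@unit_cube R N)
    (fine (\int[cubeP R N]_x (enorm (g x))%:E)%E + (1 + limit_cst) * e).
Proof.
have c0 : 0 <= limit_cst.
  by rewrite /limit_cst addr_ge0// mulr_ge0 ?divr_ge0 ?addr_ge0 ?mulr_ge0// ltW// ball_vol_gt0.
have [K [K0 hK]] : exists K : nat, (0 < K)%N /\ K%:R^-1 <= r0.
  have /archi_boundP h : 0 <= r0^-1 by rewrite invr_ge0 ltW.
  exists (Num.bound r0^-1).+1; split => //.
  by rewrite invf_ple ?posrE// ltW// (lt_trans h)// ltr_nat.
have K0' : 0 < K%:R :> R by rewrite ltr0n.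
have iK : 0 < (K%:R^-1 : R) by rewrite invr_gt0.
pose I := {ffun 'I_N -> 'I_K}.
pose x_ (k : I) : 'rV[R]_N := \row_i ((k i)%:R / K%:R).
have cellQ (k : I) : grid_cell k `<=` cubeQ (x_ k) K%:R^-1.
  move=> x hx i; have [h1 h2] := hx i; rewrite mxE; split=> //; apply: ltW.
  by move: h2; rewrite -[(k i).+1]addn1 natrD mulrDl mul1r.
have hS (k : I) : k \in enum I -> level_bound n d f (cubeQ (x_ k) K%:R^-1)
    ((enorm (g (x_ k)) + limit_cst * e) * K%:R^-1 ^+ N).
  by move=> _; exact: level_bound_cube.
apply: level_bound_sub (level_bound_seq hS).
  move=> x hx; have [k hk] := grid_cell_ex K0 hx.
  by exists k; rewrite ?mem_enum//; exact: cellQ.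
rewrite (eq_bigr (fun k : I => enorm (g (x_ k)) * K%:R^-1 ^+ N + limit_cst * e * K%:R^-1 ^+ N)); last first.
  by move=> k _; rewrite mulrDl.
rewrite big_split/= (mulrDl 1 limit_cst e) mul1r addrA lerD//; last first.
  rewrite big_const_seq count_predT -cardE iter_addr addr0 card_ffun !card_ord.
  rewrite -[_ *+ _]mulr_natr -mulrA natrX exprVn mulVf ?mulr1//.
  by rewrite expf_neq0// gt_eqF.
have mge : measurable_fun setT ((fun x => (enorm (g x) + e)%:E) : borel_rV R N -> \bar R).
  by apply/measurable_EFinP; apply: measurable_funD => //; exact: measurable_cst.
have h : (\sum_(k <- enum I) \int[cubeP R N]_(x in grid_cell k) (enorm (g x) + e)%:E <=
    \int[cubeP R N]_(x in setT) (enorm (g x) + e)%:E)%E.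
  apply: sum_integral_le => //.
  - exact: enum_uniq.
  - by move=> k; exact: measurable_box.
  - by move=> i j x hi hj; apply/ffunP => l; exact: (grid_cell_inj K0 hi hj).
  - by move=> x; rewrite lee_fin addr_ge0 ?enorm_ge0// ltW.
rewrite -lee_fin EFinD fineK ?integral_norm_fin//.
apply: (@le_trans _ _ (\int[cubeP R N]_(x in setT) (enorm (g x) + e)%:E)%E); last first.
  under eq_integral do rewrite EFinD.
  rewrite ge0_integralD//=.
  - by rewrite integral_cubeP_cst.
  - by move=> x _; rewrite lee_fin enorm_ge0.
  - exact/measurable_EFinP.
  - by move=> x _; rewrite lee_fin ltW.
apply: le_trans h; rewrite -sumEFin; apply: lee_sum => k _.
apply: (@le_trans _ _ (\int[cubeP R N]_(x in grid_cell k) cst (enorm (g (x_ k)))%:E x)%E).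
  rewrite integral_cst; last exact: measurable_box.
  rewrite [X in (_ <= _ * X)%E](_ : _ = ((K%:R^-1) ^+ N)%:E); last exact: cubeP_grid_cell.
  by rewrite -EFinM.
apply: ge0_le_integral => //=.
- exact: measurable_box.
- by move=> x _; rewrite lee_fin enorm_ge0.
- exact: measurable_funTS.
- move=> x /cellQ hx; rewrite lee_fin.
  by have := Hg iK hK hx; rewrite ler_norml => /andP[]; lra.
Qed.

End LevelBoundLimit.

Section Taylor.
Variables (R : realType) (n : nat).
Local Notation N := n.+1.
Variables (f : 'rV[R]_N -> R) (g : 'rV[R]_N -> 'rV[R]_N) (C : R).
Hypothesis C0 : 0 <= C.
Hypothesis Tf : forall x h, `|f (x + h) - f x - edot (g x) h| <= C * enorm h ^+ 2.

(** Compare the expansions from [x] and from [y] at one point, with an increment [h] parallel to the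
    difference of the gradients and as long as [y - x]; the three remainders add up to 6 = 1 + 1 +
    4. *)
Lemma taylor_grad_lipschitz x y : enorm (g x - g y) <= 6 * C * enorm (x - y).
Proof.
rewrite enormB (enormB x).
have [v0|v0] := eqVneq (g y - g x) 0.
  by rewrite v0 enorm0 !mulr_ge0 ?enorm_ge0.
set v := g y - g x in v0 *; set w := y - x.
have vp : 0 < enorm v.
  by rewrite lt_neqAle enorm_ge0 andbT eq_sym; apply: contra_neq v0; exact: enorm_eq0.
have [w0|w0] := eqVneq (enorm w) 0.
  by move: vp; rewrite /v -[y](subrK x) -/w (enorm_eq0 w0) add0r subrr enorm0 ltxx.
have wp : 0 < enorm w by rewrite lt_neqAle enorm_ge0 eq_sym w0.
pose h := (enorm w / enorm v) *: v.
have hw : enorm h = enorm w.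
  by rewrite /h enormZ ger0_norm ?divr_ge0 ?enorm_ge0// divfK ?gt_eqF.
have vh : edot v h = enorm w * enorm v.
  by rewrite /h edotZr -sqr_enorm expr2 mulrA divfK ?gt_eqF.
have := Tf y h; have := Tf x (w + h); have := Tf x w.
have -> : x + (w + h) = y + h by rewrite addrA /w (addrC x) subrK.
have -> : x + w = y by rewrite /w addrC subrK.
rewrite hw edotDr => h1 h2 h3.
have h4 : enorm (w + h) ^+ 2 <= 4 * enorm w ^+ 2.
  rewrite (_ : 4 * _ = (2 * enorm w) ^+ 2); last by ring.
  rewrite ler_sqr ?nnegrE ?enorm_ge0 ?mulr_ge0 ?enorm_ge0//.
  by apply: le_trans (enormD _ _) _; rewrite hw; lra.
have h5 := ler_wpM2l C0 h4.
have : edot v h <= 6 * C * enorm w ^+ 2.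
  rewrite /v edotBl.
  move: h1 h2 h3; rewrite !ler_norml => /andP[a1 a2] /andP[b1 b2] /andP[c1 c2].
  lra.
by rewrite vh expr2 mulrA [leLHS]mulrC ler_pM2r.
Qed.

Lemma eilenberg_bound (d eta G : R) : 0 < d -> 0 < eta -> (forall x, enorm (g x) <= G) ->
  level_bound n d f (@unit_cube R N) (fine (\int[cubeP R N]_x (enorm (g x))%:E)%E + eta).
Proof.
move=> d0 eta0 HG.
have Np : 0 < N%:R :> R by [].
have c0 : 0 < 1 + limit_cst R n.
  by rewrite /limit_cst ltr_wpDr// addr_ge0// mulr_ge0 ?divr_ge0 ?addr_ge0 ?mulr_ge0// ltW// ball_vol_gt0.
pose e := eta / (1 + limit_cst R n).
have e0 : 0 < e by rewrite divr_gt0.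
(* Replacing [g y] by [g x0] in the expansion costs 6 C (N r)^2 on top of the remainder C (N r)^2,
   hence the 7. *)
pose D := 7 * C * N%:R ^+ 2 + 6 * C * N%:R + 1.
have D0 : 0 < D by rewrite /D ltr_wpDl// addr_ge0// !mulr_ge0.
pose r0 := Num.min (d / N%:R) (e / D).
have r00 : 0 < r0 by rewrite /r0 lt_min !divr_gt0.
have r0d : N%:R * r0 <= d by rewrite mulrC -ler_pdivlMr// /r0 ge_min lexx.
have r0e : D * r0 <= e by rewrite mulrC -ler_pdivlMr// /r0 ge_min lexx orbT.
have rD r : 0 < r -> r <= r0 -> (7 * C * N%:R ^+ 2) * r <= e /\ (6 * C * N%:R) * r <= e.
  move=> r1 rr; have h : D * r <= e by apply: le_trans r0e; rewrite ler_pM2l.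
  have h1 : 0 <= 7 * C * N%:R ^+ 2 * r by rewrite !mulr_ge0// ltW.
  have h2 : 0 <= 6 * C * N%:R * r by rewrite !mulr_ge0// ltW.
  by move: h; rewrite /D; move: (7 * C * N%:R ^+ 2) (6 * C * N%:R) h1 h2 => a b; nra.
rewrite -[eta](divfK (lt0r_neq0 c0)) -/e mulrC.
apply: (level_bound_unit_cube e0 r00 r0d) => //.
- move=> x0 r r1 rr x y hx hy.
  have hx0 : cubeQ x0 r x0 by move=> i; split=> //; rewrite lerDl ltW.
  have d1 := cubeQ_diam (ltW r1) hx hy.
  have d2 := cubeQ_diam (ltW r1) hy hx0.
  have T := Tf y (x - y); rewrite (addrC y) subrK in T.
  have L := taylor_grad_lipschitz y x0.
  have [h _] := rD r r1 rr.
  have E : f x - f y - edot (g x0) (x - y) =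
      (f x - f y - edot (g y) (x - y)) + edot (g y - g x0) (x - y).
    by rewrite edotBl; ring.
  rewrite E; apply: le_trans (ler_normD _ _) _.
  have s1 : enorm (x - y) ^+ 2 <= (N%:R * r) ^+ 2.
    by rewrite ler_sqr ?nnegrE ?enorm_ge0// mulr_ge0// ltW.
  have s2 : `|edot (g y - g x0) (x - y)| <= 6 * C * (N%:R * r) * (N%:R * r).
    apply: le_trans (abs_edot_le _ _) _; apply: ler_pM; rewrite ?enorm_ge0//.
    by apply: le_trans L _; rewrite ler_wpM2l// mulr_ge0.
  apply: le_trans (lerD T s2) _.
  have s3 := ler_wpM2l C0 s1.
  apply: le_trans (lerD s3 (lexx _)) _.
  rewrite (_ : _ + _ = 7 * C * N%:R ^+ 2 * r * r); last by ring.
  by rewrite ler_pM2r.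
- move=> x0 r r1 rr x hx.
  have hx0 : cubeQ x0 r x0 by move=> i; split=> //; rewrite lerDl ltW.
  have [_ h] := rD r r1 rr.
  apply: le_trans (abs_enormB _ _) _; apply: le_trans (taylor_grad_lipschitz _ _) _.
  apply: le_trans h; rewrite -[leRHS]mulrA; apply: ler_wpM2l; first by rewrite mulr_ge0.
  exact: cubeQ_diam (ltW r1) hx hx0.
- apply: continuous_measurable_rV; apply/continuous_enormP => x eps eps0.
  exists (eps / (6 * C + 1)); first by rewrite divr_gt0// ltr_wpDl// mulr_ge0.
  move=> y; rewrite ltr_pdivlMr ?ltr_wpDl ?mulr_ge0// => hy.
  apply: le_lt_trans (abs_enormB _ _) _; apply: le_lt_trans (taylor_grad_lipschitz _ _) _.
  by apply: le_lt_trans hy; rewrite mulrC ler_wpM2l ?enorm_ge0// lerDl.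
Qed.

End Taylor.

(** * Integration by parts on the torus *)

Section PartialDerivative.
Variables (R : realType) (m : nat) (phi : 'rV[R]_m -> R) (L : R) (i : 'I_m).
Hypothesis phiL : forall x y, `|phi x - phi y| <= L * enorm (x - y).
Local Notation mu := (@lebesgue_measure R).

Definition quot (h : R) (x : 'rV[R]_m) : R := h^-1 * (phi (x + h *: ecoord R i) - phi x).

Lemma enorm_ecoord : enorm (ecoord R i) = 1.
Proof.
rewrite /enorm /edot (bigD1 i)//= big1 => [|j ji].
  by rewrite !mxE !eqxx mulr1 addr0 sqrtr1.
by rewrite !mxE (negbTE ji) andbF mulr0.
Qed.

Let L0 : 0 <= L.
Proof.
have := phiL (ecoord R i) 0; rewrite subr0 enorm_ecoord mulr1.
exact: le_trans.
Qed.

Lemma quot_le h x : `|quot h x| <= L.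
Proof.
rewrite /quot; have [->|h0] := eqVneq h 0; first by rewrite invr0 mul0r normr0.
rewrite normrM normfV mulrC ler_pdivrMr ?normr_gt0//.
apply: le_trans (phiL _ _) _; rewrite [x + _]addrC addrK enormZ enorm_ecoord mulr1//.
Qed.

Lemma lipschitz_continuous_rV : continuous phi.
Proof.
apply/continuous_enormP => x e e0; exists (e / (L + 1)); first by rewrite divr_gt0// ltr_wpDl.
move=> y; rewrite ltr_pdivlMr ?ltr_wpDl// => h; apply: le_lt_trans (phiL _ _) _.
by apply: le_lt_trans h; rewrite mulrC ler_wpM2l ?enorm_ge0// lerDl.
Qed.

Lemma measurable_quot h : measurable_fun setT (quot h : borel_rV R m -> R).
Proof.
have mp : measurable_fun setT (phi : borel_rV R m -> R).
  by apply: continuous_measurable_rV; exact: lipschitz_continuous_rV.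
apply: measurable_funM; first exact: measurable_cst.
by apply: measurable_funB => //; apply: (measurableT_comp mp); exact: measurable_addr_rV.
Qed.

Lemma quot_continuous h x (e : R) : h != 0 -> 0 < e ->
  \forall k \near h, `|quot k x - quot h x| < e.
Proof.
move=> h0 e0.
have c1 : (fun k : R => phi (x + k *: ecoord R i) - phi x) k @[k --> h] --> phi (x + h *: ecoord R i) - phi x.
  apply: cvgB; last exact: cvg_cst.
  apply/cvgrPdist_lt => eps eps0; near=> k.
  apply: le_lt_trans (phiL _ _) _.
  rewrite opprD addrACA subrr add0r -scalerBl enormZ enorm_ecoord mulr1.
  have : `|h - k| < eps / (L + 1).
    near: k; apply: (@cvgr_dist_lt _ _ _ (nbhs h) _ id h); first exact: cvg_id.
    by rewrite divr_gt0// ltr_wpDl.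
  rewrite ltr_pdivlMr ?ltr_wpDl//; apply: le_lt_trans.
  by rewrite mulrC ler_wpM2l// lerDl.
have c2 : quot k x @[k --> h] --> quot h x by apply: cvgM => //; apply: cvgV => //; exact: cvg_id.
by move/cvgrPdist_lt : c2 => /(_ e e0); apply: filterS => k; rewrite distrC.
Unshelve. all: by end_near. Qed.

(** Cauchy's criterion for the difference quotients, restricted to rational increments so that the
    set of such points is a countable combination of measurable sets. *)
Definition cauchy_at (x : 'rV[R]_m) := forall j : nat, exists p : nat, forall qq : rat * rat,
  0 < `|ratr qq.1 : R| < p.+1%:R^-1 -> 0 < `|ratr qq.2 : R| < p.+1%:R^-1 ->
  `|quot (ratr qq.1) x - quot (ratr qq.2) x| <= j.+1%:R^-1.

Lemma measurable_cauchy_at : measurable (cauchy_at : set (borel_rV R m)).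
Proof.
pose A j p (qq : rat * rat) : set (borel_rV R m) :=
  [set x | 0 < `|ratr qq.1 : R| < p.+1%:R^-1 -> 0 < `|ratr qq.2 : R| < p.+1%:R^-1 ->
    `|quot (ratr qq.1) x - quot (ratr qq.2) x| <= j.+1%:R^-1].
have -> : cauchy_at = \bigcap_j \bigcup_p \bigcap_(qq in [set: rat * rat]) A j p qq.
  apply/seteqP; split => x h j.
    by move=> _; have [p hp] := h j; exists p => // qq _; exact: hp.
  by have [p _ hp] := h j I; exists p => qq; exact: hp.
apply: bigcapT_measurable => j; apply: bigcupT_measurable => p.
rewrite -[X in measurable X]setCK; apply: measurableC; rewrite setC_bigcap.
apply: countable_bigcupT_measurable; first exact: countableP.
move=> qq; apply: measurableC.
have [h1|h1] := boolP (0 < `|ratr qq.1 : R| < p.+1%:R^-1); last first.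
  by rewrite (_ : A j p qq = setT)//; apply/seteqP; split => // x _; rewrite /A/= (negbTE h1).
have [h2|h2] := boolP (0 < `|ratr qq.2 : R| < p.+1%:R^-1); last first.
  by rewrite (_ : A j p qq = setT)//; apply/seteqP; split => // x _; rewrite /A/= (negbTE h2).
rewrite (_ : A j p qq = [set x | `|quot (ratr qq.1) x - quot (ratr qq.2) x| <= j.+1%:R^-1]); last first.
  by apply/seteqP; split => x; rewrite /A/= ?h1 ?h2 => h; [exact: h|move=> _ _].
have mq : measurable_fun setT ((fun x => `|quot (ratr qq.1) x - quot (ratr qq.2) x|) : borel_rV R m -> R).
  by apply: measurableT_comp => //; apply: measurable_funB; exact: measurable_quot.
rewrite (_ : [set x | _] = (fun x : borel_rV R m => `|quot (ratr qq.1) x - quot (ratr qq.2) x|) @^-1` `]-oo, j.+1%:R^-1]%classic).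
  by rewrite -[X in measurable X]setTI; apply: mq.
by apply/seteqP; split => x /=; rewrite in_itv.
Qed.

Lemma derivable_quotP x : derivable phi x (ecoord R i) <-> cvg (quot h x @[h --> 0^']).
Proof.
rewrite /derivable (_ : (fun h => h^-1 *: _) = (fun h => quot h x))//.
by apply/funext => h; rewrite /quot /= [_ + x]addrC.
Qed.

Lemma partial_derivE x : 'D_(ecoord R i) phi x = lim (quot h x @[h --> 0^']).
Proof.
rewrite /derive (_ : (fun h => h^-1 *: _) = (fun h => quot h x))//.
by apply/funext => h; rewrite /quot /= [_ + x]addrC.
Qed.

Lemma natSinv_small (e : R) : 0 < e -> exists j : nat, j.+1%:R^-1 < e.
Proof.
move=> e0; have /archi_boundP h0 : 0 <= e^-1 by rewrite invr_ge0 ltW.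
exists (Num.bound e^-1); rewrite invf_plt ?posrE//.
by apply: lt_trans h0 _; rewrite ltr_nat.
Qed.

(** Rational increments suffice because [quot] is continuous in its increment away from zero. *)
Lemma cauchy_atP x : cauchy_at x <-> derivable phi x (ecoord R i).
Proof.
rewrite derivable_quotP; split=> [h|/cvg_ex[l /cvgrPdist_le hl] j].
  apply/cauchy_cvgP; apply: cauchy_exP => e e0.
  have [j hj] : exists j : nat, j.+1%:R^-1 < e / 2 by apply: natSinv_small; rewrite divr_gt0.
  have [p hp] := h j; have p0 : 0 < (p.+1%:R^-1 : R) by rewrite invr_gt0.
  have [q0] := rat_in_itvoo p0; rewrite in_itv/= => q0p.
  have aq0 : 0 < `|ratr q0 : R| < p.+1%:R^-1 by rewrite gtr0_norm//; case/andP: q0p.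
  exists (quot (ratr q0) x); near=> k.
  have k0 : k != 0 by near: k; exact: nbhs_dnbhs_neq.
  have kp : `|k| < p.+1%:R^-1 by near: k; exact: dnbhs0_lt.
  have e2 : 0 < e / 2 by rewrite divr_gt0.
  have /nbhs_normP[eps /= eps0 heps] : \forall k' \near k,
      `|quot k' x - quot k x| < e / 2 /\ (k' != 0 /\ `|k'| < p.+1%:R^-1).
    apply: filterI; first exact: quot_continuous.
    apply: filterI.
      apply/nbhs_normP; exists `|k|; first by rewrite /= normr_gt0.
      by move=> k'; rewrite /ball_/=; apply: contraTneq => ->; rewrite subr0 ltxx.
    apply/nbhs_normP; exists (p.+1%:R^-1 - `|k|); first by rewrite /= subr_gt0.
    move=> k'; rewrite /ball_/= ltrBrDr; apply: le_lt_trans.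
    by rewrite distrC -{1}(subrK k k') ler_normD.
  have [q] : exists q : rat, ratr q \in `](k - eps), (k + eps)[ by apply: rat_in_itvoo; lra.
  rewrite in_itv/= => /andP[q1 q2].
  have [hq1 [hq2 hq3]] : `|quot (ratr q) x - quot k x| < e / 2 /\ (ratr q != 0 :> R /\ `|ratr q : R| < p.+1%:R^-1).
    by apply: heps; rewrite /ball_/= ltr_norml; apply/andP; split; lra.
  have := hp (q0, q) aq0; rewrite /= normr_gt0 hq2 hq3 => /(_ isT) hqq.
  rewrite /ball/= -[e in _ < e]/(e : R).
  have := ler_distD (quot (ratr q) x) (quot (ratr q0) x) (quot k x).
  move=> /le_lt_trans; apply; rewrite [ltRHS](splitr e) ler_ltD//.
  exact: le_trans hqq (ltW hj).
have j0 : 0 < (j.+1%:R^-1 / 2 : R) by rewrite divr_gt0// invr_gt0.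
have [d /= d0 hd] := hl _ j0.
have [p hp] := natSinv_small d0.
exists p => -[q q'] /= /andP[q0 qp] /andP[q0' qp'].
have hq (s : rat) : 0 < `|ratr s : R| -> `|ratr s : R| < p.+1%:R^-1 -> `|l - quot (ratr s) x| <= j.+1%:R^-1 / 2.
  move=> s0 sp; apply: hd; rewrite /ball_/= ?sub0r ?normrN; first exact: lt_trans sp hp.
  by rewrite -normr_gt0.
have := ler_distD l (quot (ratr q) x) (quot (ratr q') x).
move=> /le_trans; apply; rewrite [leRHS]splitr lerD ?hq//.
by rewrite distrC hq.
Unshelve. all: by end_near. Qed.

(** On each line in direction [i] the function is Lipschitz in one variable, so the bad points form
    a null set there and Fubini concludes. *)
Lemma cubeP_not_cauchy : cubeP R m (~` cauchy_at) = 0%E.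
Proof.
apply: (@cubeP_null_lines R m _ i); first by apply: measurableC; exact: measurable_cauchy_at.
move=> x; set S := [set s : R | _].
have mS : measurable (S : set (measurableTypeR R)).
  rewrite (_ : S = `[0, 1]%classic `&` ((fun s : measurableTypeR R => (x + (s : R) *: ecoord R i : borel_rV R m)) @^-1` (~` cauchy_at))).
    apply: measurableI => //; rewrite -[X in measurable X]setTI.
    have : measurable_fun setT ((fun s : measurableTypeR R => (x + (s : R) *: ecoord R i)) : measurableTypeR R -> borel_rV R m).
      apply: (@measurability _ _ _ (borel_rV R m) _ _ (@open 'rV[R]_m)) => //.
      move=> _ [U oU <-]; rewrite setTI.
      apply: open_measurable; apply: open_comp => // s _.
      move=> B /nbhs_enormP[d d0 hd]; apply/nbhs_normP; exists d => //= t; rewrite /ball_/= => st.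
      by apply: hd; rewrite opprD addrACA subrr add0r -scalerBl enormZ enorm_ecoord mulr1 distrC.
    by apply => //; apply: measurableC; exact: measurable_cauchy_at.
  by apply/seteqP; split => s /=; rewrite in_itv/=.
pose psi (s : R) := phi (x + s *: ecoord R i).
have psiL s t : `|psi s - psi t| <= L * `|s - t|.
  apply: le_trans (phiL _ _) _.
  by rewrite opprD addrACA subrr add0r -scalerBl enormZ enorm_ecoord mulr1.
(* A larger open interval, so that the end points 0 and 1 are covered. *)
have [A [mA A0 hA]] := @lipschitz_ae_derivable R L psi (-1) 2 psiL.
apply/eqP; rewrite eq_le measure_ge0 andbT -A0; apply: le_measure; rewrite ?inE//.
move=> s [/andP[s0 s1] ns]; apply: hA => /= h; apply: ns; apply/cauchy_atP.
have : derivable psi s 1 by apply: h; lra.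
rewrite derivable_quotP /derivable (_ : (fun h => h^-1 *: _) = (fun h => quot h (x + s *: ecoord R i)))//.
apply/funext => k; rewrite /quot /psi/=; congr (_ * (phi _ - _)).
by rewrite [X in X *: _](_ : _ = s + k) ?scalerDl ?addrA// /GRing.scale/= mulr1 addrC.
Qed.

End PartialDerivative.

(** * Bounded measurable functions on the torus *)

Section BoundedMeasurable.
Variables (R : realType) (m : nat).
Local Notation T := (borel_rV R m).
Local Notation P := (cubeP R m).
Implicit Types u v : 'rV[R]_m -> R.

Definition bmf u := measurable_fun setT (u : T -> R) /\ exists M : R, forall x, `|u x| <= M.

Lemma bmf_integrable u : bmf u -> P.-integrable setT (EFin \o (u : T -> R)).
Proof.
move=> [mu_ [M hM]]; apply: measurable_bounded_integrable => //.
  by rewrite [X in (X < _)%E](_ : _ = 1%E) ?ltry//; exact: (@probability_setT _ _ _ P).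
exists M; split; first exact: num_real.
by move=> y My x _; exact: le_trans (hM x) (ltW My).
Qed.

Lemma bmf_cst (c : R) : bmf (fun=> c).
Proof. by split; [exact: measurable_cst|exists `|c|]. Qed.

Lemma bmfD u v : bmf u -> bmf v -> bmf (fun x => u x + v x).
Proof.
move=> [mu_ [M hM]] [mv [K hK]]; split; first exact: measurable_funD.
by exists (M + K) => x; rewrite (le_trans (ler_normD _ _))// lerD.
Qed.

Lemma bmfM u v : bmf u -> bmf v -> bmf (fun x => u x * v x).
Proof.
move=> [mu_ [M hM]] [mv [K hK]]; split; first exact: measurable_funM.
by exists (M * K) => x; rewrite normrM ler_pM.
Qed.

Lemma bmfN u : bmf u -> bmf (fun x => - u x).
Proof.
move=> [mu_ [M hM]]; split; last by exists M => x; rewrite normrN.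
by apply: (measurableT_comp _ mu_); exact: oppr_measurable.
Qed.

Lemma bmfB u v : bmf u -> bmf v -> bmf (fun x => u x - v x).
Proof. by move=> hu hv; apply: bmfD => //; exact: bmfN. Qed.

Lemma bmf_norm u : bmf u -> bmf (fun x => `|u x|).
Proof.
move=> [mu_ [M hM]]; split; last by exists M => x; rewrite normr_id.
by apply: (measurableT_comp _ mu_); exact: normr_measurable.
Qed.

Lemma bmf_max u v : bmf u -> bmf v -> bmf (fun x => Num.max (u x) (v x)).
Proof.
move=> [mu_ [M hM]] [mv [K hK]]; split; first exact: measurable_maxr.
by exists (Num.max M K) => x; rewrite le_max; case: (leP (u x) (v x)) => _; rewrite ?hM ?hK ?orbT.
Qed.

Lemma bmf_sum (I : Type) (r : seq I) (F : I -> 'rV[R]_m -> R) :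
  (forall i, bmf (F i)) -> bmf (fun x => \sum_(i <- r) F i x).
Proof.
move=> h; elim: r => [|i r IH].
  by rewrite (_ : (fun x => _) = fun=> 0); [exact: bmf_cst|apply/funext => x; rewrite big_nil].
rewrite (_ : (fun x => _) = fun x => F i x + \sum_(j <- r) F j x); first exact: bmfD.
by apply/funext => x; rewrite big_cons.
Qed.

Lemma bmf_continuous u (M : R) : continuous u -> (forall x, `|u x| <= M) -> bmf u.
Proof. by move=> cu hM; split; [exact: continuous_measurable_rV|exists M]. Qed.

Lemma Rintegral_cubeP_cst (c : R) : \int[P]_x c = c.
Proof. by rewrite /Rintegral integral_cubeP_cst. Qed.

Lemma bmf_EFin u : bmf u -> (\int[P]_x (u x)%:E = (\int[P]_x u x)%:E)%E.
Proof.
move=> /bmf_integrable/integrable_fin_num h; rewrite /Rintegral fineK//.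
exact: h.
Qed.

Lemma bmf_shift u (a : 'rV[R]_m) : bmf u -> bmf (fun x => u (x + a)).
Proof.
move=> [mu_ [M hM]]; split; last by exists M => x.
exact: (measurableT_comp mu_ (@measurable_addr_rV R m a)).
Qed.

(** Adding the bound [M] makes the integrand nonnegative, as [integral_cubeP_periodic] requires. *)
Lemma Rintegral_periodic u (a : 'rV[R]_m) : bmf u -> periodic_fun u ->
  \int[P]_x u (x + a) = \int[P]_x u x.
Proof.
move=> hu pu; have [mu_ [M hM]] := hu.
have hM0 x : 0 <= u x + M by have := hM x; rewrite ler_norml => /andP[]; lra.
have h : \int[P]_x (u (x + a) + M) = \int[P]_x (u x + M).
  rewrite /Rintegral; congr fine.
  apply: (@integral_cubeP_periodic R m (fun x => (u x + M)%:E)).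
  - by apply/measurable_EFinP; apply: measurable_funD => //; exact: measurable_cst.
  - by move=> x; rewrite lee_fin.
  - by move=> z x; rewrite pu.
have hM' := bmf_integrable (bmf_cst M).
move: h; rewrite !RintegralD//=; try exact: bmf_integrable; last first.
  by apply: (bmf_integrable (bmf_shift a hu)).
exact: addIr.
Qed.

End BoundedMeasurable.

Section IntegrationByParts.
Variables (R : realType) (m : nat) (phi : 'rV[R]_m -> R) (L : R) (i : 'I_m).
Hypothesis phiL : forall x y, `|phi x - phi y| <= L * enorm (x - y).
Local Notation P := (cubeP R m).

Let Dphi (x : 'rV[R]_m) : R := 'D_(ecoord R i) phi x.

Lemma partial_cvg x : cauchy_at phi i x -> quot phi i k.+1%:R^-1 x @[k --> \oo] --> Dphi x.
Proof.
move=> /(cauchy_atP i phiL)/(derivable_quotP phi i) h.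
rewrite /Dphi partial_derivE.
have k0 : (k.+1%:R^-1 : R) @[k --> \oo] --> 0^'.
  move=> A [e /= e0 he]; change (\forall k \near \oo, A (k.+1%:R^-1)); near=> k.
  have k0 : (k.+1%:R^-1 : R) != 0 by rewrite invr_eq0.
  apply: (he _ _ k0).
  by near: k; exact: (@cvgr_dist_lt _ _ _ _ _ _ (0 : R) (@cvg_harmonic R) _ e0).
exact: (cvg_comp _ _ k0 h).
Unshelve. all: by end_near. Qed.

(** Where the limit does not exist, [lim] returns the default [point]. This fixes the derivative on
    the null set of bad points, so that [Dphi] is measurable and bounded everywhere. *)
Lemma partial_junk x : ~ cauchy_at phi i x -> Dphi x = (point : R).
Proof.
move=> h; rewrite /Dphi partial_derivE.
have nc : ~ cvg (quot phi i h0 x @[h0 --> 0^']).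
  by move=> hc; apply: h; apply: (cauchy_atP i phiL x).2; exact: (derivable_quotP phi i x).2.
exact: dvgP nc.
Qed.

Lemma bmf_partial : bmf Dphi.
Proof.
split.
  apply: (@measurable_fun_cvg _ (borel_rV R m) _ setT (fun k x =>
     quot phi i k.+1%:R^-1 x * \1_(cauchy_at phi i) x + (point : R) * \1_(~` cauchy_at phi i) x)).
    move=> k; have mc := measurable_cauchy_at i phiL.
    apply: measurable_funD; apply: measurable_funM.
    - exact: measurable_quot phiL _.
    - exact: measurable_indic.
    - exact: measurable_cst.
    - by apply: measurable_indic; exact: measurableC.
  move=> x _; have [h|h] := pselect (cauchy_at phi i x).
    rewrite (_ : (fun k => _) = fun k => quot phi i k.+1%:R^-1 x); first exact: partial_cvg.
    apply/funext => k.
    have nh : ~ (~` cauchy_at phi i) x by move=> /(_ h).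
    by rewrite !indicE (mem_set h) (memNset nh) mulr1 mulr0 addr0.
  rewrite (_ : (fun k => _) = fun k => (point : R)); first by rewrite -(partial_junk h); exact: cvg_cst.
  by apply/funext => k; rewrite !indicE (memNset h) (@mem_set _ (~` cauchy_at phi i)) ?mulr0 ?add0r ?mulr1.
exists (Num.max L `|point : R|) => x; have [h|h] := pselect (cauchy_at phi i x).
  rewrite le_max; apply/orP; left.
  apply: (@closed_cvg _ _ \oo _ (fun k : nat => `|quot phi i k.+1%:R^-1 x|) [set y : R | y <= L]).
  - exact: closed_le.
  - by apply: nearW => k /=; exact: quot_le phiL _ _.
  - exact: (cvg_norm (partial_cvg h)).
by rewrite partial_junk// le_max lexx orbT.
Qed.

Variables (B : R) (phiB : forall x, `|phi x| <= B) (phiP : periodic_fun phi).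
Variables (f : 'rV[R]_m -> R) (g : 'rV[R]_m -> 'rV[R]_m) (C : R).
Hypotheses (C0 : 0 <= C) (hf : bmf f) (fP : periodic_fun f) (hg : bmf (fun x => g x 0 i)).
Hypothesis Tf : forall x h, `|f (x + h) - f x - edot (g x) h| <= C * enorm h ^+ 2.

(** The difference quotients of the product [f * phi] have zero integral by periodicity and converge
    to the integrand almost everywhere; dominated convergence concludes. *)
Lemma integration_by_parts_partial :
  \int[P]_x (f x * Dphi x + phi x * g x 0 i) = 0.
Proof.
have hphi : bmf phi by apply: (bmf_continuous _ phiB); exact: lipschitz_continuous_rV phiL.
pose F (k : nat) x := (k.+1%:R : R) * (f (x + k.+1%:R^-1 *: ecoord R i) * phi (x + k.+1%:R^-1 *: ecoord R i) - f x * phi x).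
pose F' x := f x * Dphi x + phi x * g x 0 i.
have hfp : bmf (fun x => f x * phi x) by exact: bmfM.
have bF k : bmf (F k).
  apply: bmfM; first exact: bmf_cst.
  by apply: bmfB => //; exact: (bmf_shift _ hfp).
have bF' : bmf F' by apply: bmfD; apply: bmfM => //; exact: bmf_partial.
have IF k : \int[P]_x F k x = 0.
  rewrite RintegralZl//=; last first.
    by apply: (@bmf_integrable _ _ (fun x => f (x + _) * phi (x + _) - f x * phi x)); apply: bmfB => //; exact: (bmf_shift _ hfp).
  rewrite RintegralB//=; [|exact: (bmf_integrable (bmf_shift _ hfp))|exact: bmf_integrable].
  rewrite (@Rintegral_periodic _ _ (fun x => f x * phi x))//; first by rewrite subrr mulr0.
  by move=> z x; rewrite fP phiP.
have [_ [Bf hBf]] := hf; have [_ [Bg hBg]] := hg.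
have dq k x : k.+1%:R * (f (x + k.+1%:R^-1 *: ecoord R i) - f x) - g x 0 i =
   k.+1%:R * (f (x + k.+1%:R^-1 *: ecoord R i) - f x - edot (g x) (k.+1%:R^-1 *: ecoord R i)).
  have -> : edot (g x) (k.+1%:R^-1 *: ecoord R i) = k.+1%:R^-1 * g x 0 i.
    rewrite edotZr /edot (bigD1 i)//= big1 ?addr0 => [|j ji]; rewrite !mxE.
      by rewrite !eqxx mulr1.
    by rewrite (negbTE ji) andbF mulr0.
  by rewrite [in RHS]mulrBr mulrA mulfV ?mul1r.
have dqb k x : `|k.+1%:R * (f (x + k.+1%:R^-1 *: ecoord R i) - f x) - g x 0 i| <= C * k.+1%:R^-1.
  rewrite dq normrM ger0_norm//.
  apply: (@le_trans _ _ (k.+1%:R * (C * enorm (k.+1%:R^-1 *: ecoord R i) ^+ 2))).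
    by rewrite ler_wpM2l.
  rewrite enormZ enorm_ecoord mulr1 ger0_norm//.
  have : k.+1%:R != 0 :> R by [].
  move: (k.+1%:R : R) => t t0; rewrite (_ : t * _ = C * t^-1)//.
  by field.
have FE k x : F k x = f (x + k.+1%:R^-1 *: ecoord R i) * quot phi i k.+1%:R^-1 x +
    phi x * (k.+1%:R * (f (x + k.+1%:R^-1 *: ecoord R i) - f x)).
  by rewrite /F /quot invrK; ring.
have key : [sequence (\int[P]_(x in setT) (EFin \o (F n : borel_rV R m -> R)) x)%E]_n @ \oo -->
    (\int[P]_(x in setT) (EFin \o (F' : borel_rV R m -> R)) x)%E.
  have [//|||||_ _ //] := @dominated_convergence _ _ _ P setT measurableT
     (fun n => EFin \o (F n : borel_rV R m -> R)) (EFin \o (F' : borel_rV R m -> R))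
     (cst (Bf * L + B * (Bg + C))%:E).
  - by move=> k; apply/measurable_EFinP; case: (bF k).
  - by apply/measurable_EFinP; case: bF'.
  - exists (~` cauchy_at phi i); split.
    + by apply: measurableC; exact: measurable_cauchy_at i phiL.
    + exact: (cubeP_not_cauchy i phiL).
    + move=> x /=; apply: contra_not => hx _.
      apply: cvg_EFin; first by near=> k.
      rewrite (_ : fine \o _ = (fun k => F k x)); last exact/funext.
      under eq_fun do rewrite FE.
      have hinv : (fun k : nat => k.+1%:R^-1 : R) @ \oo --> (0 : R) by exact: cvg_harmonic.
      have c1 : (fun k => k.+1%:R * (f (x + k.+1%:R^-1 *: ecoord R i) - f x)) @ \oo --> g x 0 i.
        apply/cvgrPdist_le => e e0; near=> k.
        rewrite distrC (le_trans (dqb k x))//.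
        have : `|0 - k.+1%:R^-1 : R| <= e / (C + 1).
          near: k; apply: (@cvgr_dist_le _ _ _ _ _ _ (0 : R)) => //.
          by rewrite divr_gt0// ltr_wpDl.
        rewrite sub0r normrN ger0_norm// ler_pdivlMr ?ltr_wpDl// mulrDr mulr1 mulrC.
        by apply: le_trans; rewrite lerDl.
      have c2 : (fun k => f (x + k.+1%:R^-1 *: ecoord R i)) @ \oo --> f x.
        rewrite -[f x]addr0 -(mul0r (g x 0 i)).
        rewrite (_ : (fun k => _) = (fun k : nat => f x + k.+1%:R^-1 * (k.+1%:R * (f (x + k.+1%:R^-1 *: ecoord R i) - f x)))).
          by apply: cvgD; [exact: cvg_cst|exact: cvgM].
        by apply/funext => k; rewrite mulrA mulVf// mul1r addrCA subrr addr0.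
      by apply: cvgD; apply: cvgM => //; [exact: partial_cvg|exact: cvg_cst].
  - exact: (bmf_integrable (bmf_cst _ _)).
  - apply: aeW => x k _; rewrite /= lee_fin FE.
    apply: le_trans (ler_normD _ _) _; rewrite !normrM; apply: lerD.
      apply: ler_pM; rewrite ?normr_ge0 ?mulr_ge0//.
      by rewrite -normrM; exact: (quot_le i phiL k.+1%:R^-1 x).
    apply: ler_pM; rewrite ?normr_ge0//.
    rewrite -normrM; have h1 := dqb k x; have h2 := hBg x.
    have h3 : C * k.+1%:R^-1 <= C by rewrite ler_piMr// invf_le1// ler1n.
    have := ler_normD (k.+1%:R * (f (x + k.+1%:R^-1 *: ecoord R i) - f x) - g x 0 i) (g x 0 i).
    rewrite subrK => /le_trans; apply; rewrite [leRHS]addrC; apply: lerD => //.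
    exact: le_trans h1 h3.
have key2 : [sequence (\int[P]_(x in setT) (EFin \o (F n : borel_rV R m -> R)) x)%E]_n @ \oo --> 0%E.
  rewrite (_ : (fun n => _) = fun=> 0%E); first exact: cvg_cst.
  by apply/funext => k; rewrite (bmf_EFin (bF k)) IF.
have e : (\int[P]_(x in setT) (EFin \o (F' : borel_rV R m -> R)) x)%E = 0%E.
  exact: (cvg_unique (@ereal_hausdorff R) key key2).
by move: e; rewrite (bmf_EFin bF') => -[].
Unshelve. all: by end_near. Qed.

End IntegrationByParts.

Section Divergence.
Variables (R : realType) (n : nat) (V : 'rV[R]_n.+1 -> 'rV[R]_n.+1) (L : R).
Local Notation N := n.+1.
Local Notation P := (cubeP R N).
Hypothesis VP : periodic_fun V.
Hypothesis VL : forall x y, enorm (V x - V y) <= L * enorm (x - y).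

Lemma lipschitz_coord i x y : `|V x 0 i - V y 0 i| <= L * enorm (x - y).
Proof. by apply: le_trans (VL x y); have := coord_le_enorm (V x - V y) i; rewrite !mxE. Qed.

Lemma periodic_lipschitz_bounded : exists B, forall x, enorm (V x) <= B.
Proof.
have L0 : 0 <= L.
  have := VL (ecoord R ord0) 0; rewrite subr0 enorm_ecoord mulr1.
  by apply: le_trans; exact: enorm_ge0.
exists (enorm (V 0) + L * N%:R) => x; have [z hz] := unit_cube_shift x.
rewrite -(VP z x) -[V _](subrK (V 0)) addrC (le_trans (enormD _ _))// lerD2l.
apply: le_trans (VL _ _) _; rewrite ler_wpM2l// subr0 -[N%:R]mulr1 enorm_le_const// => i.
by have [h1 h2] := hz i; rewrite ger0_norm// ltW.
Qed.

Lemma bmf_coord i : bmf (fun x => V x 0 i).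
Proof.
have [B hB] := periodic_lipschitz_bounded.
apply: (@bmf_continuous _ _ _ B); first exact: lipschitz_continuous_rV (lipschitz_coord i).
by move=> x; apply: le_trans (coord_le_enorm _ _) _.
Qed.

Lemma bmf_divergence : bmf (divergence V).
Proof.
apply: (@bmf_sum _ _ 'I_N (index_enum _) (fun i x => 'D_(ecoord R i) (fun y => V y 0 i) x)) => i.
exact: bmf_partial i (lipschitz_coord i).
Qed.

Lemma Rintegral_bmf_sum (I : Type) (r : seq I) (F : I -> 'rV[R]_N -> R) :
  (forall i, bmf (F i)) -> \int[P]_x (\sum_(i <- r) F i x) = \sum_(i <- r) \int[P]_x F i x.
Proof.
move=> h; elim: r => [|i r IH].
  rewrite big_nil -[RHS](@Rintegral_cubeP_cst R N); congr Rintegral.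
  by apply/funext => x; rewrite big_nil.
rewrite big_cons -IH -RintegralD//=.
- by congr Rintegral; apply/funext => x; rewrite big_cons.
- exact: bmf_integrable.
- by apply: (bmf_integrable (bmf_sum _ _)).
Qed.

Variables (f : 'rV[R]_N -> R) (g : 'rV[R]_N -> 'rV[R]_N) (C : R).
Hypotheses (C0 : 0 <= C) (hf : bmf f) (fP : periodic_fun f) (hg : forall i, bmf (fun x => g x 0 i)).
Hypothesis Tf : forall x h, `|f (x + h) - f x - edot (g x) h| <= C * enorm h ^+ 2.

Lemma bmf_edot : bmf (fun x => edot (g x) (V x)).
Proof.
apply: (@bmf_sum _ _ 'I_N (index_enum _) (fun i x => g x 0 i * V x 0 i)) => i.
by apply: bmfM => //; exact: bmf_coord.
Qed.

Lemma integration_by_parts_div :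
  \int[P]_x edot (g x) (V x) = - \int[P]_x (f x * divergence V x).
Proof.
apply/eqP; rewrite -addr_eq0 addrC -RintegralD//=; last 2 first.
- by apply: bmf_integrable; apply: bmfM => //; exact: bmf_divergence.
- by apply: bmf_integrable; exact: bmf_edot.
have [B hB] := periodic_lipschitz_bounded.
have E x : f x * divergence V x + edot (g x) (V x) =
    \sum_(i < N) (f x * 'D_(ecoord R i) (fun y => V y 0 i) x + V x 0 i * g x 0 i).
  rewrite big_split/= /divergence mulr_sumr; congr (_ + _).
  by apply: eq_bigr => i _; rewrite mulrC.
under eq_Rintegral do rewrite E.
pose F i x := f x * 'D_(ecoord R i) (fun y => V y 0 i) x + V x 0 i * g x 0 i.
have bF i : bmf (F i).
  apply: (@bmfD R N (fun x => f x * 'D_(ecoord R i) (fun y => V y 0 i) x) (fun x => V x 0 i * g x 0 i)).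
    by apply: (@bmfM R N f) => //; exact: bmf_partial (lipschitz_coord i).
  by apply: (@bmfM R N (fun x => V x 0 i)) => //; exact: bmf_coord.
rewrite (Rintegral_bmf_sum (index_enum 'I_N) bF) big1// => i _.
have hB' x : `|V x 0 i| <= B by apply: le_trans (coord_le_enorm _ _) _.
have hP : periodic_fun (fun y => V y 0 i) by move=> z x; rewrite VP.
exact: (integration_by_parts_partial (lipschitz_coord i) hB' hP C0 hf fP (hg i) Tf).
Qed.

End Divergence.

(** * Hoelder's inequality on a set *)

Section HoelderPower.
Variables (R : realType) (n : nat).
Local Notation N := n.+1.
Local Notation P := (cubeP R N).

Lemma Rintegral_ge0 (w : 'rV[R]_N -> R) : (forall x, 0 <= w x) -> 0 <= \int[P]_x w x.
Proof. by move=> w0; apply: fine_ge0; apply: integral_ge0 => x _; rewrite lee_fin. Qed.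

Lemma Rintegral_le (u w : 'rV[R]_N -> R) : bmf u -> bmf w -> (forall x, u x <= w x) ->
  \int[P]_x u x <= \int[P]_x w x.
Proof.
move=> hu hw h; apply: le_Rintegral => //; [exact: bmf_integrable hu|exact: bmf_integrable hw].
Qed.

Lemma Rintegral_lin (c : R) (u w : 'rV[R]_N -> R) : bmf u -> bmf w ->
  \int[P]_x (u x + c * w x) = \int[P]_x u x + c * \int[P]_x w x.
Proof.
move=> hu hw; rewrite RintegralD//; first last.
- by apply: bmf_integrable; apply: (@bmfM R N (fun=> c) w) => //; exact: bmf_cst.
- exact: bmf_integrable hu.
by rewrite RintegralZl//; exact: bmf_integrable hw.
Qed.

(** The arithmetic-geometric inequality for [x ^+ N] and [n] ones: Young's inequality in the case
    that Hoelder's inequality against an indicator requires. *)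
Lemma bernoulli_power (x : R) : 0 <= x -> N%:R * x <= x ^+ N + n%:R.
Proof.
move=> x0; elim: n => [|k IH]; first by rewrite mul1r expr1 addr0.
have h := ler_wpM2l x0 IH.
rewrite exprS; move: h; rewrite mulrDr -exprS => h.
have : 0 <= k.+1%:R * (x - 1) ^+ 2 by rewrite mulr_ge0// sqr_ge0.
move: h; rewrite !(exprS _ k.+1) -![k.+2%:R]natr1 -![k.+1%:R]natr1.
move: (x ^+ k.+1) (k%:R : R) => y a; rewrite expr2; nra.
Qed.

Lemma bmfX (w : 'rV[R]_N -> R) k : bmf w -> bmf (fun x => w x ^+ k).
Proof.
move=> hw; elim: k => [|k IH].
  by rewrite (_ : (fun x => _) = fun=> 1); [exact: bmf_cst|apply/funext => x; rewrite expr0].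
by rewrite (_ : (fun x => _) = fun x => w x * w x ^+ k); [exact: bmfM|apply/funext => x; rewrite exprS].
Qed.

Lemma bmf_indic (S : set 'rV[R]_N) : measurable (S : set (borel_rV R N)) -> bmf (\1_S : 'rV[R]_N -> R).
Proof.
move=> mS; split; first exact: measurable_indic.
by exists 1 => x; rewrite indicE; case: (_ \in _); rewrite ?normr1// normr0.
Qed.

Lemma Rintegral_indic_cubeP (S : set 'rV[R]_N) : measurable (S : set (borel_rV R N)) ->
  \int[P]_x (\1_S x : R) = fine (P S).
Proof. by move=> mS; rewrite /Rintegral integral_indic// setIT. Qed.

(** Integrate Young's inequality for [w x / a] over [S], then choose the best [a], namely [K] over
    the [N]-th root of the measure of [S]. *)
Lemma hoelder_set (w : 'rV[R]_N -> R) (S : set 'rV[R]_N) (K : R) : 0 < K -> bmf w -> (forall x, 0 <= w x) ->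
  measurable (S : set (borel_rV R N)) -> \int[P]_x (w x ^+ N) <= K ^+ N ->
  \int[P]_x (\1_S x * w x) <= K * fine (P S) `^ (1 - N%:R^-1).
Proof.
move=> K0 hw w0 mS hK; set s := fine (P S).
have s0 : 0 <= s by exact: fine_ge0.
have bS := bmf_indic mS.
have bSw : bmf (fun x => \1_S x * w x) by exact: bmfM.
have N1 : N%:R != 0 :> R by [].
have cancel (y c : R) : c != 0 -> y = c / N%:R * (N%:R * (y / c)).
  by move: N1; move: (N%:R : R) => N' *; field; apply/andP.
have key (a : R) : 0 < a -> \int[P]_x (\1_S x * w x) <= a / N%:R * (K ^+ N / a ^+ N + n%:R * s).
  move=> a0.
  pose v x := a / N%:R * (a ^- N * w x ^+ N + n%:R * \1_S x).
  have b1 : bmf (fun x => a ^- N * w x ^+ N) by apply: bmfM; [exact: bmf_cst|exact: bmfX].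
  have b2 : bmf (fun x => n%:R * (\1_S x : R)) by apply: bmfM; [exact: bmf_cst|].
  apply: (@le_trans _ _ (\int[P]_x v x)).
    apply: Rintegral_le => //.
    - by apply: bmfM; [exact: bmf_cst|exact: bmfD].
    - move=> x; rewrite /v indicE; have wN : 0 <= a ^- N * w x ^+ N by rewrite mulr_ge0 ?invr_ge0 ?exprn_ge0// ltW.
      have aN : 0 <= a / N%:R by rewrite divr_ge0// ltW.
      case: (_ \in _); last by rewrite mul0r mulr0 addr0 mulr_ge0.
      have := @bernoulli_power (w x / a) (divr_ge0 (w0 x) (ltW a0)).
      rewrite mul1r mulr1 expr_div_n [w x ^+ N / _]mulrC => h.
      have := ler_wpM2l aN h; apply: le_trans.
      by rewrite le_eqVlt; apply/orP; left; apply/eqP; apply: cancel; rewrite gt_eqF.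
  rewrite /v RintegralZl//=; last by apply: (bmf_integrable (bmfD b1 b2)).
  rewrite RintegralD//=; [|exact: (bmf_integrable b1)|exact: (bmf_integrable b2)].
  rewrite !RintegralZl//=; [|exact: (bmf_integrable bS)|exact: (bmf_integrable (bmfX _ hw))].
  rewrite Rintegral_indic_cubeP//.
  apply: ler_wpM2l; first by rewrite divr_ge0// ltW.
  by rewrite lerD2r mulrC ler_wpM2r// invr_ge0 exprn_ge0// ltW.
(* On a null set the optimal [a] would divide by zero; boundedness of [w] gives the claim
   directly. *)
have [s00|sn0] := eqVneq s 0.
  apply: (@le_trans _ _ 0); last by rewrite mulr_ge0 ?powR_ge0// ltW.
  have [_ [M hM]] := hw.
  apply: (@le_trans _ _ (\int[P]_x (M * \1_S x))).
    apply: Rintegral_le => //; first by apply: bmfM => //; exact: bmf_cst.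
    move=> x; rewrite mulrC ler_wpM2r ?indicE//.
    by apply: le_trans (hM x); exact: ler_norm.
  by rewrite RintegralZl//=; [rewrite Rintegral_indic_cubeP// -/s s00 mulr0|exact: (bmf_integrable bS)].
have sp : 0 < s by rewrite lt_neqAle eq_sym sn0.
pose b := s `^ N%:R^-1.
have b0 : 0 < b by rewrite powR_gt0.
have bN : b ^+ N = s by rewrite -powR_mulrn ?powR_ge0// /b -powRrM mulVf// powRr1// ltW.
have -> : s `^ (1 - N%:R^-1) = s / b.
  by rewrite powRD ?(gt_eqF sp) ?implybT// powRr1// powRN.
apply: le_trans (key (K / b) (divr_gt0 K0 b0)) _.
rewrite expr_div_n bN le_eqVlt; apply/orP; left; apply/eqP.
have KN : K ^+ N != 0 by rewrite expf_neq0// gt_eqF.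
have nN : N%:R = n%:R + 1 :> R by rewrite natr1.
have N0 : N%:R != 0 :> R by [].
rewrite nN in N0 *; move: (K ^+ N) (n%:R : R) KN N0 => KN a KN0 N0.
by field; rewrite N0 KN0 !gt_eqF.
Qed.

End HoelderPower.

(** * Strictness of the bound on the divergence *)

Section StrictNorm.
Variables (R : realType) (n : nat).
Local Notation N := n.+1.
Local Notation P := (cubeP R N).

(* If one of two functions of equal mean carried the whole $L^N$ mass, the other would vanish, hence so would its mean. *)
Lemma equal_mean_strict (w1 w2 : 'rV[R]_N -> R) (K : R) : 0 < K -> bmf w1 -> bmf w2 ->
  (forall x, 0 <= w1 x) -> (forall x, 0 <= w2 x) ->
  \int[P]_x w1 x = \int[P]_x w2 x ->
  \int[P]_x (w1 x ^+ N) + \int[P]_x (w2 x ^+ N) <= K ^+ N -> \int[P]_x (w1 x ^+ N) < K ^+ N.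
Proof.
move=> K0 h1 h2 w10 w20 e hK; rewrite ltNge; apply/negP => h.
have A2 : \int[P]_x (w2 x ^+ N) <= 0 by lra.
have I2 : \int[P]_x w2 x <= 0.
  (* Hoelder's inequality on the whole torus with an arbitrarily small constant [a]. *)
  apply/ler_addgt0Pl => a a0; rewrite addr0.
  have := @hoelder_set R n w2 setT a a0 h2 w20 measurableT (le_trans A2 (exprn_ge0 _ (ltW a0))).
  rewrite (@probability_setT _ _ _ P) powR1 mulr1; apply: le_trans.
  by rewrite le_eqVlt; apply/orP; left; apply/eqP; apply: eq_Rintegral => x _; rewrite indicT mul1r.
have [_ [M hM]] := h1.
have : \int[P]_x (w1 x ^+ N) <= M ^+ n * \int[P]_x w1 x.
  have hc := @bmf_cst R N (M ^+ n).
  rewrite -RintegralZl//; last exact: bmf_integrable h1.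
  apply: Rintegral_le; [exact: bmfX|exact: (bmfM hc h1)|move=> x].
  rewrite exprSr ler_wpM2r// lerXn2r ?nnegrE//.
    by apply: le_trans (hM x); exact: normr_ge0.
  by apply: le_trans (hM x); exact: ler_norm.
move=> h3; have : 0 < K ^+ N by rewrite exprn_gt0.
apply/negP; rewrite -leNgt (le_trans h)// (le_trans h3)// e mulr_ge0_le0// exprn_ge0//.
by apply: le_trans (hM 0); exact: normr_ge0.
Qed.

Lemma powRV_exprn (a : R) : 0 <= a -> (a `^ N%:R^-1) ^+ N = a.
Proof. by move=> a0; rewrite -powR_mulrn ?powR_ge0// -powRrM mulVf// powRr1. Qed.

Variables (V : 'rV[R]_N -> 'rV[R]_N) (L : R).
Hypothesis VP : periodic_fun V.
Hypothesis VL : forall x y, enorm (V x - V y) <= L * enorm (x - y).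

Lemma Rintegral_divergence : \int[P]_x divergence V x = 0.
Proof.
have := @integration_by_parts_div R n V L VP VL (fun=> 1) (fun=> 0) 0 (lexx _) (bmf_cst N 1) _ _ _.
rewrite (_ : \int[P]_x edot 0 (V x) = 0); last first.
  rewrite (_ : (fun x => _) = fun=> 0); first exact: Rintegral_cubeP_cst.
  by apply/funext => x; rewrite edot0l.
rewrite (_ : \int[P]_x (1 * divergence V x) = \int[P]_x divergence V x); last first.
  by apply: eq_Rintegral => x _; rewrite mul1r.
move=> h; apply/eqP; rewrite -oppr_eq0; apply/eqP; rewrite -h//.
- move=> i; rewrite (_ : (fun x => _) = fun=> 0); first exact: bmf_cst.
  by apply/funext => x; rewrite mxE.
- by move=> x y; rewrite edot0l subrr subr0 normr0 mul0r.
Qed.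

(** The positive and negative parts of the divergence share the mass [chi^-1 ^+ N] and have equal
    means, so [equal_mean_strict] applies to both. *)
Lemma divergence_strict (chi : R) : 0 < chi -> (LN_norm_div V <= (chi^-1)%:E)%E ->
  exists q : R, [/\ 0 < q, q < 1,
    \int[P]_x ((Num.max (divergence V x) 0) ^+ N) <= (q / chi) ^+ N &
    \int[P]_x ((Num.max (- divergence V x) 0) ^+ N) <= (q / chi) ^+ N].
Proof.
move=> c0; set D := divergence V => hLN.
have bD : bmf D by exact: bmf_divergence VL.
have b0 := @bmf_cst R N 0.
pose wp x := Num.max (D x) 0; pose wm x := Num.max (- D x) 0.
have bp : bmf wp by exact: bmf_max.
have bm : bmf wm by apply: bmf_max => //; exact: bmfN.
have wp0 x : 0 <= wp x by rewrite le_max lexx orbT.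
have wm0 x : 0 <= wm x by rewrite le_max lexx orbT.
set A := \int[P]_x (wp x ^+ N); set B := \int[P]_x (wm x ^+ N).
have A0 : 0 <= A by apply: Rintegral_ge0 => x; exact: exprn_ge0.
have B0 : 0 <= B by apply: Rintegral_ge0 => x; exact: exprn_ge0.
have K0 : 0 < chi^-1 by rewrite invr_gt0.
have dE x : `|D x| ^+ N = wp x ^+ N + 1 * wm x ^+ N.
  rewrite /wp /wm mul1r; case/orP: (le_total 0 (D x)) => h.
    by rewrite ger0_norm// (max_l h) (max_r (y := 0)) ?oppr_le0// [0 ^+ _]expr0n addr0.
  by rewrite ler0_norm// (max_r h) (max_l (y := 0)) ?oppr_ge0// [0 ^+ _]expr0n add0r.
have bX := bmfX N (bmf_norm bD).
have sAB : A + B <= chi^-1 ^+ N.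
  have eI : \int[P]_x (`|D x| ^+ N) = A + B.
    have hl : \int[P]_x (wp x ^+ N + 1 * wm x ^+ N) = A + 1 * B by exact: (Rintegral_lin 1 (bmfX N bp) (bmfX N bm)).
    rewrite mul1r in hl; rewrite -hl.
    by apply: eq_Rintegral => x _; rewrite dE.
  move: hLN; rewrite /LN_norm_div (@cube_intE R N (fun x => (`|D x| ^+ N)%:E)); first last.
  - by move=> x; rewrite lee_fin exprn_ge0.
  - by apply/measurable_EFinP; case: bX.
  rewrite (bmf_EFin bX) eI poweR_EFin lee_fin => h.
  by rewrite -(powRV_exprn (addr_ge0 A0 B0)) lerXn2r ?nnegrE ?powR_ge0// ltW.
have eAB : \int[P]_x wp x = \int[P]_x wm x.
  have hl := Rintegral_lin (-1) bp bm.
  apply/eqP; rewrite -subr_eq0 -mulN1r -hl -[X in _ == X]Rintegral_divergence.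
  apply/eqP; apply: eq_Rintegral => x _; rewrite /wp /wm mulN1r -/D.
  case/orP: (le_total 0 (D x)) => h; first by rewrite (max_l h) (max_r (y := 0)) ?oppr_le0// subr0.
  by rewrite (max_r h) (max_l (y := 0)) ?oppr_ge0// sub0r opprK.
have hA : A < chi^-1 ^+ N by exact: (equal_mean_strict K0 bp bm).
have hB : B < chi^-1 ^+ N by apply: (equal_mean_strict K0 bm bp) => //; rewrite addrC.
set K := chi^-1 in K0 hA hB sAB *.
pose M := Num.max A B.
have M0 : 0 <= M by rewrite le_max A0.
have MK : M < K ^+ N by rewrite gt_max hA hB.
(* The second argument of the maximum keeps [q] positive when the divergence vanishes. *)
pose q := Num.max (M `^ N%:R^-1 / K) 2^-1.
have hM : M `^ N%:R^-1 <= q * K by rewrite -ler_pdivrMr// le_max lexx.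
have q0 : 0 < q by rewrite lt_max invr_gt0 ltr0n orbT.
have hq : M <= (q * K) ^+ N.
  by rewrite -{1}(powRV_exprn M0) lerXn2r ?nnegrE ?powR_ge0// mulr_ge0// ltW.
exists q; split => //.
- rewrite gt_max; apply/andP; split; last by rewrite invf_lt1 ?ltr1n.
  rewrite ltr_pdivrMr// mul1r -(ltr_pXn2r (ltn0Sn n)) ?nnegrE ?powR_ge0// ?(ltW K0)//.
  by rewrite powRV_exprn.
- by apply: le_trans hq; rewrite /M le_max lexx.
- by apply: le_trans hq; rewrite /M le_max lexx orbT.
Qed.

End StrictNorm.

(** * Mollification *)

Section Trigonometry.
Variable R : realType.

Lemma abs_sin_le (x : R) : `|sin x| <= `|x|.
Proof.
wlog x0 : x / 0 <= x => [H|].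
  case/orP: (le_total 0 x) => h; first exact: H.
  by have := H (- x); rewrite oppr_ge0 sinN !normrN; apply.
have [c _] : exists2 c : R, c \in `[0, x] & sin x - sin 0 = cos c * (x - 0).
  by apply: MVT_segment => //; apply: continuous_subspaceT => z; exact: continuous_sin.
rewrite sin0 !subr0 => ->; rewrite normrM -[leRHS]mul1r ler_wpM2r//.
exact: cos_max.
Qed.

Lemma cos_expand (x : R) : 1 - cos x <= x ^+ 2 / 2.
Proof.
have -> : cos x = 1 - 2 * sin (x / 2) ^+ 2.
  have -> : cos x = cos ((x / 2) *+ 2) by congr cos; rewrite mulr2n; field.
  by rewrite cos_mulr2n cos2sin2 mulr2n; ring.
have : sin (x / 2) ^+ 2 <= (x / 2) ^+ 2 by rewrite -real_normK ?num_real// -[leRHS]real_normK ?num_real// lerXn2r ?nnegrE ?abs_sin_le.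
by move: (sin _) => s; rewrite !expr2; lra.
Qed.

Lemma abs_sin_sub_le (h : R) : `|sin h - h| <= h ^+ 2.
Proof.
wlog h0 : h / 0 <= h => [H|].
  case/orP: (le_total 0 h) => k; first exact: H.
  by have := H (- h); rewrite oppr_ge0 sinN -opprD normrN sqrrN; apply.
have [c /andP[c0 ch]] : exists2 c : R, c \in `[0, h] & sin h - sin 0 = cos c * (h - 0).
  by apply: MVT_segment => //; apply: continuous_subspaceT => z; exact: continuous_sin.
rewrite sin0 !subr0 => ->; rewrite -[X in _ - X]mul1r -mulrBl normrM (ger0_norm h0).
rewrite !bnd_simp in c0 ch.
rewrite distrC ger0_norm ?subr_ge0 ?cos_le1//.
have [h1|h1] := lerP h 2; last first.
  by have := cos_geN1 c; rewrite expr2; nra.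
have := cos_expand c; rewrite !expr2; nra.
Qed.

Lemma cos_taylor (x h : R) : `|cos (x + h) - cos x + sin x * h| <= 2 * h ^+ 2.
Proof.
rewrite cosD (_ : _ - _ + _ = cos x * (cos h - 1) - sin x * (sin h - h)); last by ring.
apply: (le_trans (ler_normB _ _)); rewrite !normrM (_ : 2 * h ^+ 2 = 1 * h ^+ 2 + 1 * h ^+ 2); last by ring.
apply: lerD; apply: ler_pM => //; [exact: cos_max| |exact: sin_max|exact: abs_sin_sub_le].
rewrite distrC ger0_norm ?subr_ge0 ?cos_le1//; apply: le_trans (cos_expand h) _.
by have := sqr_ge0 h; lra.
Qed.

Lemma cos_int_period (t : R) (z : int) : cos (pi *+ 2 * (t + z%:~R)) = cos (pi *+ 2 * t).
Proof.
have H (k : nat) (y : R) : cos (pi *+ 2 * (y + k%:R)) = cos (pi *+ 2 * y).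
  elim: k => [|k <-]; first by rewrite addr0.
  by rewrite -natr1 addrA mulrDr mulr1 cosD2pi.
case: z => k; first exact: H.
by rewrite NegzE mulrNz -(H k.+1 (t - _)) subrK.
Qed.

Lemma sin_int_period (t : R) (z : int) : sin (pi *+ 2 * (t + z%:~R)) = sin (pi *+ 2 * t).
Proof.
have H (k : nat) (y : R) : sin (pi *+ 2 * (y + k%:R)) = sin (pi *+ 2 * y).
  elim: k => [|k <-]; first by rewrite addr0.
  by rewrite -natr1 addrA mulrDr mulr1 sinD2pi.
case: z => k; first exact: H.
by rewrite NegzE mulrNz -(H k.+1 (t - _)) subrK.
Qed.

(** After reduction to the interval of length one around zero, the cosine depends on the absolute
    value alone and decreases in it. *)
Lemma cos_near_int (t e : R) : 0 < e -> e <= 2^-1 -> cos (pi *+ 2 * e) < cos (pi *+ 2 * t) ->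
  exists z : int, `|t + z%:~R| < e.
Proof.
move=> e0 e1 h; pose z := - Num.floor (t + 2^-1); exists z.
set r := t + z%:~R; have hr : `|r| <= 2^-1.
  have := floor_itv (t + 2^-1); rewrite intrD => /andP[h1 h2].
  rewrite /r /z mulrNz; move: h1 h2; set F := _%:~R => h1 h2.
  by rewrite ler_norml; apply/andP; split; lra.
have p0 := pi_gt0 R.
have e2 : cos (pi *+ 2 * t) = cos (pi *+ 2 * `|r|).
  rewrite -(cos_int_period t z) -/r -(cos_norm (_ * r)) normrM (ger0_norm (mulrn_wge0 2 (ltW p0)))//.
have a0 := normr_ge0 r.
have p20 : 0 < pi *+ 2 :> R by rewrite mulrn_wgt0.
have bnd (c : R) : 0 <= c -> c <= 2^-1 -> pi *+ 2 * c \in `[0, pi].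
  move=> c0 c1; rewrite in_itv; change (is_true (0 <= pi *+ 2 * c <= pi)); apply/andP; split; first by rewrite mulr_ge0// ltW.
  by have h1 := ler_wpM2l (ltW p0) c1; rewrite mulr2n mulrDl [leRHS]splitr lerD.
rewrite e2 ltr_cos ?bnd// in h; last exact: ltW.
by rewrite ltr_pM2l in h.
Qed.

End Trigonometry.

(** The squared positive part has a Lipschitz derivative, which is all the smoothness asked of the
    mollifier. *)
Lemma pos_sqr_taylor (R : realType) (s s' : R) :
  `|Num.max s' 0 ^+ 2 - Num.max s 0 ^+ 2 - 2 * Num.max s 0 * (s' - s)| <= (s' - s) ^+ 2.
Proof.
rewrite ler_norml; case/orP: (le_total 0 s) => a; case/orP: (le_total 0 s') => b;
  rewrite ?(max_l a) ?(max_r a) ?(max_l b) ?(max_r b).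
- by apply/andP; split; have := sqr_ge0 (s' - s); rewrite !expr2; nra.
- have h : s * s' <= 0 by rewrite mulr_ge0_le0.
  have := sqr_ge0 s; have := sqr_ge0 s'; have := sqr_ge0 (s' - s); rewrite !expr2 => *; apply/andP; split; nra.
- have h : s * s' <= 0 by rewrite mulr_le0_ge0.
  have := sqr_ge0 s; have := sqr_ge0 s'; have := sqr_ge0 (s' - s); rewrite !expr2 => *; apply/andP; split; nra.
- by rewrite mulr0 mul0r expr0n/= !subr0 oppr_le0 sqr_ge0.
Qed.

Section TrigBump.
Variables (R : realType) (n : nat).
Local Notation N := n.+1.
Local Notation P := (cubeP R N).
Local Notation w := ((pi : R) *+ 2).

Lemma w_gt0 : 0 < w. Proof. by rewrite mulrn_wgt0// pi_gt0. Qed.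

Lemma abs_cos_sub_le (x h : R) : `|cos (x + h) - cos x| <= 2 * `|h|.
Proof.
rewrite cosD (_ : _ - _ = - (cos x * (1 - cos h)) - sin x * sin h); last by ring.
apply: (le_trans (ler_normB _ _)); rewrite normrN !normrM (_ : 2 * `|h| = 1 * `|h| + 1 * `|h|); last by ring.
apply: lerD; apply: ler_pM => //; [exact: cos_max| |exact: sin_max|exact: abs_sin_le].
rewrite ger0_norm ?subr_ge0 ?cos_le1//; have h1 := cos_expand h; have h2 := cos_geN1 h.
rewrite -(real_normK (num_real h)) in h1.
by have a0 := normr_ge0 h; move: h1 h2; move: (cos h) `|h| a0 => c a a0 h1 h2; rewrite expr2 in h1; nra.
Qed.

Lemma lipschitz_cos_coord (b : R) (i : 'I_N) (x y : 'rV[R]_N) :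
  `|cos (w * x 0 i + b) - cos (w * y 0 i + b)| <= 2 * w * enorm (x - y).
Proof.
have := abs_cos_sub_le (w * y 0 i + b) (w * (x - y) 0 i).
rewrite (_ : _ + _ + _ = w * x 0 i + b); last by rewrite !mxE; ring.
move=> h; apply: (le_trans h); rewrite normrM (gtr0_norm w_gt0) mulrA ler_wpM2l ?coord_le_enorm//.
by rewrite mulr_ge0// ltW// w_gt0.
Qed.

Lemma bmf_cos_coord (b : R) i : bmf (fun x : 'rV[R]_N => cos (w * x 0 i + b)).
Proof.
apply: (@bmf_continuous _ _ _ 1) => [|x]; last exact: cos_max.
exact: (lipschitz_continuous_rV i (lipschitz_cos_coord b i)).
Qed.

Variable tau : R.
Hypotheses (tau0 : 0 < tau) (tau2 : tau <= 2).

(** For small [tau] this is positive only close to integer points, where every cosine is nearly one;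
    its squared positive part is thus an explicit periodic kernel with small support. *)
Definition trig_sum (y : 'rV[R]_N) := \sum_(i < N) cos (w * y 0 i) - (N%:R - tau).
Definition trig_grad (y : 'rV[R]_N) : 'rV[R]_N := \row_i (- (w * sin (w * y 0 i))).
Definition bump (y : 'rV[R]_N) := (Num.max (trig_sum y) 0) ^+ 2.
Definition bump_grad (y : 'rV[R]_N) := (2 * Num.max (trig_sum y) 0) *: trig_grad y.

Lemma trig_sum_le y : trig_sum y <= tau.
Proof.
have : \sum_(i < N) cos (w * y 0 i) <= \sum_(i < N) (1 : R) by apply: ler_sum => i _; exact: cos_le1.
by rewrite sumr_const card_ord /trig_sum => h; rewrite lerBlDr (le_trans h)// addrCA subrr addr0.
Qed.

Lemma bmf_trig_sum : bmf trig_sum.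
Proof.
apply: (@bmfB R N (fun y => \sum_(i < N) cos (w * y 0 i)) (fun=> N%:R - tau)); last exact: bmf_cst.
apply: (@bmf_sum _ _ 'I_N (index_enum _) (fun i y => cos (w * y 0 i))) => i.
by have := bmf_cos_coord 0 i; under eq_fun do rewrite addr0.
Qed.

Lemma bmf_pos_trig_sum : bmf (fun y => Num.max (trig_sum y) 0).
Proof. by apply: (@bmf_max R N trig_sum (fun=> 0)); [exact: bmf_trig_sum|exact: bmf_cst]. Qed.

Lemma bmf_bump : bmf bump.
Proof. exact: (bmfX 2 bmf_pos_trig_sum). Qed.

Lemma bmf_bump_grad i : bmf (fun y => bump_grad y 0 i).
Proof.
rewrite (_ : (fun y => _) = fun y => 2 * Num.max (trig_sum y) 0 * - (w * cos (w * y 0 i + - (pi / 2)))); last first.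
  by apply/funext => y; rewrite !mxE cosBpihalf.
have h1 := bmfM (@bmf_cst R N 2) bmf_pos_trig_sum.
exact: (bmfM h1 (bmfN (bmfM (@bmf_cst R N w) (bmf_cos_coord (- (pi / 2)) i)))).
Qed.

Lemma bump_ge0 y : 0 <= bump y. Proof. exact: sqr_ge0. Qed.

Lemma trig_sum_lipschitz y h : `|trig_sum (y + h) - trig_sum y| <= 2 * w * N%:R * enorm h.
Proof.
rewrite (_ : _ - _ = \sum_(i < N) (cos (w * (y + h) 0 i) - cos (w * y 0 i))); last first.
  by rewrite sumrB /trig_sum; ring.
apply: le_trans (ler_norm_sum _ _ _) _.
apply: (@le_trans _ _ (\sum_(i < N) (2 * w * enorm h))).
  apply: ler_sum => i _; have := lipschitz_cos_coord 0 i (y + h) y.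
  by rewrite !addr0 [y + h]addrC addrK.
by rewrite sumr_const card_ord -mulr_natr; rewrite le_eqVlt; apply/orP; left; apply/eqP; ring.
Qed.

Lemma trig_sum_taylor y h :
  `|trig_sum (y + h) - trig_sum y - edot (trig_grad y) h| <= 2 * w ^+ 2 * enorm h ^+ 2.
Proof.
rewrite sqr_enorm /edot mulr_sumr.
rewrite (_ : _ - _ - _ = \sum_(i < N) (cos (w * y 0 i + w * h 0 i) - cos (w * y 0 i) + sin (w * y 0 i) * (w * h 0 i))); last first.
  rewrite big_split/= sumrB /trig_sum;
  rewrite (_ : \sum_(i < N) sin _ * _ = - \sum_(i < N) trig_grad y 0 i * h 0 i); last first.
    by rewrite -sumrN; apply: eq_bigr => i _; rewrite !mxE; ring.
  rewrite (_ : \sum_(i < N) cos (w * (y + h) 0 i) = \sum_(i < N) cos (w * y 0 i + w * h 0 i)); first by ring.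
  by apply: eq_bigr => i _; rewrite mxE mulrDr.
apply: le_trans (ler_norm_sum _ _ _) _; apply: ler_sum => i _.
by apply: le_trans (cos_taylor _ _) _; rewrite le_eqVlt; apply/orP; left; apply/eqP; ring.
Qed.

(** First term: the remainder of the squared positive part. Second term: twice the positive part, at
    most 4 since [tau <= 2], times the remainder of [trig_sum]. *)
Definition bump_cst : R := (2 * w * N%:R) ^+ 2 + 8 * w ^+ 2.

Lemma bump_cst_ge0 : 0 <= bump_cst.
Proof. by rewrite addr_ge0 ?sqr_ge0// mulr_ge0// sqr_ge0. Qed.

Lemma bump_taylor y h : `|bump (y + h) - bump y - edot (bump_grad y) h| <= bump_cst * enorm h ^+ 2.
Proof.
have h1 := trig_sum_lipschitz y h; have h2 := trig_sum_taylor y h.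
have h3 := trig_sum_le y; have w0 := w_gt0.
rewrite /bump /bump_grad edotZl /bump_cst.
set s := trig_sum y in h1 h2 h3 *; set s' := trig_sum (y + h) in h1 h2 *; set l := edot _ _ in h2 *.
have hD : (s' - s) ^+ 2 <= (2 * w * N%:R) ^+ 2 * enorm h ^+ 2.
  rewrite -(real_normK (num_real (s' - s))) -exprMn lerXn2r ?nnegrE//.
  by rewrite !mulr_ge0 ?enorm_ge0// ltW.
set p := Num.max s 0; have p0 : 0 <= p by rewrite le_max lexx orbT.
have p2 : p <= 2 by rewrite ge_max (le_trans h3 tau2) ler0n.
set p' := Num.max s' 0.
have key := pos_sqr_taylor s s'; rewrite -/p -/p' in key.
rewrite (_ : _ - _ - _ = (p' ^+ 2 - p ^+ 2 - 2 * p * (s' - s)) + 2 * p * (s' - s - l)); last by ring.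
apply: le_trans (ler_normD _ _) _; rewrite [((2 * w * N%:R) ^+ 2 + _) * _]mulrDl; apply: lerD; first exact: le_trans key hD.
rewrite normrM ger0_norm ?mulr_ge0// (_ : 8 * _ * _ = 4 * (2 * w ^+ 2 * enorm h ^+ 2)); last by ring.
by apply: ler_pM => //; [rewrite mulr_ge0|lra].
Qed.

Lemma trig_sum_periodic (z : 'rV[int]_N) y : trig_sum (y + intvec R z) = trig_sum y.
Proof. by rewrite /trig_sum; congr (_ - _); apply: eq_bigr => i _; rewrite !mxE cos_int_period. Qed.

Lemma bump_periodic : periodic_fun bump.
Proof. by move=> z y; rewrite /bump trig_sum_periodic. Qed.

Lemma bump_grad_periodic : periodic_fun bump_grad.
Proof.
move=> z y; rewrite /bump_grad trig_sum_periodic; congr (_ *: _).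
by apply/rowP => i; rewrite !mxE sin_int_period.
Qed.

Lemma bump0 : 0 < bump 0.
Proof.
rewrite /bump exprn_gt0// lt_max; apply/orP; left; rewrite /trig_sum.
under eq_bigr do rewrite mxE mulr0 cos0.
by rewrite sumr_const card_ord opprB addrCA subrr addr0.
Qed.

(** With this [tau], positivity of the sum forces every cosine above [cos (w * e)], the others being
    at most one. *)
Lemma bump_support (e : R) y : 0 < e -> e <= 2^-1 -> tau = 1 - cos (w * e) -> bump y != 0 ->
  exists z : 'rV[int]_N, enorm (y + intvec R z) <= N%:R * e.
Proof.
move=> e0 e1 te hb.
have hs : 0 < trig_sum y.
  rewrite ltNge; apply/negP => h; move: hb; rewrite /bump max_r// expr0n/= eqxx//.
have hc i : exists z : int, `|y 0 i + z%:~R| < e.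
  apply: cos_near_int => //.
  have : \sum_(j < N | j != i) cos (w * y 0 j) <= \sum_(j < N | j != i) (1 : R) by apply: ler_sum => j _; exact: cos_le1.
  have : \sum_(j < N) (1 : R) = N%:R by rewrite sumr_const card_ord.
  move: hs; rewrite /trig_sum te (bigD1 i)//= (bigD1 i (F := fun=> 1))//=.
  move: (\sum_(j < N | j != i) _) (\sum_(j < N | j != i) _) => A B; lra.
have [z hz] := choice hc; exists (\row_i z i).
by apply: enorm_le_const; [exact: ltW|move=> i; rewrite !mxE ltW].
Qed.

End TrigBump.

Section Taylor2.
Variables (R : realType) (n : nat).
Local Notation N := n.+1.
Local Notation P := (cubeP R N).
Variables (f : 'rV[R]_N -> R) (g : 'rV[R]_N -> 'rV[R]_N) (C : R).
Hypothesis C0 : 0 <= C.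
Hypothesis Tf : forall x h, `|f (x + h) - f x - edot (g x) h| <= C * enorm h ^+ 2.

Lemma taylor_increment x h : `|f (x + h) - f x| <= (enorm (g x) + C * enorm h) * enorm h.
Proof.
have := Tf x h; have := abs_edot_le (g x) h; move=> h1 h2.
rewrite -[f (x + h) - f x](subrK (edot (g x) h)); apply: le_trans (ler_normD _ _) _.
by rewrite mulrDl addrC lerD// -mulrA -expr2.
Qed.

Lemma taylor_continuous : continuous f.
Proof.
apply/continuous_enormP => x e e0.
have A0 : 0 < enorm (g x) + C + 1 by rewrite ltr_wpDl// addr_ge0 ?enorm_ge0.
exists (Num.min 1 (e / (enorm (g x) + C + 1))); first by rewrite lt_min ltr01 divr_gt0.
move=> y; rewrite lt_min => /andP[h1 h2].
have := taylor_increment x (y - x); rewrite [x + _]addrC subrK => h; apply: le_lt_trans h _.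
rewrite ltr_pdivlMr// in h2; apply: le_lt_trans h2; rewrite [leRHS]mulrC; apply: ler_wpM2r; first exact: enorm_ge0.
rewrite -addrA lerD2l; have : C * enorm (y - x) <= C * 1 by rewrite ler_wpM2l// ltW.
by rewrite mulr1; lra.
Qed.

(** Cutting the segment into [j] equal steps leaves a total remainder of order 1/j. *)
Lemma taylor_grad0_cst : (forall x, g x = 0) -> forall x y, f x = f y.
Proof.
move=> g0 x y; apply/eqP; rewrite -subr_eq0 -normr_eq0; apply/negPn/negP => hne.
set D := `|f x - f y| in hne; have D0 : 0 < D by rewrite lt_def hne normr_ge0.
set h := x - y; pose K := C * enorm h ^+ 2.
have step (m : nat) (d : 'rV[R]_N) : `|f (y + m%:R *: d) - f y| <= m%:R * (C * enorm d ^+ 2).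
  elim: m => [|m IH]; first by rewrite mulr0n scale0r addr0 subrr normr0 mul0r.
  rewrite -natr1 scalerDl scale1r addrA.
  rewrite -[_ - f y](subrKA (f (y + m%:R *: d))); apply: le_trans (ler_normD _ _) _.
  rewrite mulrDl mul1r [leRHS]addrC lerD//.
  by have := Tf (y + m%:R *: d) d; rewrite g0 edot0l subr0.
have K0 : 0 <= K by rewrite mulr_ge0// sqr_ge0.
have [j hj] := natSinv_small (divr_gt0 D0 (ltr_wpDl K0 ltr01)).
have j0 : (j.+1%:R : R) != 0 by [].
have := step j.+1 (j.+1%:R^-1 *: h).
rewrite scalerA mulfV// scale1r [y + h]addrC subrK -/D enormZ ger0_norm// exprMn => hs.
have e1 : j.+1%:R * (C * (j.+1%:R^-1 ^+ 2 * enorm h ^+ 2)) = K * j.+1%:R^-1.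
  by rewrite /K; move: (j.+1%:R : R) j0 => a a0; field.
rewrite e1 in hs; move: hj; rewrite ltr_pdivlMr ?ltr_wpDl// => hj.
have : 0 <= j.+1%:R^-1 :> R by rewrite invr_ge0.
by move: hs hj; move: (j.+1%:R^-1) => a; lra.
Qed.

End Taylor2.

Section PositiveIntegral.
Variables (R : realType) (n : nat).
Local Notation N := n.+1.
Local Notation P := (cubeP R N).

Lemma Rintegral_gt0 (h : 'rV[R]_N -> R) x0 : bmf h -> continuous h -> periodic_fun h ->
  (forall x, 0 <= h x) -> 0 < h x0 -> 0 < \int[P]_x h x.
Proof.
move=> bh ch ph h0 hx; pose c := h x0 / 2; have c0 : 0 < c by rewrite divr_gt0.
pose U := [set x | c < h x].
have oU : open U by apply: (open_comp (f := h) (D := [set r | c < r])) => //; exact: open_gt.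
have pU : (0 < P U)%E.
  apply: cubeP_open_gt0 => //; first by exists x0; rewrite /U /= /c; lra.
  by move=> z x; rewrite /U /= ph.
have mU : measurable (U : set (borel_rV R N)) by exact: open_measurable_rV.
have fU : 0 < fine (P U).
  apply: fine_gt0; rewrite pU; apply: le_lt_trans (ltry 1).
  exact: (@probability_le1 _ _ _ P U mU).
apply: (@lt_le_trans _ _ (\int[P]_x (c * (\1_U x : R)))).
  by rewrite RintegralZl//; [rewrite Rintegral_indic_cubeP// mulr_gt0|exact: bmf_integrable (bmf_indic mU)].
apply: Rintegral_le => //; first exact: (bmfM (@bmf_cst R N c) (bmf_indic mU)).
move=> x; rewrite indicE; case: (boolP (x \in U)) => [|_]; last by rewrite mulr0.
by rewrite inE mulr1 => /ltW.
Qed.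

End PositiveIntegral.

(** Only straight segments of constant velocity are tested; their concatenations play the role of
    trajectories. The strict inequality leaves room for perturbations. *)
Definition forward_invariant (R : realType) (m : nat) (V : 'rV[R]_m -> 'rV[R]_m) (E : set 'rV[R]_m) :=
  forall y s v, E y -> 0 <= s -> (forall s', 0 <= s' -> s' <= s -> enorm (v - V (y + s' *: v)) < 1) ->
    E (y + s *: v).

(** * The mollified indicator of an invariant set *)

Section Mollify.
Variables (R : realType) (n : nat) (V : 'rV[R]_n.+1 -> 'rV[R]_n.+1) (L : R).
Local Notation N := n.+1.
Local Notation P := (cubeP R N).
Hypothesis VP : periodic_fun V.
Hypothesis VL : forall x y, enorm (V x - V y) <= L * enorm (x - y).
Variable E : set 'rV[R]_N.
Hypotheses (oE : open E) (pE : periodic_set E) (fE : forward_invariant V E).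
Variable e : R.
Hypotheses (e0 : 0 < e) (e1 : e <= 2^-1).

Let tau : R := 1 - cos ((pi : R) *+ 2 * e).

Let tau0 : 0 < tau.
Proof.
have p0 := pi_gt0 R; rewrite /tau subr_gt0 -[X in _ < X](cos0 R).
have p20 : 0 < pi *+ 2 :> R by rewrite mulrn_wgt0.
have h1 := ler_wpM2l (ltW p0) e1.
rewrite ltr_cos ?mulr_gt0//; rewrite in_itv.
  by change (is_true (0 <= (0 : R) <= pi)); rewrite lexx ltW.
change (is_true (0 <= pi *+ 2 * e <= pi)); apply/andP; split; first by rewrite mulr_ge0// ltW.
by rewrite mulr2n mulrDl [leRHS]splitr lerD.
Qed.

Let tau2 : tau <= 2.
Proof. by have := cos_geN1 ((pi : R) *+ 2 * e); rewrite /tau; lra. Qed.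

Let rho := @bump R n tau.
Let drho := @bump_grad R n tau.
Let Cr := @bump_cst R n.

Let bE : bmf (\1_E : 'rV[R]_N -> R).
Proof. by apply: bmf_indic; exact: open_measurable_rV. Qed.

(** Left unnormalized: the argument uses only smoothness, monotonicity along trajectories and the
    contrast between zero and positive values. *)
Definition mollification (x : 'rV[R]_N) : R := \int[P]_y (\1_E y * rho (y - x)).
Definition mollification_grad (x : 'rV[R]_N) : 'rV[R]_N :=
  \row_i (- \int[P]_y (\1_E y * drho (y - x) 0 i)).

Let shift_per (T : Type) (h : 'rV[R]_N -> T) : periodic_fun h ->
  forall z x y, h (y - (x + intvec R z)) = h (y - x).
Proof. by move=> ph z x y; rewrite -(ph z (y - _)) opprD addrA subrK. Qed.

Lemma mollification_periodic : periodic_fun mollification.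
Proof.
move=> z x; apply: eq_Rintegral => y _; by rewrite /rho (shift_per (@bump_periodic R n tau)).
Qed.

Lemma mollification_grad_periodic : periodic_fun mollification_grad.
Proof.
move=> z x; apply/rowP => i; rewrite !mxE; congr (- _).
by apply: eq_Rintegral => y _; rewrite /drho (shift_per (@bump_grad_periodic R n tau)).
Qed.

Let b1 x : bmf (fun y => \1_E y * rho (y - x)).
Proof. exact: (bmfM bE (bmf_shift (- x) (bmf_bump n tau))). Qed.

Let b2 x i : bmf (fun y => \1_E y * drho (y - x) 0 i).
Proof. exact: (bmfM bE (bmf_shift (- x) (bmf_bump_grad tau i))). Qed.

(** The bound for the kernel integrates with the same constant, the torus having measure one and the
    indicator being at most one. *)
Lemma mollification_taylor x h :
  `|mollification (x + h) - mollification x - edot (mollification_grad x) h| <= Cr * enorm h ^+ 2.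
Proof.
pose F y i := \1_E y * drho (y - x) 0 i * h 0 i.
have bF i : bmf (F^~ i) by exact: (bmfM (b2 x i) (@bmf_cst R N (h 0 i))).
have bS : bmf (fun y => \sum_(i < N) F y i) by exact: (bmf_sum (index_enum 'I_N) bF).
have eg : edot (mollification_grad x) h = - \int[P]_y (\sum_(i < N) F y i).
  rewrite (Rintegral_bmf_sum (index_enum 'I_N) bF) -sumrN; apply: eq_bigr => i _.
  by rewrite !mxE mulNr /F RintegralZr//; exact: bmf_integrable (b2 x i).
pose G y := \1_E y * rho (y - (x + h)) + (-1) * (\1_E y * rho (y - x)).
have bG : bmf G by exact: (bmfD (b1 (x + h)) (bmfM (@bmf_cst R N (-1)) (b1 x))).
pose H y := G y + 1 * \sum_(i < N) F y i.
have bH : bmf H by exact: (bmfD bG (bmfM (@bmf_cst R N 1) bS)).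
have eH : mollification (x + h) - mollification x - edot (mollification_grad x) h = \int[P]_y H y.
  have := Rintegral_lin 1 bG bS; rewrite -/H => ->.
  have := Rintegral_lin (-1) (b1 (x + h)) (b1 x); rewrite -/G => ->.
  by rewrite eg opprK mulN1r mul1r.
have hH y : `|H y| <= Cr * enorm h ^+ 2.
  have Eq : H y = \1_E y * (rho ((y - x) + - h) - rho (y - x) - edot (drho (y - x)) (- h)).
    rewrite /H /G edotNr opprK mul1r mulN1r opprD addrA mulrDr mulrBr; congr (_ + _).
    by rewrite /edot mulr_sumr; apply: eq_bigr => i _; rewrite /F mulrA.
  rewrite Eq normrM -[leRHS]mul1r ler_pM//.
    by rewrite indicE; case: (_ \in _); rewrite ?normr1 ?normr0.
  by have := bump_taylor tau2 (y - x) (- h); rewrite enormN.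
rewrite eH ler_norml; apply/andP; split.
  rewrite -[leLHS](@Rintegral_cubeP_cst R N); apply: Rintegral_le => //; first exact: bmf_cst.
  by move=> y; have := hH y; rewrite ler_norml => /andP[].
rewrite -[leRHS](@Rintegral_cubeP_cst R N); apply: Rintegral_le => //; first exact: bmf_cst.
by move=> y; have := hH y; rewrite ler_norml => /andP[].
Qed.

Lemma mollificationE x : mollification x = \int[P]_y (\1_E (y + x) * rho y).
Proof.
rewrite /mollification -(Rintegral_periodic x (b1 x)).
  by apply: eq_Rintegral => y _; rewrite addrK.
move=> z y; rewrite addrAC /rho (@bump_periodic R n tau); congr (_ * _).
by rewrite !indicE; congr (_%:R); congr nat_of_bool; apply/idP/idP; rewrite !inE => /pE.
Qed.

Let b3 x : bmf (fun y => \1_E (y + x) * rho y).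
Proof. exact: (bmfM (bmf_shift x bE) (bmf_bump n tau)). Qed.

(** Up to an integer vector, the kernel only sees points within [N%:R * e] of [x]. There [V] changes
    by at most [delta], so invariance carries the points of [E] among them along the same
    segment. *)
Lemma mollification_mono x s v delta : L * (N%:R * e) <= delta -> 0 <= L -> 0 <= s ->
  (forall s', 0 <= s' -> s' <= s -> enorm (v - V (x + s' *: v)) + delta < 1) ->
  mollification x <= mollification (x + s *: v).
Proof.
move=> hd L0 s0 hs; rewrite !mollificationE; apply: Rintegral_le => // y.
have [->|hy] := eqVneq (rho y) 0; first by rewrite !mulr0.
have [z hz] := bump_support e0 e1 (erefl tau) hy.
rewrite ler_wpM2r ?bump_ge0// !indicE; case: (boolP (y + x \in E)) => // /set_mem hE.
rewrite (_ : _ \in _ = true)//; apply/mem_set; rewrite addrA.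
apply/(pE z (y + x + s *: v)); rewrite [y + x + _ + _]addrAC; apply: (fE (y := y + x + intvec R z)) => //; first by apply/pE.
move=> s' s'0 s's; apply: le_lt_trans (hs s' s'0 s's).
apply: le_trans (enorm_triangle (V (x + s' *: v)) _ _) _; rewrite lerD2l.
apply: le_trans (VL _ _) _; apply: le_trans hd; rewrite ler_wpM2l//.
rewrite enormB (_ : _ - _ = y + intvec R z)//.
by apply/rowP => i; rewrite !mxE; ring.
Qed.

Lemma mollification_out x r : N%:R * e < r -> (forall y, enorm (y - x) < r -> ~ E y) -> mollification x = 0.
Proof.
move=> hr h; rewrite mollificationE -[RHS](@Rintegral_cubeP_cst R N 0).
apply: eq_Rintegral => y _; have [->|hy] := eqVneq (rho y) 0; first by rewrite mulr0.
have [z hz] := bump_support e0 e1 (erefl tau) hy.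
rewrite indicE memNset ?mul0r// => /(pE z); rewrite addrAC; apply: h.
by rewrite addrK; exact: le_lt_trans hz hr.
Qed.

Lemma mollification_in x r : N%:R * e < r -> (forall y, enorm (y - x) < r -> E y) -> 0 < mollification x.
Proof.
move=> hr h; rewrite mollificationE.
rewrite (_ : \int[P]_y _ = \int[P]_y rho y).
  apply: (@Rintegral_gt0 R n rho 0).
  - exact: bmf_bump.
  - by apply: (taylor_continuous (@bump_cst_ge0 R n) (g := drho)) => y k; exact: bump_taylor.
  - exact: bump_periodic.
  - by move=> y; exact: bump_ge0.
  - exact: bump0.
apply: eq_Rintegral => y _; have [->|hy] := eqVneq (rho y) 0; first by rewrite mulr0.
have [z hz] := bump_support e0 e1 (erefl tau) hy.
rewrite indicE mem_set ?mul1r//; apply/(pE z (y + x)); rewrite addrAC; apply: h.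
by rewrite addrK; exact: le_lt_trans hz hr.
Qed.

End Mollify.

(** * Isoperimetry *)

Section Householder.
Variables (R : realType) (n : nat).
Local Notation N := n.+1.

(* The reflection exchanging the first basis vector and [- e]. *)
Lemma orthogonal_first_column (e : 'rV[R]_N) : enorm e = 1 ->
  exists Q : 'M[R]_N, orthogonal_mx Q /\ forall i, Q i ord0 = - e 0 i.
Proof.
move=> e1; pose d : 'rV[R]_N := ecoord R ord0; pose u := - e - d.
have dd : edot d d = 1 by rewrite -sqr_enorm enorm_ecoord expr1n.
have ee : edot e e = 1 by rewrite -sqr_enorm e1 expr1n.
have de (x : 'rV[R]_N) : edot x d = x 0 ord0.
  rewrite /edot (bigD1 ord0)//= big1 => [|j j0]; first by rewrite !mxE !eqxx mulr1 addr0.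
  by rewrite !mxE (negbTE j0) andbF mulr0.
have uu : edot u u = 2 + 2 * e 0 ord0.
  rewrite /u edotBl !edotBr !edotNl !edotNr ee dd (edotC d) !de; ring.
have [u0|u0] := eqVneq (edot u u) 0.
  have ud : u = 0 by apply: enorm_eq0; rewrite /enorm u0 sqrtr0.
  have ed : - e = d by apply/eqP; rewrite -subr_eq0 -/u ud.
  exists 1%:M; split; first by rewrite /orthogonal_mx trmx1 mulmx1.
  by move=> i; have := congr1 (fun m : 'rV[R]_N => m 0 i) ed; rewrite !mxE => ->; rewrite eqxx/= eq_sym.
pose c := 2 / edot u u; pose Q : 'M[R]_N := 1%:M - c *: (u^T *m u).
have hu i : u 0 i = - e 0 i - (i == ord0)%:R by rewrite !mxE eqxx.
have uTu : u *m u^T = (edot u u)%:M.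
  apply/matrixP => i j; rewrite !ord1 !mxE eqxx mulr1n.
  by apply: eq_bigr => k _; rewrite [u^T _ _]mxE.
have QT : Q^T = Q by rewrite /Q linearB/= linearZ/= trmx1 trmx_mul trmxK.
exists Q; split.
  pose U := u^T *m u.
  have UU : U *m U = edot u u *: U.
    by rewrite /U mulmxA -(mulmxA u^T u) uTu mul_mx_scalar -scalemxAl.
  rewrite /orthogonal_mx QT /Q -/U mulmxBl mul1mx mulmxBr mulmx1 -scalemxAl -scalemxAr UU.
  apply/matrixP => i j; rewrite /c; move: (edot u u) u0 U {UU} => a a0 U; rewrite !mxE.
  by field.
move=> i; rewrite /Q; have -> : (1%:M - c *: (u^T *m u)) i ord0 = (i == ord0)%:R - c * (u 0 i * u 0 ord0).
  rewrite mxE [in LHS]mxE; congr (_ + _); rewrite mxE [in LHS]mxE mxE; congr (- (_ * _)).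
  by rewrite (bigD1 ord0)//= big1 => [|j]; [rewrite [u^T _ _]mxE addr0|rewrite ord1].
rewrite !hu eqxx /c uu.
have h : 2 + 2 * e 0 ord0 != 0 by rewrite -uu.
have [->|i0] := eqVneq i ord0; rewrite ?eqxx/= ?(negbTE i0) /=.
  by move: (e 0 ord0) h => a h; rewrite !mulr1n; field.
by move: (e 0 ord0) (e 0 i) h => a b h; rewrite !mulr0n; field.
Qed.

End Householder.

(** * Lipschitz graphs from a cone condition *)

Section ConeBoundary.
Variables (R : realType) (n : nat).
Local Notation N := n.+1.
Variables (A : set 'rV[R]_N) (x0 W : 'rV[R]_N) (r0 : R).
Hypotheses (oA : open A) (r00 : 0 < r0) (bx : topo_boundary A x0).
Hypothesis hA : forall x s v, A x -> 0 <= s -> enorm (x - x0) < r0 -> enorm (x + s *: v - x0) < r0 ->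
  enorm (v - W) <= 4^-1 -> A (x + s *: v).

Let near_pt : exists a, A a /\ enorm (a - x0) < r0.
Proof.
have [cA _] := bx; have [|a [Aa ha]] := cA [set y | enorm (y - x0) < r0]; last by exists a.
by apply/nbhs_enormP; exists r0.
Qed.

(** If [W] were shorter, all slow velocities would be allowed, and a whole ball around [x0] could be
    reached from one point of [A], making [x0] interior. *)
Let W_big : 8^-1 <= enorm W.
Proof.
rewrite leNgt; apply/negP => hW; have [_] := bx; apply.
have [a [Aa ha]] := near_pt; apply/nbhs_enormP; exists r0 => // y hy.
(* The duration [16 * r0] turns any displacement inside the ball, at most [2 * r0], into a velocity
   of length at most 1/8. *)
have s0 : 0 < 16 * r0 by rewrite mulr_gt0.
have -> : y = a + (16 * r0) *: ((16 * r0)^-1 *: (y - a)).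
  by rewrite scalerA mulfV ?gt_eqF// scale1r addrC subrK.
apply: hA => //; first exact: ltW.
  by rewrite scalerA mulfV ?gt_eqF// scale1r [a + _]addrC subrK.
apply: le_trans (enormD _ _) _; rewrite enormN enormZ ger0_norm ?invr_ge0 ?(ltW s0)//.
have h1 : enorm (y - a) <= 2 * r0.
  apply: le_trans (enorm_triangle x0 _ _) _; rewrite [enorm (x0 - a)]enormB; lra.
have : (16 * r0)^-1 * enorm (y - a) <= 8^-1.
  rewrite mulrC ler_pdivrMr//; apply: le_trans h1 _; lra.
lra.
Qed.

Let m := enorm W.
Let m0 : 0 < m. Proof. by apply: lt_le_trans W_big; rewrite invr_gt0. Qed.
Let e := m^-1 *: W.
Let e1 : enorm e = 1.
Proof. by rewrite /e enormZ ger0_norm ?invr_ge0 ?ltW// mulVf// gt_eqF. Qed.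
(** The aperture: a cone vector rescaled to the speed [m] differs from [W] by at most [m * k], which
    is below 1/4. *)
Let k := (4 * m + 2)^-1.
Let k0 : 0 < k. Proof. by rewrite invr_gt0 addr_gt0// mulr_gt0. Qed.
Let k1 : k <= 2^-1.
Proof. by rewrite /k lef_pV2 ?posrE ?addr_gt0 ?mulr_gt0// lerDr mulr_ge0// ltW. Qed.

(** The convex cone of axis [e] and aperture [k], written so that stability under sums is the
    triangle inequality. *)
Let K (w : 'rV[R]_N) := exists t, 0 <= t /\ enorm (w - t *: e) <= k * t.

Let K_add w w' : K w -> K w' -> K (w + w').
Proof.
move=> [t [t0 h]] [t' [t'0 h']]; exists (t + t'); split; first exact: addr_ge0.
rewrite scalerDl opprD addrACA mulrDr; apply: le_trans (enormD _ _) _; exact: lerD.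
Qed.

Let K_e t : 0 <= t -> K (t *: e).
Proof. by move=> t0; exists t; split => //; rewrite subrr enorm0 mulr_ge0// ltW. Qed.

Let K_A a w : A a -> enorm (a - x0) < r0 -> enorm (a + w - x0) < r0 -> K w -> A (a + w).
Proof.
move=> Aa h1 h2 [t [t0 ht]].
have [tz|tn] := eqVneq t 0.
  move: ht; rewrite tz scale0r subr0 mulr0 => h.
  have -> : w = 0 by apply: enorm_eq0; apply/eqP; rewrite eq_le h enorm_ge0.
  by rewrite addr0.
have tp : 0 < t by rewrite lt_neqAle eq_sym tn.
have ew : w = (t / m) *: ((m / t) *: w).
  by rewrite scalerA (_ : _ / _ * _ = 1) ?scale1r//; field; rewrite tn gt_eqF.
rewrite ew; apply: hA => //; [by rewrite divr_ge0// ltW|by rewrite -ew|].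
have -> : (m / t) *: w - W = (m / t) *: (w - t *: e).
  rewrite scalerBr scalerA /e scalerA (_ : m / t * t / m = 1) ?scale1r//.
  by field; rewrite tn gt_eqF.
rewrite enormZ ger0_norm ?divr_ge0 ?(ltW m0) ?(ltW tp)//.
apply: (@le_trans _ _ (m / t * (k * t))); first by rewrite ler_wpM2l// divr_ge0 ?(ltW m0) ?(ltW tp).
rewrite (_ : _ * _ = m * k); last by move: k; rewrite -/m => k'; field.
rewrite /k ler_pdivrMr ?addr_gt0 ?mulr_gt0//; lra.
Qed.

(** Inside the ball [A] is a union of truncated cones, hence lies on one side of a Lipschitz graph
    over the hyperplane orthogonal to [e]. *)
Lemma cone_boundary : exists r : R, exists Q : 'M[R]_N, exists g : 'rV[R]_n -> R,
  [/\ 0 < r, orthogonal_mx Q, lipschitz_real g &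
    forall y, enorm (y - x0) < r -> (A y <-> (y *m Q) 0 ord0 < g (@rsubmx R 1 1 n (y *m Q)))].
Proof.
(* The first column of [Q] is [- e]: the first coordinate decreases along the cone, which puts [A]
   below the graph, as [lipschitz_boundary] demands. *)
have [Q [oQ hQ]] := orthogonal_first_column e1.
have oQ' : Q^T *m Q = 1%:M by exact: mulmx1C.
pose T (h : 'rV[R]_n) : 'rV[R]_N := (row_mx (0 : 'rV[R]_1) h : 'rV[R]_N) *m Q^T.
have Z0 h : (row_mx (0 : 'rV[R]_1) h : 'rV[R]_N) 0 ord0 = 0.
  by rewrite mxE; case: split_ordP => j; [rewrite mxE|move/(congr1 val)].
have ZS h i : (row_mx (0 : 'rV[R]_1) h : 'rV[R]_N) 0 (lift ord0 i) = h 0 i.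
  rewrite mxE; case: split_ordP => j /(congr1 val) /=; first by rewrite ord1.
  by move=> [/val_inj->].
have TB h h' : T h - T h' = T (h - h').
  by rewrite /T -mulmxBl; congr (_ *m _); apply/rowP => i; rewrite !mxE; case: (fintype.split _) => j; rewrite !mxE ?subrr.
have Tn h : enorm (T h) = enorm h.
  have edotE (q : nat) (x y : 'rV[R]_q) : edot x y = (x *m y^T) 0 0.
    by rewrite mxE; apply: eq_bigr => i _; rewrite mxE.
  rewrite /enorm; congr Num.sqrt; rewrite !edotE /T trmx_mul trmxK -mulmxA (mulmxA Q^T) oQ' mul1mx.
  by rewrite -!edotE /edot big_ord_recl Z0 mul0r add0r; apply: eq_bigr => i _; rewrite ZS.
have dec y : y = - ((y *m Q) 0 ord0) *: e + T (@rsubmx R 1 1 n (y *m Q)).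
  rewrite -{1}[y]mulmx1 -oQ mulmxA; move: (y *m Q) => z.
  have E : z = (z 0 ord0) *: ecoord R ord0 + (row_mx (0 : 'rV[R]_1) (@rsubmx R 1 1 n z) : 'rV[R]_N).
    apply/rowP => i; rewrite mxE [(_ *: _ : 'rV[R]_N) _ _]mxE [ecoord _ _ _ _]mxE eqxx.
    case: (unliftP ord0 i) => [j|] ->; last by rewrite Z0 eqxx mulr1 addr0.
    rewrite ZS mulr0 add0r mxE; congr (_ _ _); exact: val_inj.
  rewrite {1}E mulmxDl; congr (_ + _).
  rewrite -scalemxAl scaleNr -scalerN; congr (_ *: _); apply/rowP => i.
  rewrite mxE (bigD1 ord0)//= big1 => [|j j0]; last by rewrite !mxE (negbTE j0) andbF mul0r.
  by rewrite [ecoord _ _ _ _]mxE !eqxx mul1r addr0 [Q^T _ _]mxE hQ [(- e) _ _]mxE.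
(* Whole cones are attached to the points of [A] near [x0], so [G] is finite and Lipschitz on the
   entire hyperplane although [A] is controlled only in the ball. *)
pose A' y := exists a, [/\ A a, enorm (a - x0) < r0 & K (y - a)].
pose S h : set R := [set s | A' (- s *: e + T h)].
pose G h := sup (S h).
have [a0 [Aa0 ha0]] := near_pt.
have S_ub h : ubound (S h) (enorm h + enorm x0 + r0).
  move=> s [a [Aa ha [t [t0 ht]]]].
  have E : (- s - t) *: e = (- s *: e + T h - a - t *: e) - (T h - a).
    by apply/rowP => i; rewrite !mxE; ring.
  have h1 := enormB (- s *: e + T h - a) (t *: e).
  have : enorm ((- s - t) *: e) <= k * t + (enorm h + (enorm x0 + r0)).
    rewrite E; apply: le_trans (enormD _ _) _; rewrite enormN; apply: lerD => //.
    apply: le_trans (enormD _ _) _; rewrite enormN Tn lerD2l.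
    rewrite -[a](subrK x0); apply: le_trans (enormD _ _) _; rewrite addrC lerD2l; exact: ltW.
  rewrite enormZ e1 mulr1 => h2; have h3 := ler_norm (- (- s - t)); rewrite normrN in h3.
  have h4 : k * t <= t by rewrite ler_piMl//; have := k1; lra.
  lra.
have S_ne h : S h !=set0.
  exists (- (enorm (T h - a0) / k)); exists a0; split=> //.
  have p0 : 0 <= enorm (T h - a0) / k by rewrite divr_ge0 ?enorm_ge0// ltW.
  exists (enorm (T h - a0) / k); split => //; rewrite opprK.
  rewrite (_ : _ - _ - _ = T h - a0); last by apply/rowP => i; rewrite !mxE; ring.
  by rewrite mulrC divfK// gt_eqF.
have S_sup h : has_sup (S h) by split; [exact: S_ne|exists (enorm h + enorm x0 + r0); exact: S_ub].
(* Moving sideways by [d] is compensated by moving [d / k] along the axis, whence the Lipschitz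
   constant. *)
have S_shift h h' s : S h s -> S h' (s - k^-1 * enorm (h - h')).
  move=> [a [Aa ha hK]]; exists a; split => //.
  set d := enorm (h - h'); have d0 : 0 <= k^-1 * d by rewrite mulr_ge0 ?enorm_ge0// invr_ge0 ltW.
  rewrite (_ : _ - a = (- s *: e + T h - a) + ((k^-1 * d) *: e + (T h' - T h))); last first.
    by apply/rowP => i; rewrite !mxE; ring.
  apply: K_add => //; exists (k^-1 * d); split => //.
  by rewrite [_ + (T h' - T h)]addrC addrK TB Tn enormB mulrA mulfV ?gt_eqF// mul1r.
have S_down h s s' : S h s -> s' <= s -> S h s'.
  move=> [a [Aa ha hK]] ss; exists a; split => //.
  rewrite (_ : _ - a = (- s *: e + T h - a) + (s - s') *: e); last by apply/rowP => i; rewrite !mxE; ring.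
  by apply: K_add => //; apply: K_e; rewrite subr_ge0.
have G_le h h' : G h <= G h' + k^-1 * enorm (h - h').
  apply: ge_sup; first exact: S_ne.
  move=> s hs; rewrite -lerBlDr; apply: ub_le_sup; first exact: (S_sup h').2.
  exact: S_shift.
exists r0, Q, G; split => //.
  exists k^-1 => h h'; rewrite ler_norml; apply/andP; split; last by rewrite lerBlDl; exact: G_le.
  by rewrite lerNl opprB lerBlDl enormB; exact: G_le.
move=> y hy; have ey := dec y; set s := (y *m Q) 0 ord0 in ey *; set h := rsubmx _ in ey *.
split=> [Ay|].
  have /open_enormP oA' := oA; have [d d0 hd] := oA' _ Ay.
  (* Stepping back by [t] along the axis stays in the open set [A] and pushes the supremum strictly
     above [s]. *)
  pose t := Num.min d (r0 - enorm (y - x0)) / 2.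
  have t0 : 0 < t by rewrite divr_gt0// lt_min d0 subr_gt0.
  have td : t < d /\ t < r0 - enorm (y - x0).
    have h1 : Num.min d (r0 - enorm (y - x0)) <= d by rewrite ge_min lexx.
    have h2 : Num.min d (r0 - enorm (y - x0)) <= r0 - enorm (y - x0) by rewrite ge_min lexx orbT.
    by move: t0; rewrite /t => ?; split; lra.
  have nt : enorm (- t *: e) = t by rewrite enormZ normrN e1 mulr1 gtr0_norm.
  apply: (@lt_le_trans _ _ (s + t)); first by rewrite ltrDl.
  apply: ub_le_sup; first exact: (S_sup h).2.
  exists (y - t *: e); split.
  - by apply: hd; rewrite addrC addKr -scaleNr nt; case: td.
  - rewrite addrAC -scaleNr; apply: le_lt_trans (enormD _ _) _; rewrite nt.
    by case: td => _; lra.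
  - rewrite (_ : _ - (y - _) = (- s *: e + T h) - y); last by apply/rowP => i; rewrite !mxE; ring.
    by rewrite -ey subrr -(scale0r e); exact: K_e.
move=> hs; have [|s' hs' ss'] := @sup_gt _ (S h) s (S_ne h); first exact: hs.
have [a [Aa ha hK]] := S_down _ _ _ hs' (ltW ss').
rewrite -ey in hK; rewrite -[y](subrK a) addrC; apply: K_A => //.
by rewrite [a + _]addrC subrK.
Qed.

End ConeBoundary.

Section LimnEinf.
Variable R : realType.
Implicit Type u : (\bar R)^nat.

Lemma limn_einf_sup u : limn_einf u = ereal_sup (range (einfs u)).
Proof.
rewrite limn_einf_lim; apply/cvg_lim => //.
exact: (ereal_nondecreasing_cvgn (nondecreasing_einfs u)).
Qed.

Lemma einfs_le_limn_einf u k : (einfs u k <= limn_einf u)%E.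
Proof. by rewrite limn_einf_sup; apply: ereal_sup_ubound; exists k. Qed.

Lemma limn_einf_ge u k (a : \bar R) : (forall j, (k <= j)%N -> (a <= u j)%E) -> (a <= limn_einf u)%E.
Proof.
move=> h; apply: le_trans (einfs_le_limn_einf u k).
by apply: le_ereal_inf_tmp => _ [j /= kj <-]; exact: h.
Qed.

Lemma limn_einf_le u (a : R) : (forall j, (u j <= (a + j.+1%:R^-1)%:E)%E) -> (limn_einf u <= a%:E)%E.
Proof.
move=> h; rewrite limn_einf_sup; apply: ge_ereal_sup => _ [k _ <-].
apply/lee_addgt0Pr => e e0; have [j hj] := natSinv_small e0.
apply: (@le_trans _ _ (u (maxn j k))).
  by apply: ereal_inf_lbound; exists (maxn j k) => //=; exact: leq_maxr.
apply: le_trans (h _) _; rewrite -EFinD lee_fin lerD2l; apply: le_trans (ltW hj).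
by rewrite lef_pV2 ?posrE ?ltr0n// ler_nat ltnS leq_maxl.
Qed.

Lemma measurable_limn_einf d (T : measurableType d) (h : nat -> T -> \bar R) :
  (forall j, measurable_fun setT (h j)) -> measurable_fun setT (fun x => limn_einf (h ^~ x)).
Proof.
move=> mh; apply: measurableT_comp => //; apply: measurable_fun_limn_esup => j.
by apply: measurableT_comp => //; exact: mh.
Qed.

End LimnEinf.

(** * The isoperimetric inequality on level sets *)

Section Isoperimetry.
Variables (R : realType) (n : nat).
Local Notation N := n.+1.
Local Notation P := (cubeP R N).

(** Each scale [d] eventually exceeds 1/(j + 1), after which the covers compete in [haus_delta]. *)
Lemma hausdorff_le_limn_einf (A B : set 'rV[R]_N) (b : (\bar R)^nat) : A `<=` B ->
  (forall j, fin_cover n j.+1%:R^-1 B (b j)) -> (hausdorff n A <= limn_einf b)%E.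
Proof.
move=> AB hb; apply: ge_ereal_sup => _ [d /= d0 <-].
have [k hk] := natSinv_small d0; apply: (@limn_einf_ge _ _ k) => j kj.
apply: fin_cover_haus => //; apply: fin_cover_sub AB _; have [l [h1 h2 h3]] := hb j; exists l; split => // i.
apply: le_trans (h2 i) _; rewrite lee_fin; apply: le_trans (ltW hk).
by rewrite lef_pV2 ?posrE ?ltr0n// ler_nat ltnS.
Qed.

Lemma hausdorff_ge0 (A : set 'rV[R]_N) : (0 <= hausdorff n A)%E.
Proof.
apply: (@le_trans _ _ (haus_delta n 1 A)); last by apply: ereal_sup_ubound; exists 1 => //=.
by apply: le_ereal_inf_tmp => _ [C _ <-]; apply: nneseries_ge0 => j _ _; exact: haus_term_ge0.
Qed.

(** With [chi <= 0] the inequality fails for every admissible set, so none exists; every constant is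
    then valid, and [chi - 1] contradicts minimality. *)
Lemma isoperimetric_constant_gt0 (chi : R) : isoperimetric_constant n chi -> 0 < chi.
Proof.
move=> [h1 h2]; rewrite ltNge; apply/negP => chi0.
suff : chi <= chi - 1 by lra.
apply: h2 => Th hTh; have := h1 _ hTh; rewrite /iso_ineq.
have [_ _ [t0 t1]] := hTh.
have : 0 < fine (tmeas Th).
  by apply: fine_gt0; rewrite t0 (le_lt_trans t1)// ltry.
move=> /(powR_gt0 (1 - n.+1%:R^-1)); rewrite -lte_fin => h h3.
have := lt_le_trans h h3; rewrite ltNge; case/negP.
by apply: mule_le0_ge0; [rewrite lee_fin|exact: hausdorff_ge0].
Qed.

Variables (V : 'rV[R]_N -> 'rV[R]_N) (L : R).
Hypothesis VP : periodic_fun V.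
Hypothesis VL : forall x y, enorm (V x - V y) <= L * enorm (x - y).
Variables (f : 'rV[R]_N -> R) (g : 'rV[R]_N -> 'rV[R]_N) (C theta : R).
Hypothesis C0 : 0 <= C.
Hypothesis Tf : forall x h, `|f (x + h) - f x - edot (g x) h| <= C * enorm h ^+ 2.
Hypothesis fP : periodic_fun f.
Hypothesis gP : periodic_fun g.
Hypothesis fg : forall x, theta * enorm (g x) <= edot (g x) (V x).
Hypothesis fmono : forall x s v, 0 <= s ->
  (forall s', 0 <= s' -> s' <= s -> enorm (v - V (x + s' *: v)) <= 2^-1) -> f x <= f (x + s *: v).

(** Over a ball of radius [r0] the field varies by at most 1/4, which turns the condition along the
    segment into one on [V x0] alone. *)
Lemma local_monotone : exists r0, 0 < r0 /\ forall x0 x s v, 0 <= s -> enorm (x - x0) < r0 ->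
  enorm (x + s *: v - x0) < r0 -> enorm (v - V x0) <= 4^-1 -> f x <= f (x + s *: v).
Proof.
have A0 : 0 < 4 * (`|L| + 1) by rewrite mulr_gt0// ltr_wpDl.
exists ((4 * (`|L| + 1))^-1); split; first by rewrite invr_gt0.
move=> x0 x s v s0 h1 h2 hv; apply: fmono => // s' s'0 s's.
apply: le_trans (enorm_triangle (V x0) _ _) _; rewrite (_ : 2^-1 = 4^-1 + 4^-1 :> R); last by field.
apply: lerD => //; apply: le_trans (VL _ _) _.
set r0 := _^-1 in h1 h2.
have hr : enorm (x + s' *: v - x0) <= r0.
  have [s00|sn0] := eqVneq s 0.
    have -> : s' = 0 by apply/eqP; rewrite eq_le s'0 andbT (le_trans s's)// s00.
    by rewrite scale0r addr0; exact: ltW.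
  have sp : 0 < s by rewrite lt_neqAle eq_sym sn0.
  pose t := s' / s; have t0 : 0 <= t by rewrite divr_ge0.
  have t1 : t <= 1 by rewrite ler_pdivrMr// mul1r.
  have -> : x + s' *: v - x0 = (1 - t) *: (x - x0) + t *: (x + s *: v - x0).
    have -> : s' = t * s by rewrite /t divfK.
    by apply/rowP => i; rewrite !mxE; ring.
  apply: le_trans (enormD _ _) _; rewrite !enormZ !ger0_norm ?subr_ge0//.
  have := ltW h1; have := ltW h2; move: (enorm _) (enorm _) => a b; nra.
rewrite enormB; apply: le_trans (ler_wpM2r (enorm_ge0 _) (ler_norm L)) _.
apply: le_trans (ler_wpM2l (normr_ge0 L) hr) _.
by rewrite /r0 ler_pdivrMr//; lra.
Qed.

Let cf : continuous f. Proof. exact: taylor_continuous C0 Tf. Qed.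

Let oS (l : R) : open [set x | l < f x].
Proof. by apply: (open_comp (f := f) (D := [set r | l < r])) => //; exact: open_gt. Qed.

Let oI (l : R) : open [set x | f x < l].
Proof. by apply: (open_comp (f := f) (D := [set r | r < l])) => //; exact: open_lt. Qed.

Definition superlevel (l : R) : set 'rV[R]_N := [set x | l < f x].
Definition sublevel (l : R) : set 'rV[R]_N := [set x | f x < l].

(** Monotonicity along a cone around [V x0] is a cone condition at every level, critical values of
    [f] included. *)
Lemma superlevel_boundary l : lipschitz_boundary [set x | l < f x].
Proof.
move=> x0 bx; have [r0 [r00 hr]] := local_monotone.
apply: (@cone_boundary R n _ x0 (V x0) r0) => // x s v lx s0 h1 h2 hv.
by apply: lt_le_trans lx _; apply: hr hv.
Qed.

Lemma sublevel_boundary l : lipschitz_boundary [set x | f x < l].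
Proof.
move=> x0 bx; have [r0 [r00 hr]] := local_monotone.
apply: (@cone_boundary R n _ x0 (- V x0) r0) => // x s v lx s0 h1 h2 hv.
apply: le_lt_trans lx.
have := hr x0 (x + s *: v) s (- v) s0 h2.
rewrite scalerN addrK; apply => //.
by move: hv; rewrite opprK -opprD enormN.
Qed.

Lemma boundary_superlevel l : topo_boundary [set x | l < f x] `<=` [set x | f x = l].
Proof.
move=> x [cx nx] /=; apply/eqP; rewrite eq_le; apply/andP; split; rewrite leNgt; apply/negP => h.
  by apply: nx; apply: open_nbhs_nbhs; split; [exact: oS|].
have hn : nbhs x [set y | f y < l] by apply: open_nbhs_nbhs; split; [exact: oI|].
have [y [/= h1 h2]] := cx _ hn.
by have := lt_trans h1 h2; rewrite ltxx.
Qed.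

Lemma boundary_sublevel l : topo_boundary [set x | f x < l] `<=` [set x | f x = l].
Proof.
move=> x [cx nx] /=; apply/eqP; rewrite eq_le; apply/andP; split; rewrite leNgt; apply/negP => h; last first.
  by apply: nx; apply: open_nbhs_nbhs; split; [exact: oI|].
have hn : nbhs x [set y | l < f y] by apply: open_nbhs_nbhs; split; [exact: oS|].
have [y [/= h1 h2]] := cx _ hn.
by have := lt_trans h1 h2; rewrite ltxx.
Qed.

Let gL := taylor_grad_lipschitz C0 Tf.

Let gB : exists B, forall x, enorm (g x) <= B.
Proof. exact: periodic_lipschitz_bounded gP gL. Qed.

Let bf : bmf f.
Proof.
have [B hB] := gB; have B0 : 0 <= B := le_trans (enorm_ge0 _) (hB 0).
apply: (@bmf_continuous _ _ _ (`|f 0| + (B + C * N%:R) * N%:R)) => // x.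
have [z hz] := unit_cube_shift x; rewrite -(fP z x) -[f _](subrK (f 0)) addrC.
apply: le_trans (ler_normD _ _) _; rewrite lerD2l; set y := x + _.
have hy : enorm y <= N%:R.
  rewrite -[N%:R]mulr1 enorm_le_const// => i.
  by have [h1 h2] := hz i; rewrite ger0_norm// ltW.
have := taylor_increment Tf 0 y; rewrite add0r => h; apply: le_trans h _.
apply: ler_pM; rewrite ?enorm_ge0 ?addr_ge0 ?mulr_ge0 ?enorm_ge0//.
by apply: lerD => //; apply: ler_wpM2l.
Qed.

Let bgc i : bmf (fun x => g x 0 i). Proof. exact: bmf_coord gP gL i. Qed.

Let bg : bmf (fun x => enorm (g x)).
Proof.
have [B hB] := gB; apply: (@bmf_continuous _ _ _ B).
  apply: (@lipschitz_continuous_rV R N _ (6 * C) ord0) => x y.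
  by apply: le_trans (gL x y); exact: abs_enormB.
by move=> x; rewrite ger0_norm ?enorm_ge0.
Qed.

Variables (chi q : R).
Hypothesis hchi : isoperimetric_constant n chi.
Hypotheses (q0 : 0 < q) (qtheta : q < theta).
Let wp x := Num.max (divergence V x) 0.
Let wm x := Num.max (- divergence V x) 0.
Hypothesis Ap : \int[P]_x (wp x ^+ N) <= (q / chi) ^+ N.
Hypothesis Am : \int[P]_x (wm x ^+ N) <= (q / chi) ^+ N.

Let wp0 x : 0 <= wp x. Proof. by rewrite le_max lexx orbT. Qed.
Let wm0 x : 0 <= wm x. Proof. by rewrite le_max lexx orbT. Qed.
Let bD : bmf (divergence V). Proof. exact: bmf_divergence VL. Qed.
Let bwp : bmf wp. Proof. by apply: (@bmf_max R N (divergence V) (fun=> 0)) => //; exact: bmf_cst. Qed.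
Let bwm : bmf wm.
Proof. by apply: (@bmf_max R N (fun x => - divergence V x) (fun=> 0)) => //; [exact: bmfN|exact: bmf_cst]. Qed.

(** Hoelder's inequality produces the very power of the measure that the isoperimetric inequality
    bounds, and [chi] cancels. *)
Lemma admissible_integral_le (S : set 'rV[R]_N) (w : 'rV[R]_N -> R) (l : R) (b : (\bar R)^nat) :
  open S -> periodic_set S -> lipschitz_boundary S -> topo_boundary S `<=` [set x | f x = l] ->
  (P S <= (2^-1)%:E)%E -> bmf w -> (forall x, 0 <= w x) -> \int[P]_x (w x ^+ N) <= (q / chi) ^+ N ->
  (forall j, fin_cover n j.+1%:R^-1 ([set x | f x = l] `&` @unit_cube R N) (b j)) -> (forall j, 0 <= b j)%E ->
  ((\int[P]_x (\1_S x * w x))%:E <= q%:E * limn_einf b)%E.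
Proof.
move=> oSS pS lS bS hS bw w0 hw hb b0; have c0 := isoperimetric_constant_gt0 hchi.
have mS : measurable (S : set (borel_rV R N)) by exact: open_measurable_rV.
have bb0 : (0 <= limn_einf b)%E by apply: (@limn_einf_ge _ _ 0) => j _.
have [S0|Sne] := pselect (S !=set0); last first.
  rewrite (_ : \int[P]_x _ = 0) ?mule_ge0 ?lee_fin ?(ltW q0)//.
  rewrite -[RHS](@Rintegral_cubeP_cst R N); apply: eq_Rintegral => x _.
  by rewrite indicE memNset ?mul0r// => Sx; apply: Sne; exists x.
have adm : iso_admissible S by split => //; rewrite tmeasE//; split => //; exact: cubeP_open_gt0.
have := hchi.1 _ adm; rewrite /iso_ineq tmeasE// => hiso.
have hH : (hausdorff n (topo_boundary S `&` @unit_cube R N) <= limn_einf b)%E.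
  by apply: hausdorff_le_limn_einf hb; exact: setSI.
apply: (@le_trans _ _ (q / chi * fine (P S) `^ (1 - N%:R^-1))%:E).
  by rewrite lee_fin; apply: hoelder_set => //; exact: divr_gt0.
rewrite EFinM; apply: (@le_trans _ _ ((q / chi)%:E * (chi%:E * limn_einf b))%E).
  rewrite lee_wpmul2l ?lee_fin ?divr_ge0 ?(ltW q0) ?(ltW c0)//.
  by apply: le_trans hiso _; rewrite lee_wpmul2l// lee_fin ltW.
by rewrite muleA -EFinM divfK// gt_eqF.
Qed.

(** Admissible sets fill at most half of the torus: superlevels are usable above the median and
    sublevels below it. *)
Lemma median_exists : exists l0 : R, (forall l, l0 < l -> (P (superlevel l) <= (2^-1)%:E)%E) /\
  (forall l, l < l0 -> (P (sublevel l) <= (2^-1)%:E)%E).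
Proof.
have [_ [M hM]] := bf.
pose S := [set l | (P (superlevel l) <= (2^-1)%:E)%E].
have SM : S M.
  rewrite /S /= (_ : superlevel M = set0) ?measure0 ?lee_fin//.
  by rewrite -subset0 => x; rewrite /superlevel/= ltNge (le_trans (ler_norm _) (hM x)).
have hS : has_inf S.
  split; first by exists M.
  exists (- M - 1) => l; change (is_true (P (superlevel l) <= (2^-1)%:E)%E -> is_true (- M - 1 <= l)); rewrite leNgt => h; rewrite leNgt; apply/negP => lM; move: h.
  rewrite (_ : superlevel l = setT).
    by rewrite (@probability_setT _ _ _ P) lte_fin invf_lt1// ltr1n.
  apply/seteqP; split => // x _; apply: lt_trans lM _.
  by have := hM x; rewrite ler_norml => /andP[]; lra.
have mS l : measurable ((superlevel l) : set (borel_rV R N)) by apply: open_measurable_rV; exact: oS.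
have mI l : measurable ((sublevel l) : set (borel_rV R N)) by apply: open_measurable_rV; exact: oI.
exists (inf S); split => l hl.
  have [l' Sl' ll'] := inf_lt hS.1 hl.
  have Sl2 : (P (superlevel l') <= (2^-1)%:E)%E := Sl'.
  apply: le_trans Sl2; apply: (@le_measure _ _ _ P); [apply/mem_set; exact: mS|apply/mem_set; exact: mS|].
  by move=> x; exact: lt_trans ll'.
have nS : ~ S l by move=> /(ge_inf hS.2); rewrite leNgt hl.
have {}nS : ((2^-1)%:E < P (superlevel l))%E by rewrite ltNge; apply/negP.
have : (P (sublevel l) + P (superlevel l) <= 1)%E.
  rewrite -measureU//.
  - exact: (@probability_le1 _ _ _ P _ (measurableU _ _ (mI l) (mS l))).
  - by rewrite -subset0 => x [h1 h2]; have := lt_trans h1 h2; rewrite ltxx.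
have := fin_num_measure P _ (mI l); have := fin_num_measure P _ (mS l); move: nS.
move=> h h1 h2; have h' : 2^-1 < fine (P (superlevel l)) by rewrite -lte_fin fineK.
rewrite -(fineK h1) -(fineK h2) -EFinD !lee_fin; move: h'.
by move: (fine (P (superlevel l))) (fine (P (sublevel l))) => a b; lra.
Qed.

Lemma integral_itv_indic (a b w : R) : 0 <= w ->
  (\int[@lebesgue_measure R]_l (\1_(`]a, b[%classic : set (measurableTypeR R)) l * w)%:E = (Num.max (b - a) 0 * w)%:E)%E.
Proof.
move=> w0'; under eq_integral do rewrite EFinM muleC.
rewrite ge0_integralZl//; last by apply/measurable_EFinP; exact: measurable_indic.
have -> : (\int[@lebesgue_measure R]_l (\1_(`]a, b[%classic : set (measurableTypeR R)) l)%:E = @lebesgue_measure R `]a, b[%classic)%E.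
  by rewrite integral_indic ?setIT//; exact: measurable_itv.
rewrite lebesgue_measure_itv/= lte_fin; case: ltP => h.
  by rewrite -EFinB -EFinM mulrC max_l// subr_ge0 ltW.
by rewrite mule0 max_r ?mul0r// subr_le0.
Qed.

(* Layer-cake: [f - l0] is integrated over its levels, which are bounded by the isoperimetric inequality. *)
Lemma divergence_flux_le : \int[P]_x edot (g x) (V x) <= q * \int[P]_x enorm (g x).
Proof.
have [l0 [hl1 hl2]] := median_exists.
have [B hB] := gB.
have j0 (j : nat) : 0 < (j.+1%:R^-1 : R) by rewrite invr_gt0.
have /choice[h hh] : forall j : nat, exists hj : measurableTypeR R -> \bar R,
  [/\ measurable_fun setT hj, forall t, (0 <= hj t)%E,
     forall t, fin_cover n j.+1%:R^-1 ([set x | f x = t] `&` @unit_cube R N) (hj t) &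
     (\int[@lebesgue_measure R]_t hj t <= (fine (\int[P]_x (enorm (g x))%:E)%E + j.+1%:R^-1)%:E)%E].
  by move=> j; exact: (eilenberg_bound C0 Tf (j0 j) (j0 j) hB).
pose G := \int[P]_x enorm (g x).
pose mu := @lebesgue_measure R.
pose A1 : set (borel_rV R N * measurableTypeR R) := [set z | l0 < z.2 /\ z.2 < f z.1].
pose A2 : set (borel_rV R N * measurableTypeR R) := [set z | f z.1 < z.2 /\ z.2 < l0].
have mf : measurable_fun setT ((fun z => f z.1) : borel_rV R N * measurableTypeR R -> R).
  exact: (measurableT_comp bf.1 measurable_fst).
have ms : measurable_fun setT ((fun z => z.2) : borel_rV R N * measurableTypeR R -> R) by exact: measurable_snd.
have mlt (u v : borel_rV R N * measurableTypeR R -> R) : measurable_fun setT u -> measurable_fun setT v ->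
    measurable [set z | u z < v z].
  move=> mu_ mv; rewrite (_ : [set _ | _] = setT `&` (fun z => v z - u z) @^-1` `]0, +oo[%classic).
    by apply: (measurable_funB mv mu_) => //; exact: measurable_itv.
  by rewrite setTI; apply/seteqP; split => z /=; rewrite in_itv/= andbT subr_gt0.
have mA1 : measurable A1 by apply: measurableI; [exact: (mlt (fun=> l0))|exact: mlt].
have mA2 : measurable A2 by apply: measurableI; [exact: mlt|exact: (mlt _ (fun=> l0))].
(* For an upper bound of -(f - l0) div V, only the negative part of the divergence above [l0] and
   its positive part below [l0] have to be kept. *)
pose F (z : borel_rV R N * measurableTypeR R) : \bar R := (\1_A1 z * wm z.1 + \1_A2 z * wp z.1)%:E.
have mF : measurable_fun setT F.
  apply/measurable_EFinP; apply: measurable_funD; apply: measurable_funM; try exact: measurable_indic.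
    exact: (measurableT_comp bwm.1 measurable_fst).
  exact: (measurableT_comp bwp.1 measurable_fst).
have F0 z : (0 <= F z)%E by rewrite lee_fin addr_ge0// mulr_ge0// indicE.
have fub := @fubini_tonelli _ _ (borel_rV R N) (measurableTypeR R) R P mu F mF F0.
pose Fx x := Num.max (f x - l0) 0 * wm x + Num.max (l0 - f x) 0 * wp x.
have bFx : bmf Fx.
  have b1 := @bmf_max R N (fun x => f x - l0) (fun=> 0) (bmfB bf (@bmf_cst R N l0)) (@bmf_cst R N 0).
  have b2 := @bmf_max R N (fun x => l0 - f x) (fun=> 0) (bmfB (@bmf_cst R N l0) bf) (@bmf_cst R N 0).
  exact: (bmfD (bmfM b1 bwm) (bmfM b2 bwp)).
have inner x : (\int[mu]_l F (x, l) = (Fx x)%:E)%E.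
  rewrite /Fx EFinD -!integral_itv_indic//.
  rewrite -ge0_integralD//=.
  - apply: eq_integral => l _; rewrite /F EFinD !indicE /A1 /A2; congr ((_%:R * _)%:E + (_%:R * _)%:E)%E;
    congr nat_of_bool; apply/idP/idP; rewrite !inE/= in_itv/=.
    + by move=> [-> ->].
    + by move=> /andP[].
    + by move=> [-> ->].
    + by move=> /andP[].
  - by move=> l _; rewrite lee_fin mulr_ge0// indicE.
  - by apply/measurable_EFinP; apply: measurable_funM => //; exact: measurable_indic.
  - by move=> l _; rewrite lee_fin mulr_ge0// indicE.
  - by apply/measurable_EFinP; apply: measurable_funM => //; exact: measurable_indic.
(* The covers depend on the scale; their lower limit bounds the Hausdorff measure level by level,
   and Fatou's lemma bounds its integral. *)
pose H l := limn_einf (h ^~ l).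
have mh j : measurable_fun setT (h j) by have [] := hh j.
have h0 j l : (0 <= h j l)%E by have [_ h1 _ _] := hh j; exact: h1.
have mH : measurable_fun setT (H : measurableTypeR R -> \bar R) by exact: measurable_limn_einf mh.
have H0 l : (0 <= H l)%E by apply: (@limn_einf_ge _ _ 0%N) => j _.
have outer l : (\int[P]_x F (x, l) <= q%:E * H l)%E.
  have hc j : fin_cover n j.+1%:R^-1 ([set x | f x = l] `&` @unit_cube R N) (h j l) by have [_ _ h1 _] := hh j.
  have [ll|ll|ll] := ltgtP l l0.
  - have -> : (\int[P]_x F (x, l) = (\int[P]_x (\1_(sublevel l) x * wp x))%:E)%E.
      rewrite -bmf_EFin; last by apply: bmfM bwp; apply: bmf_indic; apply: open_measurable_rV; exact: oI.
      apply: eq_integral => x _; rewrite /F /= !indicE /A1 /A2; rewrite memNset/=; last by move=> [/(lt_trans ll)]; rewrite ltxx.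
      rewrite mul0r add0r; congr (_%:R * _)%:E; congr nat_of_bool.
      by apply/idP/idP; rewrite !inE/=; [move=> []|].
    apply: admissible_integral_le => //; [exact: oI| |exact: sublevel_boundary|exact: boundary_sublevel|exact: hl2].
    by move=> z x; rewrite /sublevel /superlevel/= fP.
  - have -> : (\int[P]_x F (x, l) = (\int[P]_x (\1_(superlevel l) x * wm x))%:E)%E.
      rewrite -bmf_EFin; last by apply: bmfM bwm; apply: bmf_indic; apply: open_measurable_rV; exact: oS.
      apply: eq_integral => x _; rewrite /F /= !indicE /A1 /A2; rewrite [_ \in [set z | _ /\ z.2 < l0]]memNset/=; last by move=> [_ /(lt_trans ll)]; rewrite ltxx.
      rewrite mul0r addr0; congr (_%:R * _)%:E; congr nat_of_bool.
      by apply/idP/idP; rewrite !inE/=; [move=> []|].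
    apply: admissible_integral_le => //; [exact: oS| |exact: superlevel_boundary|exact: boundary_superlevel|exact: hl1].
    by move=> z x; rewrite /sublevel /superlevel/= fP.
  - rewrite (_ : (\int[P]_x _ = 0)%E) ?mule_ge0 ?lee_fin ?(ltW q0)//.
    apply: integral0_eq => x _; rewrite /F /= !indicE /A1 /A2 ll !memNset/= ?mul0r ?addr0//.
    + by move=> []; rewrite ltxx.
    + by move=> []; rewrite ltxx.
have hFx : \int[P]_x Fx x <= q * G.
  rewrite -lee_fin -(bmf_EFin bFx).
  rewrite (_ : (\int[P]_x (Fx x)%:E = \int[P]_x \int[mu]_l F (x, l))%E); last by apply: eq_integral => x _; rewrite inner.
  rewrite fub; apply: (@le_trans _ _ (\int[mu]_l (q%:E * H l))%E).
    apply: ge0_le_integral => //.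
    - by move=> l _; apply: integral_ge0 => x _; exact: F0.
    - by have := @measurable_fun_fubini_tonelli_G _ _ (borel_rV R N) (measurableTypeR R) R P F mF F0; rewrite /fubini_G.
    - exact: (emeasurable_funM (measurable_cst _) mH).
  rewrite ge0_integralZl//; last by rewrite lee_fin ltW.
  rewrite EFinM lee_wpmul2l ?lee_fin ?(ltW q0)//.
  apply: le_trans (fatou mu measurableT mh (fun j l _ => h0 j l)) _.
  apply: limn_einf_le => j; have [_ _ _ hj] := hh j; apply: le_trans hj _.
  by rewrite lee_fin /G (bmf_EFin bg).
(* Subtracting [l0] changes nothing because the divergence has mean zero. *)
have e1 : \int[P]_x edot (g x) (V x) = \int[P]_x (- (f x * divergence V x + (- l0) * divergence V x)).
  rewrite (integration_by_parts_div VP VL C0 bf fP bgc Tf).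
  have hl := Rintegral_lin (- l0) (bmfM bf bD) bD.
  have b1 : bmf (fun x => f x * divergence V x + - l0 * divergence V x).
    exact: (bmfD (bmfM bf bD) (bmfM (@bmf_cst R N (- l0)) bD)).
  have := Rintegral_lin (-1) (@bmf_cst R N 0) b1; rewrite Rintegral_cubeP_cst add0r mulN1r hl.
  rewrite (Rintegral_divergence VP VL) mulr0 addr0 => <-.
  by apply: eq_Rintegral => x _; rewrite add0r mulN1r.
rewrite e1; apply: le_trans hFx; apply: Rintegral_le => //.
  exact: (bmfN (bmfD (bmfM bf bD) (bmfM (@bmf_cst R N (- l0)) bD))).
move=> x; rewrite /Fx /wm /wp; move: (f x) (divergence V x) => a d.
have pm (t : R) : Num.max t 0 - Num.max (- t) 0 = t.
  case/orP: (le_total 0 t) => h1.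
    by rewrite (max_l h1) [Num.max (- t) 0]max_r ?oppr_le0// subr0.
  by rewrite (max_r h1) [Num.max (- t) 0]max_l ?oppr_ge0// sub0r opprK.
have m0 (t : R) : 0 <= Num.max t 0 by rewrite le_max lexx orbT.
have := pm d; have := pm (a - l0); rewrite opprB; have := m0 d; have := m0 (- d); have := m0 (a - l0); have := m0 (l0 - a).
move: (Num.max d 0) (Num.max (- d) 0) (Num.max (a - l0) 0) (Num.max (l0 - a) 0) => u w p m m1 p1 w1 u1 e1' e2.
rewrite mulNr -mulrBl -e1' -e2; have := mulr_ge0 p1 u1; have := mulr_ge0 m1 w1.
by rewrite mulrBl !mulrBr; lra.
Qed.

(** The lower bound on the flux with [theta] and the upper bound with [q < theta] leave no room for
    a nonzero gradient. *)
Lemma monotone_cst x y : f x = f y.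
Proof.
have hI : \int[P]_x edot (g x) (V x) <= q * \int[P]_x enorm (g x) := divergence_flux_le.
have hJ : theta * \int[P]_x enorm (g x) <= \int[P]_x edot (g x) (V x).
  rewrite -RintegralZl//; last exact: bmf_integrable bg.
  apply: Rintegral_le => //; first exact: (bmfM (@bmf_cst R N theta) bg).
  exact: (bmf_edot VP VL bgc).
apply: (taylor_grad0_cst C0 Tf) => z; apply: enorm_eq0; apply/eqP; rewrite eq_le enorm_ge0 andbT leNgt.
apply/negP => hz.
have gc : continuous (fun x => enorm (g x)).
  apply: (@lipschitz_continuous_rV R N _ (6 * C) ord0) => a b.
  by apply: le_trans (gL a b); exact: abs_enormB.
have := @Rintegral_gt0 R n _ z bg gc _ (fun x => enorm_ge0 _) hz.
have pg : periodic_fun (fun x => enorm (g x)) by move=> k a; rewrite gP.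
move=> /(_ pg) hp; have := le_trans hJ hI.
by rewrite ler_pM2r// leNgt qtheta.
Qed.

End Isoperimetry.

(** * Controllability *)

Section InvariantDense.
Variables (R : realType) (n : nat) (V : 'rV[R]_n.+1 -> 'rV[R]_n.+1) (L chi : R).
Local Notation N := n.+1.
Hypothesis VP : periodic_fun V.
Hypothesis VL : forall x y, enorm (V x - V y) <= L * enorm (x - y).
Hypothesis hchi : isoperimetric_constant n chi.
Hypothesis hdiv : (LN_norm_div V <= (chi^-1)%:E)%E.

(** If [E] missed a ball, the mollification would vanish at its centre and be positive at [a], yet
    be constant. *)
Lemma invariant_dense (E : set 'rV[R]_N) : open E -> periodic_set E -> forward_invariant V E ->
  E !=set0 -> forall b r, 0 < r -> exists y, E y /\ enorm (y - b) < r.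
Proof.
move=> oE pE fE [a Ea] b r1 r10; apply: contrapT => hb.
have [q [q0 q1 Ap Am]] := divergence_strict VP VL (isoperimetric_constant_gt0 hchi) hdiv.
have /open_enormP/(_ a Ea)[r2 r20 hr2] := oE.
have VL' x y : enorm (V x - V y) <= `|L| * enorm (x - y).
  by apply: le_trans (VL x y) _; rewrite ler_wpM2r ?enorm_ge0// ler_norm.
(* A quarter of the gap: [1 - 2 * d] still exceeds [q], and a velocity at that distance from [V x]
   keeps a margin for the mollifier and for short times. *)
pose d := (1 - q) / 4; have d0 : 0 < d by rewrite divr_gt0// subr_gt0.
pose r := Num.min r1 r2; have r0 : 0 < r by rewrite lt_min r10.
pose e := Num.min (2^-1) (Num.min (r / (2 * N%:R)) (d / ((`|L| + 1) * N%:R))).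
have N0 : 0 < N%:R :> R by [].
have L0 : 0 < `|L| + 1 by rewrite ltr_wpDl.
have e0 : 0 < e.
  rewrite !lt_min invr_gt0 ltr0n; apply/andP; split => //; apply/andP; split; apply: divr_gt0 => //; exact: mulr_gt0.
have e1 : e <= 2^-1 by rewrite /e ge_min lexx.
have er : N%:R * e < r.
  have : e <= r / (2 * N%:R) by rewrite /e !ge_min lexx !orbT.
  rewrite ler_pdivlMr ?mulr_gt0// => h; rewrite mulrC; apply: (@lt_le_trans _ _ (2 * (e * N%:R))).
    by rewrite ltr_pMl ?mulr_gt0// ltr1n.
  by apply: le_trans h; rewrite mulrCA.
have ed : `|L| * (N%:R * e) <= d.
  have : e <= d / ((`|L| + 1) * N%:R) by rewrite /e !ge_min lexx !orbT.
  rewrite ler_pdivlMr ?mulr_gt0// => h; apply: le_trans h.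
  rewrite (_ : e * ((`|L| + 1) * N%:R) = (`|L| + 1) * (N%:R * e)); last by rewrite mulrC -mulrA.
  by rewrite ler_pM2r ?mulr_gt0// lerDl.
pose f := mollification E e; pose g := mollification_grad E e; pose C := @bump_cst R n.
have C0 : 0 <= C := @bump_cst_ge0 R n.
have Tf x h : `|f (x + h) - f x - edot (g x) h| <= C * enorm h ^+ 2.
  exact: (mollification_taylor oE).
have mono x s v := @mollification_mono R n V `|L| VL' E oE pE fE e e0 e1 x s v d ed (normr_ge0 L).
have fmono x s v : 0 <= s -> (forall s', 0 <= s' -> s' <= s -> enorm (v - V (x + s' *: v)) <= 2^-1) ->
    f x <= f (x + s *: v).
  move=> s0 hs; apply: mono => // s' h1 h2; have := hs s' h1 h2.
  have : d < 2^-1 by rewrite /d; lra.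
  lra.
pose th := 1 - 2 * d.
have thd : th + d / 2 + d < 1 by rewrite /th; move: (d) d0 => d' d'0; lra.
have qth : q < th by rewrite /th /d; lra.
have fg x : th * enorm (g x) <= edot (g x) (V x).
  have [gz|gn] := eqVneq (enorm (g x)) 0; first by rewrite gz mulr0 (enorm_eq0 gz) edot0l.
  have gp : 0 < enorm (g x) by rewrite lt_def gn enorm_ge0.
  (* Among the velocities within [th] of [V x], the one along which [f] increases least. *)
  pose v := V x - (th / enorm (g x)) *: g x.
  have th0 : 0 <= th by apply: ltW; apply: lt_trans qth.
  have vV : enorm (v - V x) = th.
    by rewrite /v addrAC subrr sub0r enormN enormZ ger0_norm ?divr_ge0 ?enorm_ge0// divfK.
  have gv : edot (g x) v = edot (g x) (V x) - th * enorm (g x).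
    rewrite /v edotBr edotZr -sqr_enorm; congr (_ - _).
    by move: (enorm (g x)) gn => t t0; field.
  suff : 0 <= edot (g x) v by rewrite gv subr_ge0.
  rewrite leNgt; apply/negP => gv0.
  pose D := C * enorm v ^+ 2 + 1; have D0 : 0 < D by rewrite ltr_wpDl// mulr_ge0// sqr_ge0.
  pose A := `|L| * enorm v + 1; have A0 : 0 < A by rewrite ltr_wpDl// mulr_ge0// enorm_ge0.
  (* Short enough for the velocity to stay allowed and for the quadratic remainder to stay below the
     linear decrease. *)
  pose s := Num.min (d / (2 * A)) (- edot (g x) v / (2 * D)).
  have gn0 : 0 < - edot (g x) v by rewrite oppr_gt0.
  have A2 : 0 < 2 * A by apply: mulr_gt0.
  have D2 : 0 < 2 * D by apply: mulr_gt0.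
  have s0 : 0 < s by rewrite lt_min (divr_gt0 d0 A2) (divr_gt0 gn0 D2).
  have s1 : s * A <= d / 2.
    have : s <= d / (2 * A) by rewrite /s ge_min lexx.
    by rewrite ler_pdivlMr//; lra.
  have s2 : s * D <= - edot (g x) v / 2.
    have : s <= - edot (g x) v / (2 * D) by rewrite /s ge_min lexx orbT.
    by rewrite ler_pdivlMr//; lra.
  have hm : f x <= f (x + s *: v).
    apply: mono; first exact: ltW.
    move=> s' h1 h2.
    have : enorm (v - V (x + s' *: v)) <= th + d / 2.
      apply: le_trans (enorm_triangle (V x) _ _) _; rewrite vV lerD2l.
      apply: le_trans (VL' _ _) _.
      rewrite opprD addrA subrr sub0r enormN enormZ (ger0_norm h1).
      apply: le_trans s1; rewrite /A mulrDr mulr1 mulrCA.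
      apply: (@le_trans _ _ (s * (`|L| * enorm v))); last by rewrite lerDl ltW.
      by rewrite ler_wpM2r// mulr_ge0// enorm_ge0.
    by move=> h; apply: le_lt_trans (lerD h (lexx d)) thd.
  have := Tf x (s *: v); rewrite edotZr enormZ exprMn real_normK ?num_real// => /(le_trans (ler_norm _)) h3.
  have h4 : s * (- edot (g x) v) <= s * (s * (C * enorm v ^+ 2)).
    move: h3 hm; move: (f _) (f _) (edot _ _) (enorm v) => a1 a2 a3 a4; rewrite !expr2; lra.
  rewrite ler_pM2l// in h4.
  have h5 : s * (C * enorm v ^+ 2) <= s * D by rewrite ler_pM2l// lerDl.
  by have := le_trans h4 (le_trans h5 s2); lra.
have := @monotone_cst R n V `|L| VP VL' f g C th C0 Tf (mollification_periodic E e)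
  (mollification_grad_periodic E e) fg fmono chi q hchi q0 qth Ap Am a b.
rewrite /f (@mollification_out R n E oE pE e e0 e1 b r er); last first.
  by move=> y hy Ey; apply: hb; exists y; split => //; apply: lt_le_trans hy _; rewrite ge_min lexx.
have h := @mollification_in R n E oE pE e e0 e1 a r er.
move=> h'; move: h; rewrite h' ltxx => h; have // : false; apply: h => y hy; apply: hr2.
by apply: lt_le_trans hy _; rewrite ge_min lexx orbT.
Qed.

End InvariantDense.

(** * Polygonal trajectories with their duration and cost *)

Section Chains.
Variables (R : realType) (n : nat).
Local Notation N := n.+1.
Local Notation E := 'rV[R]_N.
Implicit Types (G : E -> E -> R) (x y z v : E) (s t c l : R).

(* [(v, l)] is a control at [y]: its affine function lies below [G y]. *)
Definition admissible G y v l := forall q : E, edot v q - l <= G y q.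

(** Admissibility is asked in a tube around the segment, so that a chain survives small
    translations. *)
Definition admissible_near G x v s l := exists2 d : R, 0 < d &
  forall s' z, 0 <= s' -> s' <= s -> enorm (z - (x + s' *: v)) < d -> admissible G z v l.

Inductive chain G : E -> E -> R -> R -> Prop :=
| chain_nil x : chain G x x 0 0
| chain_cons x v l s y t c : 0 <= s -> admissible_near G x v s l -> chain G (x + s *: v) y t c ->
    chain G x y (s + t) (s * l + c).

Lemma chain_cat G x y z t c t' c' : chain G x y t c -> chain G y z t' c' -> chain G x z (t + t') (c + c').
Proof.
move=> h; elim: h z t' c' => {x y t c} [x|x v l s y t c s0 hs _ IH] z t' c' h'; first by rewrite !add0r.
by rewrite -!addrA; apply: (chain_cons s0 hs); exact: IH.
Qed.

Lemma chain_step G x v s l : 0 <= s -> admissible_near G x v s l -> chain G x (x + s *: v) s (s * l).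
Proof. by move=> s0 h; rewrite -[s in chain _ _ _ s]addr0 -[s * l]addr0; apply: (@chain_cons _ _ v l) => //; exact: chain_nil. Qed.

Lemma chain_time_ge0 G x y t c : chain G x y t c -> 0 <= t.
Proof. by elim => // {x y t c} x v l s y t c s0 _ _ t0; rewrite addr_ge0. Qed.

Lemma chain_le G G' x y t c : (forall x q, G x q <= G' x q) -> chain G x y t c -> chain G' x y t c.
Proof.
move=> GG'; elim => {x y t c} [x|x v l s y t c s0 [d d0 hd] _ IH]; first exact: chain_nil.
apply: (@chain_cons _ _ v l) => //; exists d => // s' z h1 h2 h3 q; exact: le_trans (hd s' z h1 h2 h3 q) (GG' _ _).
Qed.

Lemma chain_translate G x y t c (z : 'rV[int]_N) : (forall q, periodic_fun (G^~ q)) -> chain G x y t c ->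
  chain G (x + intvec R z) (y + intvec R z) t c.
Proof.
move=> GP; elim => {x y t c} [x|x v l s y t c s0 [d d0 hd] _ IH]; first exact: chain_nil.
apply: (@chain_cons _ _ v l) => //; last by rewrite addrAC.
exists d => // s' w h1 h2 h3 q; rewrite -[w](subrK (intvec R z)) GP; apply: (hd s') => //.
by rewrite (_ : _ - _ = w - (x + intvec R z + s' *: v))//; apply/rowP => i; rewrite !mxE; ring.
Qed.

Lemma chain_perturb G x y t c : chain G x y t c -> exists2 d : R, 0 < d &
  forall h : E, enorm h < d -> chain G (x + h) (y + h) t c.
Proof.
elim => {x y t c} [x|x v l s y t c s0 [d d0 hd] _ [d' d'0 IH]].
  by exists 1 => // h _; exact: chain_nil.
exists (Num.min (d / 2) d'); first by rewrite lt_min divr_gt0.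
move=> h; rewrite lt_min => /andP[h1 h2]; apply: (@chain_cons _ _ v l) => //; last by rewrite addrAC; exact: IH.
exists (d / 2); first by rewrite divr_gt0.
move=> s' z a1 a2 a3; apply: (hd s') => //.
rewrite (_ : _ - _ = (z - (x + h + s' *: v)) + h); last by apply/rowP => i; rewrite !mxE; ring.
by apply: le_lt_trans (enormD _ _) _; rewrite [ltRHS]splitr ltrD.
Qed.

(** A cut inside a segment yields two segments with the same control, since the cost is proportional
    to the duration. *)
Lemma chain_split G x y t c r : chain G x y t c -> 0 <= r -> r <= t ->
  exists z c1 c2, [/\ chain G x z r c1, chain G z y (t - r) c2 & c = c1 + c2].
Proof.
move=> h; elim: h r => {x y t c} [x|x v l s y t c s0 hs hc IH] r r0 rt.
  have -> : r = 0 by apply/eqP; rewrite eq_le rt r0.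
  by exists x, 0, 0; rewrite subr0 addr0; split => //; exact: chain_nil.
have [rs|sr] := lerP r s.
  exists (x + r *: v), (r * l), ((s - r) * l + c); split; last by rewrite addrA -mulrDl addrCA subrr addr0.
    apply: chain_step => //; case: hs => d d0 hd; exists d => // s' z h1 h2; apply: hd => //; exact: le_trans rs.
  rewrite (_ : s + t - r = (s - r) + t); last by ring.
  apply: (@chain_cons _ _ v l); [by rewrite subr_ge0| |by rewrite -addrA -scalerDl addrCA subrr addr0].
  case: hs => d d0 hd; exists d => // s' z h1 h2; rewrite -addrA -scalerDl; apply: hd; first exact: addr_ge0.
  by rewrite addrC -lerBrDr.
have [||z [c1 [c2 [k1 k2 ->]]]] := IH (r - s); [by rewrite subr_ge0 ltW|by rewrite lerBlDl|].
exists z, (s * l + c1), c2; split; last by rewrite addrA.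
- by rewrite -[r](subrK s) [_ + s]addrC; apply: (@chain_cons _ _ v l).
- by rewrite (_ : s + t - r = t - (r - s)); last by ring.
Qed.

Section Bounds.
Variables (G : E -> E -> R) (K : R).
Hypothesis GK : forall x q, G x q <= K * enorm q.

(** Otherwise the affine minorant [edot v q - l] would outgrow [K * enorm q] along the ray of
    [v]. *)
Lemma admissible_speed y v l : admissible G y v l -> enorm v <= K.
Proof.
move=> h; rewrite leNgt; apply/negP => Kv.
have v0 : 0 < enorm v.
  (* Here [K] is negative, so the growth bound tends to minus infinity while the minorant is
     constant. *)
  rewrite lt_def enorm_ge0 andbT; apply/eqP => v0; move: Kv; rewrite v0 => Kv.
  have := GK y 0; have := h (ecoord R ord0).
  have := GK y (ecoord R ord0); rewrite enorm_ecoord mulr1 (enorm_eq0 v0) edot0l sub0r.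
  move=> h1 h2 _; have := h ((`|l| / - K + 2) *: ecoord R ord0); rewrite (enorm_eq0 v0) edot0l sub0r.
  move=> /le_trans/(_ (GK _ _)); rewrite enormZ enorm_ecoord mulr1.
  have p0 : 0 <= `|l| / - K by rewrite divr_ge0// oppr_ge0 ltW.
  rewrite ger0_norm ?addr_ge0// mulrDr (_ : K * (`|l| / - K) = - `|l|); last by field; rewrite lt_eqF.
  by have := ler_norm l; lra.
pose D := enorm v * (enorm v - K); have D0 : 0 < D by rewrite mulr_gt0// subr_gt0.
pose a := (`|l| + 1) / D; have a0 : 0 < a by rewrite divr_gt0// ltr_wpDl.
have := le_trans (h (a *: v)) (GK _ _); rewrite edotZr -sqr_enorm enormZ gtr0_norm//.
have e : a * D = `|l| + 1 by rewrite /a divfK// gt_eqF.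
have := ler_norm l; move: e; rewrite /D expr2; move: (enorm v) => w; lra.
Qed.

Lemma chain_displacement x y t c : chain G x y t c -> enorm (y - x) <= K * t.
Proof.
elim => {x y t c} [x|x v l s y t c s0 [d d0 hd] _ IH]; first by rewrite subrr enorm0 mulr0.
have hv : enorm v <= K.
  by apply: (@admissible_speed x v l); apply: (hd 0) => //; rewrite scale0r addr0 subrr enorm0.
rewrite (_ : y - x = (y - (x + s *: v)) + s *: v); last by apply/rowP => i; rewrite !mxE; ring.
apply: le_trans (enormD _ _) _; rewrite mulrDr addrC; apply: lerD => //.
by rewrite enormZ ger0_norm// mulrC ler_wpM2r.
Qed.

Lemma chain_gain x y t c (P : E) K1 : (forall x, G x P <= K1) -> chain G x y t c ->
  edot P (y - x) - c <= K1 * t.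
Proof.
move=> GP; elim => {x y t c} [x|x v l s y t c s0 [d d0 hd] _ IH]; first by rewrite subrr edot0r subr0 mulr0.
have hv : edot v P - l <= K1.
  apply: le_trans (GP x); apply: (hd 0) => //; by rewrite scale0r addr0 subrr enorm0.
rewrite (_ : y - x = (y - (x + s *: v)) + s *: v); last by apply/rowP => i; rewrite !mxE; ring.
rewrite edotDr edotZr (edotC P v).
have := ler_wpM2l s0 hv; rewrite mulrBr mulrDr [K1 * s]mulrC; move: IH; lra.
Qed.

End Bounds.
End Chains.

Lemma compact_nat_cover (T : topologicalType) (K : set T) (O : nat -> set T) : compact K ->
  (forall m, open (O m)) -> (forall m k, (m <= k)%N -> O m `<=` O k) -> (forall x, K x -> exists m, O m x) ->
  exists m, K `<=` O m.
Proof.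
move=> /compact_near_coveringP cK oO mO cov.
have [|m _ h] := cK nat \oo (fun m x => O m x) _; last by exists m => x Kx; exact: (h m (leqnn m)).
move=> x /cov[m Om]; exists (O m, [set k | (m <= k)%N]).
  by split; [apply: open_nbhs_nbhs; split; [exact: oO|]|exists m].
by move=> [y k] [/= Oy mk]; exact: mO Oy.
Qed.

(** * Uniformly bounded connection times *)

Section Controllability.
Variables (R : realType) (n : nat) (V : 'rV[R]_n.+1 -> 'rV[R]_n.+1) (L chi : R).
Local Notation N := n.+1.
Local Notation E := 'rV[R]_N.
Hypothesis L0 : 0 <= L.
Hypothesis VP : periodic_fun V.
Hypothesis VL : forall x y, enorm (V x - V y) <= L * enorm (x - y).
Hypothesis hchi : isoperimetric_constant n chi.
Hypothesis hdiv : (LN_norm_div V <= (chi^-1)%:E)%E.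
Implicit Types (x y v b : E) (s t d : R).

Lemma intvecD (z w : 'rV[int]_N) : intvec R (z + w) = intvec R z + intvec R w.
Proof. by apply/rowP => i; rewrite !mxE intrD. Qed.

Lemma intvec0 : intvec R (0 : 'rV[int]_N) = 0.
Proof. by apply/rowP => i; rewrite !mxE. Qed.

Lemma intvecN (z : 'rV[int]_N) : intvec R (- z) = - intvec R z.
Proof. by apply/rowP => i; rewrite !mxE mulrNz. Qed.

Lemma Ham_periodic q : periodic_fun ((Ham V)^~ q).
Proof. by move=> z x; rewrite /Ham VP. Qed.

(** [Ham V y] is the support function of the unit ball centred at [V y]. *)
Lemma ham_admissible y v : enorm (v - V y) <= 1 -> admissible (Ham V) y v 0.
Proof.
move=> h q; rewrite subr0 /Ham -lerBlDr [edot q _]edotC -edotBl.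
apply: le_trans (ler_norm _) _; apply: le_trans (abs_edot_le _ _) _.
by rewrite -[leRHS]mul1r ler_wpM2r ?enorm_ge0.
Qed.

(** On the compact time interval the strict inequality has a positive margin, and the Lipschitz
    bound turns it into the width of a tube. *)
Lemma ham_step x v s : 0 <= s -> (forall s', 0 <= s' -> s' <= s -> enorm (v - V (x + s' *: v)) < 1) ->
  chain (Ham V) x (x + s *: v) s 0.
Proof.
move=> s0 h; rewrite -[X in chain _ _ _ _ X](mulr0 s); apply: chain_step => //.
pose f (s' : R) : R := enorm (v - V (x + s' *: v)).
have fL (a b : R) : `|f a - f b| <= L * enorm v * `|a - b|.
  apply: le_trans (abs_enormB _ _) _.
  rewrite (_ : _ - _ = V (x + b *: v) - V (x + a *: v)); last by apply/rowP => i; rewrite !mxE; ring.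
  apply: le_trans (VL _ _) _; rewrite (_ : _ - _ = (b - a) *: v); last by apply/rowP => i; rewrite !mxE; ring.
  by rewrite enormZ distrC mulrA mulrAC.
have cf : continuous f.
  move=> a; apply/cvgrPdist_lt => e e0.
  have K0 : 0 < L * enorm v + 1 by rewrite ltr_wpDl// mulr_ge0// enorm_ge0.
  apply: filterS (nbhsx_ballx a (e / (L * enorm v + 1)) (divr_gt0 e0 K0)) => c.
  rewrite /ball /= ltr_pdivlMr// => hb; apply: le_lt_trans (fL _ _) _; apply: le_lt_trans hb.
  by rewrite mulrC ler_wpM2l// lerDl.
have [c hc hm] : exists2 c, c \in `[0, s] & forall t, t \in `[0, s] -> f t <= f c.
  by apply: EVT_max => //; exact: continuous_subspaceT.
have c1 : f c < 1 by move: hc; rewrite in_itv/= => /andP[? ?]; exact: h.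
have L1 : 0 < L + 1 by rewrite ltr_wpDl.
exists ((1 - f c) / (L + 1)); first by rewrite divr_gt0 ?subr_gt0.
move=> s' z h1 h2; rewrite ltr_pdivlMr// => h3; apply: ham_admissible.
apply: le_trans (enorm_triangle (V (x + s' *: v)) _ _) _.
have h4 : f s' <= f c by apply: hm; rewrite in_itv/= h1.
have h5 := VL (x + s' *: v) z; rewrite [enorm (x + _ - z)]enormB in h5.
move: h3 h4 h5 (enorm_ge0 (z - (x + s' *: v))); rewrite /f; lra.
Qed.

(** The starting point is left free in a small ball, which makes the reachable set open; [ham_step]
    makes it invariant, hence dense. *)
Lemma reach_dense x1 r b d : 0 < r -> 0 < d -> exists x' y z t,
  [/\ enorm (x' - x1) < r, enorm (y - b) < d & chain (Ham V) x' (y + intvec R z) t 0].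
Proof.
move=> r0 d0.
pose A : set E := [set y | exists x' z t, enorm (x' - x1) < r /\ chain (Ham V) x' (y + intvec R z) t 0].
have pA : periodic_set A.
  move=> z0 x; split=> -[x' [z [t [h1 h2]]]].
    by exists x', (z0 + z), t; rewrite intvecD addrA.
  exists x', (z - z0), t; rewrite intvecD intvecN (_ : x + _ + _ = x + intvec R z)//.
  by apply/rowP => i; rewrite !mxE; ring.
have oA : open A.
  apply/open_enormP => y [x' [z [t [h1 h2]]]]; have [d' d'0 hd'] := chain_perturb h2.
  exists (Num.min d' (r - enorm (x' - x1))); first by rewrite lt_min d'0 subr_gt0.
  move=> y'; rewrite lt_min => /andP[h3 h4]; exists (x' + (y' - y)), z, t; split.
    rewrite addrAC; apply: le_lt_trans (enormD _ _) _; lra.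
  by have := hd' _ h3; rewrite addrAC [y + (y' - y)]addrC subrK.
have fA : forward_invariant V A.
  move=> y s v [x' [z [t [h1 h2]]]] s0 hs; exists x', z, (t + s); split => //.
  rewrite -[X in chain _ _ _ _ X]addr0; apply: chain_cat h2 _.
  rewrite addrAC; apply: ham_step => // s' k1 k2.
  by rewrite addrAC VP; exact: hs.
have neA : A !=set0 by exists x1, x1, 0, 0; rewrite subrr enorm0 intvec0 addr0; split => //; exact: chain_nil.
have [y [[x' [z [t [h1 h2]]]] hy]] := invariant_dense VP VL hchi hdiv oA pA fA neA b d0.
by exists x', y, z, t.
Qed.

(** For a duration [s] so short that [V] varies by less than 1/2, all velocities within 1/2 of [V x]
    remain allowed. The balls so reached absorb the inexactness of [reach_dense]. *)
Lemma local_reach : exists2 s, 0 < s & forall x x',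
  (enorm (x' - (x + s *: V x)) <= s / 2 -> chain (Ham V) x x' s 0) /\
  (enorm (x' - (x - s *: V x)) <= s / 2 -> chain (Ham V) x' x s 0).
Proof.
have [B hB] := periodic_lipschitz_bounded VP VL; have B0 : 0 <= B := le_trans (enorm_ge0 _) (hB 0).
pose D := 2 * (L + 1) * (B + 1); have D0 : 0 < D by rewrite !mulr_gt0// ltr_wpDl.
exists D^-1; first by rewrite invr_gt0.
set s := D^-1; have s0 : 0 < s by rewrite invr_gt0.
have sD : s * D = 1 by rewrite mulVf// gt_eqF.
have key (p x v a : E) : enorm (v - V p) <= 2^-1 -> enorm (a - p) <= s * enorm v -> enorm (v - V a) < 1.
  move=> h1 h2; apply: le_lt_trans (enorm_triangle (V p) _ _) _.
  have hv : enorm v <= B + 2^-1.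
    by rewrite -[v](subrK (V p)); apply: le_trans (enormD _ _) _; rewrite addrC lerD.
  have h3 : enorm (V p - V a) <= L * (s * (B + 2^-1)).
    apply: le_trans (VL _ _) _; rewrite ler_wpM2l// enormB; apply: le_trans h2 _; rewrite ler_pM2l//.
  have h4 : L * (s * (B + 2^-1)) < 2^-1.
    rewrite mulrCA -(ltr_pM2r D0) mulrAC sD mul1r /D.
    rewrite (_ : 2^-1 * _ = (L + 1) * (B + 1)); last by field.
    rewrite mulrDl mul1r; apply: (@le_lt_trans _ _ (L * (B + 1))); last by rewrite ltrDl ltr_wpDl.
    by rewrite ler_wpM2l// lerD2l invf_le1// ler1n.
  by rewrite [ltRHS](splitr 1) div1r; apply: ler_ltD => //; exact: le_lt_trans h3 h4.
have vel (u w : E) : enorm (s^-1 *: u - w) <= 2^-1 <-> enorm (u - s *: w) <= s / 2.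
  rewrite (_ : u - s *: w = s *: (s^-1 *: u - w)); last by rewrite scalerBr scalerA mulfV ?gt_eqF// scale1r.
  by rewrite enormZ gtr0_norm// ler_pM2l.
move=> x x'; split=> h.
  have -> : x' = x + s *: (s^-1 *: (x' - x)).
    by rewrite scalerA mulfV ?gt_eqF// scale1r addrC subrK.
  apply: ham_step; first exact: ltW.
  move=> s' h1 h2; apply: (key x x); first by apply/vel; rewrite opprD addrA in h *; exact: h.
  by rewrite addrC addKr enormZ ger0_norm// ler_wpM2r ?enorm_ge0.
have -> : x = x' + s *: (s^-1 *: (x - x')) by rewrite scalerA mulfV ?gt_eqF// scale1r addrC subrK.
apply: ham_step; first exact: ltW.
move=> s' h1 h2; apply: (key x x).
  apply/vel; rewrite enormB; move: h; congr (enorm _ <= _); apply/rowP => i; rewrite !mxE; ring.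
rewrite (_ : _ - x = (s' - s) *: (s^-1 *: (x - x'))).
  rewrite enormZ ler_wpM2r ?enorm_ge0// distrC ger0_norm ?subr_ge0//; lra.
rewrite scalerBl (scalerA s) mulfV ?gt_eqF// scale1r; apply/rowP => i; rewrite !mxE; ring.
Qed.

Lemma uniform_time (A : E -> R -> Prop) : (forall x t t', t <= t' -> A x t -> A x t') ->
  (forall t, open [set x | A x t]) -> (forall x, exists t, A x t) ->
  (forall (z : 'rV[int]_N) x t, A (x + intvec R z) t -> A x t) -> exists t, forall x, A x t.
Proof.
move=> mA oA exA pA.
have [m hm] : exists m : nat, [set y : E | enorm (y - 0) <= N%:R] `<=` [set x | A x m%:R].
  apply: (@compact_nat_cover E _ (fun m : nat => [set x | A x m%:R])).
  - exact: compact_enorm_ball.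
  - by move=> m; exact: oA.
  - by move=> m k mk x /=; apply: mA; rewrite ler_nat.
  - move=> x _; have [t At] := exA x; exists (Num.bound `|t|) => /=; apply: mA At.
    by apply: le_trans (ler_norm t) _; apply: ltW; apply: archi_boundP.
exists m%:R => x; have [z hz] := unit_cube_shift x; apply: (pA z); apply: hm => /=.
rewrite subr0 -[N%:R]mulr1 enorm_le_const// => i.
by have [h1 h2] := hz i; rewrite ger0_norm// ltW.
Qed.

(** Trajectories are routed through the origin modulo integers: compactness bounds the time to get
    there from any point and the time to go from there to any point, and [local_reach] corrects the
    approximate ends. *)
Lemma controllability : exists T, forall x y, exists z t, t <= T /\ chain (Ham V) x (y + intvec R z) t 0.
Proof.
have [s s0 hs] := local_reach; have s20 : 0 < s / 2 by rewrite divr_gt0.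
have tr := fun x y t c z h => @chain_translate R n (Ham V) x y t c z Ham_periodic h.
(* The sign [sg] treats departures and arrivals together. *)
have openA (sg : R) (Q : E -> R -> Prop) (t : R) : `|sg| = 1 ->
    open [set x : E | exists2 x', enorm (x' - (x + (sg * s) *: V x)) < s / 2 & Q x' t].
  move=> sg1; apply/open_enormP => x [x' h1 h2]; pose k := 1 + s * L.
  have k0 : 0 < k by rewrite ltr_pwDl// mulr_ge0// ltW.
  exists ((s / 2 - enorm (x' - (x + (sg * s) *: V x))) / k); first by rewrite divr_gt0// subr_gt0.
  move=> y; rewrite ltr_pdivlMr// => hy; exists x' => //.
  rewrite (_ : _ - _ = (x' - (x + (sg * s) *: V x)) + ((x - y) + (sg * s) *: (V x - V y))); last first.
    by apply/rowP => i; rewrite !mxE; ring.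
  apply: le_lt_trans (enormD _ _) _; rewrite -ltrBrDl; apply: le_lt_trans hy.
  apply: le_trans (enormD _ _) _; rewrite enormZ normrM sg1 mul1r (gtr0_norm s0) [enorm (x - y)]enormB.
  have := VL x y; rewrite [enorm (x - y)]enormB => h.
  by rewrite /k mulrDr mulr1 lerD2l [leRHS]mulrCA ler_pM2l// [leRHS]mulrC.
have [T1 hT1] : exists T1, forall x, exists2 x', enorm (x' - (x + (1 * s) *: V x)) < s / 2 &
    exists z t, t <= T1 /\ chain (Ham V) x' (0 + intvec R z) t 0.
  apply: (@uniform_time (fun x T => exists2 x', enorm (x' - (x + (1 * s) *: V x)) < s / 2 &
    exists z t, t <= T /\ chain (Ham V) x' (0 + intvec R z) t 0)).
  - move=> x t t' tt [x' h [z [k [h1 h2]]]]; exists x' => //; exists z, k; split => //; exact: le_trans tt.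
  - by move=> t; apply: (openA 1 (fun x' t => exists z k, k <= t /\ chain (Ham V) x' (0 + intvec R z) k 0)); rewrite normr1.
  - move=> x; have [x' [y [z [t [h1 h2 h3]]]]] := reach_dense (x + (1 * s) *: V x) (0 - s *: V 0) s20 s20.
    exists (t + s), x' => //; exists z, (t + s); split => //.
    rewrite -[X in chain _ _ _ _ X]addr0; apply: chain_cat h3 _; apply: tr.
    by apply: (hs 0 y).2; exact: ltW.
  - move=> z x t [x' h [w [k [h1 h2]]]]; exists (x' - intvec R z).
      by move: h; rewrite VP; congr (enorm _ < _); apply/rowP => i; rewrite !mxE; ring.
    exists (w - z), k; split => //; have := tr _ _ _ _ (- z) h2.
    by rewrite intvecN intvecD intvecN addrA.
have [T2 hT2] : exists T2, forall y, exists2 y', enorm (y' - (y + (- 1 * s) *: V y)) < s / 2 &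
    exists z t, t <= T2 /\ chain (Ham V) 0 (y' + intvec R z) t 0.
  apply: (@uniform_time (fun y T => exists2 y', enorm (y' - (y + (- 1 * s) *: V y)) < s / 2 &
    exists z t, t <= T /\ chain (Ham V) 0 (y' + intvec R z) t 0)).
  - move=> x t t' tt [x' h [z [k [h1 h2]]]]; exists x' => //; exists z, k; split => //; exact: le_trans tt.
  - by move=> t; apply: (openA (-1) (fun y' t => exists z k, k <= t /\ chain (Ham V) 0 (y' + intvec R z) k 0)); rewrite normrN1.
  - move=> y; have [x' [y' [z [t [h1 h2 h3]]]]] := reach_dense (0 + s *: V 0) (y + (- 1 * s) *: V y) s20 s20.
    exists (s + t), y' => //; exists z, (s + t); split => //.
    rewrite -[X in chain _ _ _ _ X]addr0; apply: chain_cat h3.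
    by apply: (hs 0 x').1; exact: ltW.
  - move=> z x t [x' h [w [k [h1 h2]]]]; exists (x' - intvec R z).
      by move: h; rewrite VP; congr (enorm _ < _); apply/rowP => i; rewrite !mxE; ring.
    exists (w + z), k; split => //.
    by rewrite intvecD addrA addrAC subrK.
exists (s + T1 + (T2 + s)) => x y.
have [x' hx' [z1 [t1 [ht1 c1]]]] := hT1 x; have [y' hy' [z2 [t2 [ht2 c2]]]] := hT2 y.
exists (z2 + z1), (s + t1 + (t2 + s)); split; first by rewrite !lerD.
have k1 : chain (Ham V) x x' s 0 by apply: (hs x x').1; rewrite mul1r in hx'; exact: ltW.
have k2 : chain (Ham V) y' y s 0 by apply: (hs y y').2; rewrite mulN1r scaleNr in hy'; exact: ltW.
have k3 : chain (Ham V) 0 (y + intvec R z2) (t2 + s) (0 + 0) := chain_cat c2 (tr _ _ _ _ z2 k2).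
have e0 : 0 = 0 + 0 + (0 + 0) :> R by rewrite !addr0.
rewrite e0; apply: chain_cat (chain_cat k1 c1) _; rewrite intvecD addrA; apply: tr.
exact: k3.
Qed.

End Controllability.

(** * Critical value and viscosity solutions *)

Section TestFunctions.
Variables (R : realType) (m : nat) (phi : 'rV[R]_m -> R).
Hypothesis hphi : C1 phi.

Lemma C1_grad_near x (e : R) : 0 < e -> \forall y \near x, enorm (grad phi y - grad phi x) < e.
Proof.
move=> e0; have k0 : 0 < m%:R + 1 :> R by rewrite ltr_wpDl.
have : \forall y \near x, forall i : 'I_m, `|'D_(ecoord R i) phi x - 'D_(ecoord R i) phi y| <= e / (m%:R + 1).
  have a0 : 0 < e / (m%:R + 1) by exact: divr_gt0.
  have H (i : 'I_m) : exists d, 0 < d /\ forall y, enorm (y - x) < d ->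
      `|'D_(ecoord R i) phi x - 'D_(ecoord R i) phi y| <= e / (m%:R + 1).
    have /continuous_enormP/(_ x _ a0)[d d0 hd] := hphi.2 i.
    by exists d; split => // y /hd; rewrite distrC => /ltW.
  have [d hd] := choice H.
  apply/nbhs_enormP; exists (\big[Num.min/1]_i d i).
    by elim/big_ind: _ => [//|a b a0' b0|i _]; [rewrite lt_min a0'|exact: (hd i).1].
  by move=> y hy i; apply: (hd i).2; apply: lt_le_trans hy _; exact: bigmin_le_cond.
apply: filterS => y hy; apply: (@le_lt_trans _ _ (m%:R * (e / (m%:R + 1)))).
  apply: enorm_le_const; first by rewrite ltW// divr_gt0.
  by move=> i; rewrite !mxE distrC; exact: hy.
by rewrite mulrCA gtr_pMr// ltr_pdivrMr// mul1r ltrDl.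
Qed.

Lemma derive_edot_grad x v : 'D_v phi x = edot (grad phi x) v.
Proof.
have d := hphi.1 x; rewrite deriveE// {1}[v]row_sum_delta linear_sum; apply: eq_bigr => i _.
by rewrite linearZ/= mxE deriveE// mulrC.
Qed.

Lemma C1_mvt x v (s : R) : 0 <= s -> exists xi : R, [/\ 0 <= xi, xi <= s &
  phi (x + s *: v) - phi x = s * edot (grad phi (x + xi *: v)) v].
Proof.
move=> s0; pose psi (t : R) := phi (x + t *: v).
have D (t : R) : is_derive t (1 : R) psi (edot (grad phi (x + t *: v)) v).
  have E : (fun h : R => h^-1 *: (psi (h *: 1 + t) - psi t)) =
      (fun h => h^-1 *: (phi (h *: v + (x + t *: v)) - phi (x + t *: v))).
    apply/funext => h; rewrite /psi [h *: 1]mulr1; congr (_ *: (phi _ - _)).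
    by rewrite scalerDl addrCA.
  have dv : derivable phi (x + t *: v) v by exact: (diff_derivable (hphi.1 _)).
  apply: DeriveDef; first by rewrite /derivable E.
  by rewrite -derive_edot_grad /derive E.
have [|xi hxi e] := @MVT_segment R psi (fun t => edot (grad phi (x + t *: v)) v) 0 s s0.
  apply: continuous_subspaceT => t; apply: differentiable_continuous; apply/derivable1_diffP.
  by have [] := D t.
exists xi; move: hxi; rewrite in_itv/= => /andP[h1 h2]; split => //.
by move: e; rewrite /psi scale0r addr0 subr0 mulrC.
Qed.

End TestFunctions.

(** * Critical level and values of the control problem *)

Section CriticalValue.
Variables (R : realType) (n : nat).
Local Notation N := n.+1.
Local Notation E := 'rV[R]_N.
Variables (G : E -> E -> R) (K T : R) (P : E).
Hypothesis K0 : 0 <= K.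
Hypothesis T0 : 0 <= T.
Hypothesis GK : forall x q, G x q <= K * enorm q.
Hypothesis GP : forall q, periodic_fun (G^~ q).
Hypothesis Gdense : forall x0 q0 (e : R), 0 < e -> exists v l d, [/\ 0 < d, G x0 q0 - e <= edot v q0 - l &
  forall y, enorm (y - x0) < d -> admissible G y v l].
Hypothesis Gctrl : forall x y, exists z t, t <= T /\ chain G x (y + intvec R z) t 0.
Implicit Types (x y v : E) (s t a c l : R).

(** The most by which a subsolution at level [a] may rise along the chain. *)
Definition chain_value a x y t c := edot P (x - y) + a * t + c.

(** The infimum of these levels is a critical value in the sense of Mane. *)
Definition bounded_levels : set R :=
  [set a | exists B, forall x y t c, chain G x y t c -> - B <= chain_value a x y t c].

Lemma bounded_levels_gain : bounded_levels (K * enorm P).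
Proof.
exists 0 => x y t c h; have := chain_gain (K1 := K * enorm P) (P := P) (fun x => GK x P) h.
rewrite oppr0 /chain_value -[x - y]opprB edotNr; lra.
Qed.

(** A cycle modulo integers can be repeated, by periodicity, and a negative value would accumulate
    without bound. *)
Lemma cycle_ge0 a x (z : 'rV[int]_N) t c : bounded_levels a -> chain G x (x + intvec R z) t c ->
  0 <= - edot P (intvec R z) + a * t + c.
Proof.
move=> [B hB] h; rewrite leNgt; apply/negP => h0.
have it (k : nat) : exists w, intvec R w = k%:R *: intvec R z /\
    chain G x (x + intvec R w) (k%:R * t) (k%:R * c).
  elim: k => [|k [w [e hw]]].
    by exists 0; rewrite intvec0 mulr0n !mul0r scale0r addr0; split => //; exact: chain_nil.
  exists (z + w); rewrite intvecD e -natr1 scalerDl scale1r addrC; split => //.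
  rewrite -e !mulrDl !mul1r [intvec R w + _]addrC addrA [_ * t + t]addrC [_ * c + c]addrC.
  apply: chain_cat h _; rewrite addrAC; exact: chain_translate.
set g := - edot P (intvec R z) + a * t + c in h0.
have ng : 0 < - g by rewrite oppr_gt0.
pose k := Num.bound (`|B| / - g).
have hk : `|B| < k%:R * - g by rewrite -ltr_pdivrMr//; apply: archi_boundP; rewrite divr_ge0// ltW.
have [w [e hw]] := it k; have := hB _ _ _ _ hw.
rewrite /chain_value opprD addrA subrr sub0r edotNr e edotZr.
rewrite (_ : _ + _ = k%:R * g); last by rewrite /g; ring.
move=> h1; have := ler_norm B; move: hk h1; rewrite mulrN; lra.
Qed.

Lemma small_step x0 q0 e : 0 < e -> exists v l d, [/\ 0 < d, G x0 q0 - e <= edot v q0 - l &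
  forall s y, 0 <= s -> s <= d -> enorm (y - x0) <= d -> chain G y (y + s *: v) s (s * l)].
Proof.
move=> e0; have [v [l [d [d0 h1 h2]]]] := Gdense x0 q0 e0.
(* Besides the path itself, the summand 2 accounts for the displaced starting point and for the
   tube. *)
have A0 : 0 < enorm v + 2 by rewrite ltr_wpDl// enorm_ge0.
have d' : 0 < d / (enorm v + 2) by rewrite divr_gt0.
exists v, l, (d / (enorm v + 2)); split => // s y s0 sd hy; apply: chain_step => //.
exists (d / (enorm v + 2)) => // s' z k1 k2 k3; apply: h2.
rewrite (_ : z - x0 = (z - (y + s' *: v)) + ((y - x0) + s' *: v)); last by apply/rowP => i; rewrite !mxE; ring.
apply: le_lt_trans (enormD _ _) _; have := enormD (y - x0) (s' *: v).
rewrite enormZ (ger0_norm k1) => k4.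
have k5 : s' * enorm v <= d / (enorm v + 2) * enorm v by rewrite ler_wpM2r ?enorm_ge0// (le_trans k2).
have k6 : d / (enorm v + 2) * enorm v + d / (enorm v + 2) + d / (enorm v + 2) = d.
  by have := divfK (lt0r_neq0 A0) d; rewrite mulrDr mulr_natr mulr2n addrA.
lra.
Qed.

(** One step away and a return by controllability form a cycle of positive duration, on which
    [cycle_ge0] bounds the level from below. *)
Lemma bounded_levels_lb : exists a0, forall a, bounded_levels a -> a0 <= a.
Proof.
have [v [l [d [d0 _ hd]]]] := small_step 0 0 (@ltr01 R).
have k1 := hd d 0 (ltW d0) (lexx d) _; rewrite subrr enorm0 in k1.
have {}k1 := k1 (ltW d0); rewrite add0r in k1.
have [z [t [_ k2]]] := Gctrl (d *: v) 0.
have t0 := chain_time_ge0 k2; have dt : 0 < d + t by rewrite ltr_pwDl.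
exists ((edot P (intvec R z) - d * l) / (d + t)) => a Sa.
have := cycle_ge0 Sa (chain_cat k1 k2); rewrite addr0 ler_pdivrMr//; lra.
Qed.

Definition critical := inf bounded_levels.

Lemma bounded_levels_inf : has_inf bounded_levels.
Proof.
split; first by exists (K * enorm P); exact: bounded_levels_gain.
by have [a0 h] := bounded_levels_lb; exists a0.
Qed.

Lemma critical_le_gain : critical <= K * enorm P.
Proof. by apply: (ge_inf bounded_levels_inf.2); exact: bounded_levels_gain. Qed.

Lemma critical_cycle_ge0 x (z : 'rV[int]_N) t c : chain G x (x + intvec R z) t c ->
  0 <= - edot P (intvec R z) + critical * t + c.
Proof.
move=> h; have t0 := chain_time_ge0 h; apply/ler_addgt0Pl => e e0.
have t1 : 0 < t + 1 by rewrite ltr_wpDl.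
have [a Sa ha] := inf_adherent (divr_gt0 e0 t1) bounded_levels_inf.
have := cycle_ge0 Sa h; rewrite -/critical in ha.
have h1 : a * t <= (critical + e / (t + 1)) * t by rewrite ler_wpM2r// ltW.
have h2 : e / (t + 1) * t <= e by rewrite mulrAC ler_pdivrMr// ler_pM2l// lerDl.
move: h1; rewrite mulrDl; lra.
Qed.

(** The cost of closing a chain into a cycle, at speed at most [K] and within time [T]. *)
Definition value_bound := K * T * enorm P + `|critical| * T.

Lemma closing_bound x y (z : 'rV[int]_N) t : t <= T -> chain G y (x + intvec R z) t 0 ->
  `|edot P (x + intvec R z - y)| + `|critical * t| <= value_bound.
Proof.
move=> tT h; have t0 := chain_time_ge0 h; apply: lerD.
  apply: le_trans (abs_edot_le _ _) _; rewrite mulrC ler_wpM2r ?enorm_ge0//.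
  by apply: le_trans (chain_displacement GK h) _; rewrite ler_wpM2l.
by rewrite normrM (ger0_norm t0) ler_wpM2l.
Qed.

(** Close the chain into a cycle: cycles have nonnegative value even at the critical level, so
    controllability makes the infimum itself a bounded level. *)
Lemma critical_value_lb x y t c : chain G x y t c -> - value_bound <= chain_value critical x y t c.
Proof.
move=> h; have [z [t' [tT h']]] := Gctrl y x.
have := critical_cycle_ge0 (chain_cat h h'); have := closing_bound tT h'.
have e : edot P (x + intvec R z - y) = edot P (x - y) + edot P (intvec R z).
  by rewrite -edotDr; congr edot; rewrite addrAC.
rewrite /chain_value e.
have := ler_norm (edot P (x - y) + edot P (intvec R z)).
have := ler_norm (critical * t').
have := ler_norm (- (edot P (x - y) + edot P (intvec R z))); rewrite normrN.
rewrite mulrDr; lra.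
Qed.

Definition arrival_values y : set R := [set r | exists x t c, chain G x y t c /\ r = chain_value critical x y t c].

Definition sub_value y := inf (arrival_values y).

Lemma arrival_values_inf y : has_inf (arrival_values y).
Proof.
split; first by exists (chain_value critical y y 0 0), y, 0, 0; split => //; exact: chain_nil.
by exists (- value_bound) => r [x [t [c [h ->]]]]; exact: critical_value_lb.
Qed.

Lemma sub_value_le x y t c : chain G x y t c -> sub_value y <= chain_value critical x y t c.
Proof. by move=> h; apply: (ge_inf (arrival_values_inf y).2); exists x, t, c. Qed.

Lemma sub_value_bound y : `|sub_value y| <= value_bound.
Proof.
rewrite ler_norml; apply/andP; split.
  apply: lb_le_inf; first by case: (arrival_values_inf y).
  by move=> r [x [t [c [h ->]]]]; exact: critical_value_lb.
apply: le_trans (sub_value_le (chain_nil G y)) _.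
rewrite /chain_value subrr edot0r mulr0 !addr0.
by rewrite addr_ge0 ?mulr_ge0 ?enorm_ge0.
Qed.

Lemma sub_value_periodic : periodic_fun sub_value.
Proof.
have H (z : 'rV[int]_N) y : arrival_values y `<=` arrival_values (y + intvec R z).
  move=> r [x [t [c [h ->]]]]; exists (x + intvec R z), t, c; split; first exact: chain_translate.
  by rewrite /chain_value opprD addrACA subrr addr0.
move=> z y; rewrite /sub_value; congr inf; apply/seteqP; split; last exact: H.
by move=> r /(H (- z)); rewrite intvecN addrK.
Qed.

(** Translating a chain together with its end point preserves its value, so an upper bound persists
    nearby. *)
Lemma sub_value_usc : usc sub_value.
Proof.
move=> y a; rewrite lte_fin ltrNr => h.
have [r [x [t [c [hc ->]]]] hr] := inf_lt (arrival_values_inf y).1 h.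
have [d d0 hd] := chain_perturb hc.
exists [set y' | enorm (y' - y) < d]; first by apply/nbhs_enormP; exists d.
move=> y' hy'; rewrite lte_fin ltrNr; apply: le_lt_trans hr.
have := hd _ hy'; rewrite [y + _]addrC subrK => /sub_value_le h'; apply: (le_trans h').
by rewrite /chain_value (_ : x + (y' - y) - y' = x - y)//; apply/rowP => i; rewrite !mxE; ring.
Qed.

Lemma sub_value_dpp x y t c : chain G x y t c -> sub_value y <= sub_value x + chain_value critical x y t c.
Proof.
move=> h; rewrite -lerBlDr; apply: lb_le_inf; first by case: (arrival_values_inf x).
move=> r [w [t' [c' [h' ->]]]]; rewrite lerBlDr; apply: le_trans (sub_value_le (chain_cat h' h)) _.
by rewrite /chain_value (_ : w - y = (w - x) + (x - y)) ?edotDr; [lra|apply/rowP => i; rewrite !mxE; ring].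
Qed.

(** Arrive at [x0] by a short segment with a nearly optimal control: dynamic programming and the
    local maximum bound the derivative of [phi] along it. *)
Lemma sub_value_visc : visc_sub G P critical sub_value.
Proof.
move=> phi x0 hphi hmax; rewrite leNgt; apply/negP => hG.
(* One third for the control, one for the variation of the gradient; the last one gives the
   contradiction. *)
set q0 := grad phi x0 + P in hG; pose e := (G x0 q0 - critical) / 3.
have e0 : 0 < e by rewrite divr_gt0// subr_gt0.
have [v [l [d [d0 h1 h2]]]] := small_step x0 q0 e0.
have A0 : 0 < enorm v + 1 by rewrite ltr_wpDl// enorm_ge0.
have /nbhs_enormP[r1 r10 hr1] := C1_grad_near hphi x0 (divr_gt0 e0 A0).
have /nbhs_enormP[r2 r20 hr2] := hmax.
pose s := Num.min d (Num.min d (Num.min r1 r2) / (2 * (enorm v + 1))).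
have A2 : 0 < 2 * (enorm v + 1) by rewrite mulr_gt0.
have m0 : 0 < Num.min d (Num.min r1 r2) by rewrite !lt_min d0 r10.
have s0 : 0 < s by rewrite lt_min d0 divr_gt0.
have sd : s <= d by rewrite ge_min lexx.
have sv : s * enorm v < Num.min d (Num.min r1 r2).
  have : s <= Num.min d (Num.min r1 r2) / (2 * (enorm v + 1)) by rewrite /s ge_min lexx orbT.
  rewrite ler_pdivlMr//; have := enorm_ge0 v; nra.
move: sv; rewrite !lt_min => /andP[sv1 /andP[sv2 sv3]].
have nv : enorm (x0 - s *: v - x0) = s * enorm v.
  by rewrite addrAC subrr sub0r enormN enormZ gtr0_norm.
have hc := h2 s (x0 - s *: v) (ltW s0) sd; rewrite nv subrK in hc.
have := sub_value_dpp (hc (ltW sv1)); 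
rewrite /chain_value (_ : x0 - s *: v - x0 = - (s *: v)) ?edotNr ?edotZr; last by rewrite addrAC subrr sub0r.
move=> k1.
have := hr2 (x0 - s *: v); rewrite nv => /(_ sv3) k2.
have [xi [x1 x2 k3]] := C1_mvt hphi (x0 - s *: v) v (ltW s0); rewrite subrK in k3.
set y := x0 - s *: v + xi *: v in k3.
have hy : enorm (y - x0) < r1.
  rewrite (_ : y - x0 = (xi - s) *: v); last by rewrite /y; apply/rowP => i; rewrite !mxE; ring.
  rewrite enormZ distrC ger0_norm ?subr_ge0//; apply: le_lt_trans sv2; rewrite ler_wpM2r ?enorm_ge0//; lra.
have k4 : s * edot (grad phi y) v <= s * (critical + l - edot P v) by rewrite -k3; move: k1 k2; lra.
rewrite ler_pM2l// in k4.
have k5 : `|edot (grad phi x0 - grad phi y) v| <= e.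
  apply: le_trans (abs_edot_le _ _) _; rewrite enormB.
  have := hr1 _ hy; rewrite ltr_pdivlMr// => k; apply: le_trans (ltW k).
  by rewrite ler_wpM2l ?enorm_ge0// lerDl.
have := le_trans (ler_norm _) k5; rewrite edotBl => k6.
have eE : 3 * e = G x0 q0 - critical by rewrite /e; field.
have h1' : G x0 q0 - e <= edot (grad phi x0) v + edot P v - l by move: h1; rewrite -edotDl -/q0 edotC.
clear -k4 k6 h1' eE e0; move: k4 k6 h1' eE e0; lra.
Qed.

Lemma bounded_levels_lt (a : R) : (exists B, forall x y t c, chain G x y t c -> - B <= chain_value a x y t c) -> critical <= a.
Proof. by move=> h; apply: (ge_inf bounded_levels_inf.2). Qed.

(* Otherwise cutting a chain into pieces of duration [t0] would show that a level below the critical one is bounded. *)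
Lemma long_chain t0 : 0 < t0 -> exists x y t c, [/\ chain G x y t c, t0 <= t & chain_value critical x y t c < 1].
Proof.
move=> t00; apply: contrapT => hn.
have hge x y t c : chain G x y t c -> t0 <= t -> 1 <= chain_value critical x y t c.
  by move=> h1 h2; rewrite leNgt; apply/negP => h3; apply: hn; exists x, y, t, c.
have cut (k : nat) : forall x y t c, chain G x y t c -> k%:R * t0 <= t -> k%:R - value_bound <= chain_value critical x y t c.
  elim: k => [|k IH] x y t c h ht; first by rewrite sub0r; exact: critical_value_lb.
  have k0 : 0 <= k%:R * t0 by rewrite mulr_ge0// ltW.
  have ht' : t0 <= t by apply: le_trans ht; rewrite -natr1 mulrDl mul1r lerDr.
  have [z [c1 [c2 [h1 h2 e]]]] := chain_split h (ltW t00) ht'.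
  have ht2 : k%:R * t0 <= t - t0 by move: ht; rewrite -natr1 mulrDl mul1r lerBrDr.
  have := IH _ _ _ _ h2 ht2; have := hge _ _ _ _ h1 (lexx _).
  rewrite /chain_value e (_ : x - y = (x - z) + (z - y)) ?edotDr; last by apply/rowP => i; rewrite !mxE; ring.
  rewrite -natr1; lra.
have : critical <= critical - t0^-1.
  apply: bounded_levels_lt; exists (value_bound + 1) => x y t c h.
  have t1 := chain_time_ge0 h; have q0 : 0 <= t / t0 by rewrite divr_ge0// ltW.
  pose k := Num.truncn (t / t0).
  have /andP[k1 k2] : k%:R <= t / t0 < k.+1%:R by exact: truncn_itv.
  have := cut k _ _ _ _ h; rewrite -ler_pdivlMr// => /(_ k1).
  move: k2; rewrite -natr1 /chain_value mulrBl [t0^-1 * t]mulrC; lra.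
have : 0 < t0^-1 by rewrite invr_gt0.
by lra.
Qed.

Lemma late_arrival t0 y : exists x t c, [/\ chain G x y t c, t0 <= t & chain_value critical x y t c <= 1 + value_bound].
Proof.
have m0 : 0 < Num.max t0 1 by rewrite lt_max ltr01 orbT.
have [x [y' [t [c [h ht hv]]]]] := long_chain m0.
have [z [t' [tT h']]] := Gctrl y' y.
have := closing_bound tT h' => hb.
exists (x - intvec R z), (t + t'), (c + 0); split.
- have := chain_translate (- z) GP (chain_cat h h'); rewrite intvecN addrK; exact.
- have := chain_time_ge0 h'; move: ht; rewrite ge_max => /andP[]; lra.
- rewrite /chain_value addr0 (_ : x - intvec R z - y = (x - y') - (y + intvec R z - y')); last first.
    by apply/rowP => i; rewrite !mxE; ring.
  rewrite edotBr mulrDr.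
  have := ler_norm (- edot P (y + intvec R z - y')); rewrite normrN.
  have := ler_norm (critical * t'); move: hv hb; rewrite /chain_value; lra.
Qed.

Definition late_values t0 y : set R :=
  [set r | exists x t c, [/\ chain G x y t c, t0 <= t & r = chain_value critical x y t c]].

Definition late_value t0 y := inf (late_values t0 y).

Lemma late_values_inf t0 y : has_inf (late_values t0 y).
Proof.
split; first by have [x [t [c [h1 h2 _]]]] := late_arrival t0 y; exists (chain_value critical x y t c), x, t, c.
by exists (- value_bound) => r [x [t [c [h _ ->]]]]; exact: critical_value_lb.
Qed.

Lemma late_value_lb t0 y : - value_bound <= late_value t0 y.
Proof.
apply: lb_le_inf; first by case: (late_values_inf t0 y).
by move=> r [x [t [c [h _ ->]]]]; exact: critical_value_lb.
Qed.

Lemma late_value_le x y t c t0 : chain G x y t c -> t0 <= t -> late_value t0 y <= chain_value critical x y t c.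
Proof. by move=> h ht; apply: (ge_inf (late_values_inf t0 y).2); exists x, t, c. Qed.

Lemma late_value_ub t0 y : late_value t0 y <= 1 + value_bound.
Proof. by have [x [t [c [h1 h2 h3]]]] := late_arrival t0 y; apply: le_trans (late_value_le h1 h2) h3. Qed.

Lemma late_value_mono t0 t1 y : t0 <= t1 -> late_value t0 y <= late_value t1 y.
Proof.
move=> h; apply: lb_le_inf; first by case: (late_values_inf t1 y).
by move=> r [x [t [c [h' ht ->]]]]; apply: late_value_le h' (le_trans h ht).
Qed.

Lemma late_value_periodic t0 : periodic_fun (late_value t0).
Proof.
have H (z : 'rV[int]_N) y : late_values t0 y `<=` late_values t0 (y + intvec R z).
  move=> r [x [t [c [h ht ->]]]]; exists (x + intvec R z), t, c; split => //; first exact: chain_translate.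
  by rewrite /chain_value opprD addrACA subrr addr0.
move=> z y; rewrite /late_value; congr inf; apply/seteqP; split; last exact: H.
by move=> r /(H (- z)); rewrite intvecN addrK.
Qed.

(* The lower half-relaxed limit of [late_value t0] as [t0] tends to infinity. *)
Definition super_values y : set R :=
  [set a | exists t0 d, 0 < d /\ forall y', enorm (y' - y) < d -> a <= late_value t0 y'].

Definition super_value y := sup (super_values y).

Lemma super_values_sup y : has_sup (super_values y).
Proof.
split; first by exists (- value_bound), 0, 1; split => // y' _; exact: late_value_lb.
exists (1 + value_bound) => a [t0 [d [d0 h]]]; apply: le_trans (late_value_ub t0 y).
by apply: h; rewrite subrr enorm0.
Qed.

Lemma super_value_ge y a : super_values y a -> a <= super_value y.
Proof. exact: (ub_le_sup (super_values_sup y).2). Qed.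

Lemma super_value_bound y : `|super_value y| <= 1 + value_bound.
Proof.
rewrite ler_norml; apply/andP; split.
  apply: (@le_trans _ _ (- value_bound)); first by lra.
  by apply: super_value_ge; exists 0, 1; split => // y' _; exact: late_value_lb.
apply: ge_sup; first by case: (super_values_sup y).
move=> a [t0 [d [d0 h]]]; apply: le_trans (late_value_ub t0 y).
by apply: h; rewrite subrr enorm0.
Qed.

Lemma super_value_periodic : periodic_fun super_value.
Proof.
have H (z : 'rV[int]_N) y : super_values y `<=` super_values (y + intvec R z).
  move=> a [t0 [d [d0 h]]]; exists t0, d; split => // y' hy'.
  rewrite -[y'](subrK (intvec R z)) late_value_periodic; apply: h.
  by rewrite addrAC -addrA -opprD.
move=> z y; rewrite /super_value; congr sup; apply/seteqP; split; last exact: H.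
by move=> r /(H (- z)); rewrite intvecN addrK.
Qed.

Lemma super_value_lsc : lsc super_value.
Proof.
move=> y a; rewrite lte_fin => h.
have [b [t0 [d [d0 hb]]] ab] := @sup_gt _ (super_values y) a (super_values_sup y).1 h.
exists [set y' | enorm (y' - y) < d / 2]; first by apply/nbhs_enormP; exists (d / 2) => //; rewrite divr_gt0.
move=> y' /= hy'; rewrite lte_fin; apply: lt_le_trans ab _; apply: super_value_ge.
exists t0, (d / 2); split; first by rewrite divr_gt0.
move=> w hw; apply: hb; rewrite (splitr d); apply: le_lt_trans (enorm_triangle y' _ _) _; exact: ltrD.
Qed.

Hypothesis Gusc : forall y0 q0 (e : R), 0 < e -> exists2 d : R, 0 < d &
  forall y q, enorm (y - y0) < d -> enorm (q - q0) < d -> G y q <= G y0 q0 + e.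

(** By the speed bound, a short chain ending near [y0] stays in the ball, and the inequality on [G]
    integrates along it. *)
Lemma chain_local_gain phi y0 r b : C1 phi -> 0 < r ->
  (forall y, enorm (y - y0) < r -> G y (grad phi y + P) <= b) ->
  forall x y t c, chain G x y t c -> enorm (y - y0) + K * t < r ->
  phi y - phi x + edot P (y - x) - c <= b * t.
Proof.
move=> hphi r0 hG x y t c; elim => {x y t c} [x|x v l s y t c s0 hs hc IH] hy.
  by rewrite !subrr edot0r mulr0 subr0 addr0.
have t0 := chain_time_ge0 hc; have hd := chain_displacement GK hc.
have {}IH := IH _; have {IH} k1 : phi y - phi (x + s *: v) + edot P (y - (x + s *: v)) - c <= b * t.
  by apply: IH; apply: le_lt_trans hy; rewrite lerD2l ler_wpM2l// lerDr.
have [xi [x1 x2 k2]] := C1_mvt hphi x v s0.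
have [d d0 hadm] := hs.
have adm : admissible G (x + xi *: v) v l by apply: (hadm xi) => //; rewrite subrr enorm0.
have hv := admissible_speed GK adm.
have hin : enorm (x + xi *: v - y0) < r.
  apply: le_lt_trans hy; rewrite (_ : x + xi *: v - y0 = (y - y0) - ((y - (x + s *: v)) + (s - xi) *: v)).
    apply: le_trans (enormD _ _) _; rewrite enormN lerD2l; apply: le_trans (enormD _ _) _.
    rewrite [s + t]addrC mulrDr; apply: lerD => //; rewrite enormZ ger0_norm ?subr_ge0// mulrC.
    by apply: ler_pM; rewrite ?enorm_ge0 ?subr_ge0// lerBlDr lerDl.
  by apply/rowP => i; rewrite !mxE; ring.
have := le_trans (adm (grad phi (x + xi *: v) + P)) (hG _ hin); rewrite edotDr => k3.
have := ler_wpM2l s0 k3; move: k1 k2.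
have eP : edot P (y - (x + s *: v)) = edot P (y - x) - s * edot P v.
  by rewrite opprD addrA [LHS]edotBr edotZr.
rewrite eP (edotC v (grad _ _)) (edotC v P) => k1 k2.
rewrite mulrBr mulrDr mulrDr; move: k1 k2; set A := phi (x + s *: v); lra.
Qed.

(** Cut off the last piece, of duration [s], of a late chain ending near [y0]. It starts where late
    values are almost above the test function; if the inequality failed, it would raise the value at
    [y0] by a fixed amount. *)
Lemma super_value_visc : visc_super G P critical super_value.
Proof.
move=> phi y0 hphi hmin; rewrite leNgt; apply/negP => hG.
set q0 := grad phi y0 + P in hG; pose e := (critical - G y0 q0) / 3.
have e0 : 0 < e by rewrite divr_gt0// subr_gt0.
have [d d0 hd] := Gusc y0 q0 e0.
have /nbhs_enormP[r1 r10 hr1] := C1_grad_near hphi y0 d0.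
have /nbhs_enormP[r2 r20 hr2] := hmin.
pose r := Num.min d (Num.min r1 r2); have r0 : 0 < r by rewrite !lt_min d0 r10.
have rd : r <= d by rewrite ge_min lexx.
have rr1 : r <= r1 by rewrite !ge_min lexx orbT.
have rr2 : r <= r2 by rewrite !ge_min lexx !orbT.
have hb y : enorm (y - y0) < r -> G y (grad phi y + P) <= critical - 2 * e.
  move=> hy; apply: le_trans (hd y _ _ _) _; first exact: lt_le_trans rd.
    by rewrite /q0 opprD addrACA subrr addr0; apply: hr1; exact: lt_le_trans rr1.
  by rewrite /e; lra.
have K1 : 0 < K + 1 by rewrite ltr_wpDl.
(* Short enough for the last piece to start within [r / 2] of [y0] and to stay in the ball. *)
pose s := r / (4 * (K + 1)); have s0 : 0 < s by rewrite divr_gt0// mulr_gt0.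
have Ks : K * s <= r / 4.
  have h : s * (4 * (K + 1)) = r by rewrite divfK// gt_eqF// mulr_gt0.
  have h' := mulr_ge0 K0 (ltW s0); move: h h' s0; rewrite mulrCA mulrDr mulr1 [s * K]mulrC; lra.
pose m0 := super_value y0 - phi y0.
have es : 0 < e * s by rewrite mulr_gt0.
have phi_cont : continuous phi by move=> y; apply: differentiable_continuous; exact: hphi.1.
(* The half-relaxed limit gives a duration near each point only; compactness makes one [k] serve the
   whole ball. *)
have [k hk] : exists k : nat, [set y | enorm (y - y0) <= r / 2] `<=`
    [set y | exists2 d : R, 0 < d & forall y', enorm (y' - y) < d -> m0 + phi y' - e * s < late_value k%:R y'].
  apply: (@compact_nat_cover E _ (fun k : nat => [set y | exists2 d : R, 0 < d &
    forall y', enorm (y' - y) < d -> m0 + phi y' - e * s < late_value k%:R y'])).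
  - exact: compact_enorm_ball.
  - move=> k; apply/open_enormP => y [d' d'0 h]; exists (d' / 2); first by rewrite divr_gt0.
    move=> y' hy'; exists (d' / 2); first by rewrite divr_gt0.
    by move=> w hw; apply: h; rewrite (splitr d'); apply: le_lt_trans (enorm_triangle y' _ _) _; exact: ltrD.
  - move=> k k' kk y [d' d'0 h]; exists d' => // y' hy'; apply: lt_le_trans (h _ hy') _.
    by apply: late_value_mono; rewrite ler_nat.
  - move=> y /= hy; have hyr2 : enorm (y - y0) < r2.
      by apply: le_lt_trans hy _; apply: lt_le_trans rr2; rewrite ltr_pdivrMr// ltr_pMr// ltr1n.
    have h1 : m0 + phi y <= super_value y by have := hr2 _ hyr2; rewrite /m0; lra.
    have e2 : 0 < e * s / 2 by rewrite divr_gt0.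
    have [a [t0 [d1 [d10 h2]]] h3] := sup_adherent e2 (super_values_sup y).
    have /continuous_enormP/(_ y _ e2)[d2 d20 h4] := phi_cont.
    exists (Num.bound `|t0|), (Num.min d1 d2); first by rewrite lt_min d10.
    move=> y'; rewrite lt_min => /andP[k1 k2].
    apply: (@lt_le_trans _ _ (late_value t0 y')); last first.
      apply: late_value_mono; apply: le_trans (ler_norm t0) _; apply: ltW; exact: archi_boundP.
    have := h2 _ k1; have := h4 _ k2; rewrite ltr_norml => /andP[_ k3].
    by move: h3 h1; rewrite -/(super_value y) (splitr (e * s)); lra.
have es2 : 0 < e * s / 2 by rewrite divr_gt0.
have /continuous_enormP/(_ y0 _ es2)[d3 d30 h3] := phi_cont.
have r4 : 0 < r / 4 by rewrite divr_gt0.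
have : super_value y0 + e * s / 2 <= super_value y0.
  apply: super_value_ge; exists (k%:R + s), (Num.min (r / 4) (d3 / 2)); split; first by rewrite lt_min r4 divr_gt0.
  move=> y; rewrite lt_min => /andP[y1 y2].
  apply: lb_le_inf; first by case: (late_values_inf (k%:R + s) y).
  move=> _ [x [t [c [h ht ->]]]].
  have k0 : 0 <= k%:R :> R by [].
  have hts : 0 <= t - s by lra.
  have tst : t - s <= t by rewrite lerBlDr lerDl ltW.
  have [w [c1 [c2 [g1 g2 ec]]]] := chain_split h hts tst.
  have ets : t - (t - s) = s by rewrite opprB addrCA subrr addr0.
  rewrite ets in g2.
  have hw : enorm (w - y0) <= r / 2.
    apply: le_trans (enorm_triangle y _ _) _; rewrite enormB.
    have := chain_displacement GK g2; lra.
  have [dw dw0 hdw] := hk _ hw; have hlw := hdw w; rewrite subrr enorm0 in hlw.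
  have hlate : late_value k%:R w <= chain_value critical x w (t - s) c1 by apply: late_value_le g1 _; lra.
  have hin : enorm (y - y0) + K * s < r by lra.
  have := chain_local_gain hphi r0 hb g2 hin.
  have k1 := hlw dw0 => k2.
  have d32 : d3 / 2 < d3 by rewrite ltr_pdivrMr// ltr_pMr// ltr1n.
  have := h3 y (lt_trans y2 d32); rewrite ltr_norml => /andP[h6 _].
  have eP : edot P (x - y) = edot P (x - w) - edot P (y - w).
    by rewrite -edotBr; congr edot; apply/rowP => i; rewrite !mxE; ring.
  move: hlate k1 k2 h6; rewrite ec /chain_value /m0 eP; clear.
  rewrite [critical * (t - s)]mulrBr [(critical - 2 * e) * s]mulrBl -[2 * e * s]mulrA; lra.
by rewrite gerDl leNgt divr_gt0.
Qed.

Lemma critical_solutions :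
  (exists u : E -> R, [/\ usc u, periodic_fun u, forall x, `|u x| <= 1 + value_bound & visc_sub G P critical u]) /\
  (exists v : E -> R, [/\ lsc v, periodic_fun v, forall x, `|v x| <= 1 + value_bound & visc_super G P critical v]).
Proof.
split; [exists sub_value|exists super_value]; split.
- exact: sub_value_usc.
- exact: sub_value_periodic.
- by move=> x; apply: le_trans (sub_value_bound x) _; rewrite lerDr.
- exact: sub_value_visc.
- exact: super_value_lsc.
- exact: super_value_periodic.
- exact: super_value_bound.
- exact: super_value_visc.
Qed.

End CriticalValue.

(** * Comparison *)

Section SemicontinuousMax.
Variable R : realType.

(** Without a maximum, the open sets where [F] stays below the supremum by 1/(k + 1) would cover
    [K], and compactness would lower the supremum. *)
Lemma usc_max (T : topologicalType) (K : set T) (F : T -> R) : compact K -> K !=set0 ->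
  (forall r, open [set x | F x < r]) -> exists2 x, K x & forall y, K y -> F y <= F x.
Proof.
move=> cK [x0 Kx0] oF; apply: contrapT => hn.
have hlt x : K x -> exists2 y, K y & F x < F y.
  move=> Kx; apply: contrapT => h; apply: hn; exists x => // y Ky.
  by rewrite leNgt; apply/negP => hxy; apply: h; exists y.
have [m hm] : exists m : nat, K `<=` [set x | F x < m%:R].
  apply: (@compact_nat_cover T K (fun m : nat => [set x | F x < m%:R])) => //.
    by move=> m k mk x /= h; apply: lt_le_trans h _; rewrite ler_nat.
  move=> x _; exists (Num.bound `|F x|) => /=; apply: le_lt_trans (ler_norm _) _; exact: archi_boundP.
pose M := sup (F @` K).
have hS : has_sup (F @` K).
  split; first by exists (F x0); exists x0.
  by exists m%:R => _ [x Kx <-]; apply: ltW; exact: hm.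
have FM x : K x -> F x < M.
  move=> Kx; have [y Ky hy] := hlt _ Kx; apply: lt_le_trans hy _; apply: (ub_le_sup hS.2).
  by exists y.
have [k hk] : exists k : nat, K `<=` [set x | F x < M - k.+1%:R^-1].
  apply: (@compact_nat_cover T K (fun k : nat => [set x | F x < M - k.+1%:R^-1])) => //.
    move=> k j kj x /= h; apply: lt_le_trans h _; rewrite lerD2l lerN2.
    by rewrite lef_pV2 ?posrE ?ltr0n// ler_nat ltnS.
  move=> x Kx; have d0 : 0 < M - F x by rewrite subr_gt0 FM.
  by have [j hj] := natSinv_small d0; exists j => /=; rewrite ltrBrDl -ltrBrDr.
have : M <= M - k.+1%:R^-1.
  by apply: ge_sup; [exact: hS.1|move=> _ [x Kx <-]; apply: ltW; exact: hk].
by rewrite lerBrDr gerDl leNgt invr_gt0 ltr0Sn.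
Qed.

End SemicontinuousMax.

Section Quadratic.
Variables (R : realType) (n : nat) (th : R) (y : 'rV[R]_n.+1).
Local Notation N := n.+1.

Definition quadratic (x : 'rV[R]_N) := th * enorm (x - y) ^+ 2.

Lemma quadratic_derive (x v : 'rV[R]_N) : 'D_v quadratic x = 2 * th * edot (x - y) v.
Proof.
apply: cvg_lim => //; apply/cvgrPdist_lt => e e0.
pose A := `|th| * enorm v ^+ 2 + 1; have A0 : 0 < A by rewrite ltr_wpDl// mulr_ge0// sqr_ge0.
near=> h.
have h0 : h != 0 by near: h; exact: nbhs_dnbhs_neq.
have hA : `|h| < e / A by near: h; apply: dnbhs0_lt; exact: divr_gt0.
have -> : h^-1 *: (quadratic (h *: v + x) - quadratic x) = 2 * th * edot (x - y) v + h * (th * enorm v ^+ 2).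
  rewrite /quadratic !sqr_enorm (_ : h *: v + x - y = (x - y) + h *: v); last by apply/rowP => i; rewrite !mxE; ring.
  move: (x - y) => w; rewrite edotDl !edotDr !edotZl !edotZr (edotC v w).
  rewrite [LHS]/GRing.scale/=; field; exact: h0.
rewrite opprD addrA subrr sub0r normrN normrM normrM (ger0_norm (sqr_ge0 (enorm v))).
move: hA; rewrite ltr_pdivlMr//; apply: le_lt_trans; rewrite ler_wpM2l// /A lerDl//.
Unshelve. all: by end_near.
Qed.

Lemma quadratic_grad x : grad quadratic x = (2 * th) *: (x - y).
Proof.
apply/rowP => i; rewrite mxE quadratic_derive mxE; congr (_ * _).
rewrite /edot (bigD1 i)//= big1 => [|j ji]; first by rewrite !mxE !eqxx mulr1 addr0.
by rewrite !mxE (negbTE ji) andbF mulr0.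
Qed.

Lemma quadratic_C1 : C1 quadratic.
Proof.
split=> [x|i].
  have -> : quadratic = \sum_(i < N) (fun x : 'rV[R]_N => th * ((x 0 i - y 0 i) * (x 0 i - y 0 i))).
    apply/funext => z; rewrite /quadratic sqr_enorm /edot fct_sumE mulr_sumr.
    by apply: eq_bigr => i _; rewrite !mxE.
  apply: differentiable_sum => i.
  have d : differentiable (fun z : 'rV[R]_N => z 0 i - y 0 i) x.
    by apply: differentiableB => //; exact: differentiable_coord.
  by apply: differentiableM => //; exact: differentiableM.
apply: (@lipschitz_continuous_rV R N _ (`|2 * th|) i) => x z.
rewrite !quadratic_derive -mulrBr normrM ler_wpM2l// -edotBl (_ : x - y - (z - y) = x - z).
  by apply: le_trans (abs_edot_le _ _) _; rewrite enorm_ecoord mulr1.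
by apply/rowP => j; rewrite !mxE; ring.
Qed.

End Quadratic.

Section Comparison.
Variables (R : realType) (n : nat) (V : 'rV[R]_n.+1 -> 'rV[R]_n.+1) (L : R) (P : 'rV[R]_n.+1).
Local Notation N := n.+1.
Local Notation E := 'rV[R]_N.
Hypothesis L0 : 0 <= L.
Hypothesis VL : forall x y, enorm (V x - V y) <= L * enorm (x - y).

Definition doubled (u v : E -> R) (th : R) (z : E * E) := u z.1 - v z.2 - th * enorm (z.1 - z.2) ^+ 2.

Lemma doubled_open u v th r : usc u -> lsc v -> open [set z | doubled u v th z < r].
Proof.
move=> hu hv; rewrite openE => -[x y] /= hxy; pose e := (r - doubled u v th (x, y)) / 4.
have e0 : 0 < e by rewrite divr_gt0// subr_gt0.
have [A nA hA] := hu x (- u x - e) ltac:(by rewrite lte_fin gtrDl oppr_lt0).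
have [B nB hB] := hv y (v y - e) ltac:(by rewrite lte_fin gtrDl oppr_lt0).
pose k := `|th| * (2 * enorm (x - y) + 1) + 1.
have k0 : 0 < k by rewrite ltr_wpDl// mulr_ge0// addr_ge0// mulr_ge0// enorm_ge0.
pose d := Num.min (2^-1) (e / k / 2).
have d0 : 0 < d.
  by rewrite lt_min invr_gt0 ltr0n; apply: divr_gt0 => //; exact: divr_gt0.
exists (A `&` [set x' | enorm (x' - x) < d], B `&` [set y' | enorm (y' - y) < d]) => /=.
  by split; apply: filterI => //; apply/nbhs_enormP; exists d.
move=> [x' y'] /= [[Ax' hx'] [By' hy']].
have := hA _ Ax'; have := hB _ By'; rewrite !lte_fin => h1 h2.
have d1 : d <= 2^-1 by rewrite ge_min lexx.
have d2 : d * 2 <= e / k by rewrite -ler_pdivlMr// ge_min lexx orbT.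
set w := enorm (x - y) in k k0 d d0 d1 d2 hx' hy' *; set w' := enorm (x' - y').
have ww : `|w' - w| <= d * 2.
  apply: le_trans (abs_enormB _ _) _.
  rewrite (_ : x' - y' - (x - y) = (x' - x) - (y' - y)); last by apply/rowP => i; rewrite !mxE; ring.
  by apply: le_trans (enormD _ _) _; rewrite enormN mulr2n mulrDr mulr1 lerD ?ltW.
have w0 : 0 <= w by exact: enorm_ge0.
have hth : th * w ^+ 2 - th * w' ^+ 2 <= e.
  apply: le_trans (ler_norm _) _; rewrite -mulrBr normrM subr_sqr normrM distrC.
  have h3 : `|w + w'| <= 2 * w + 1.
    rewrite (_ : w + w' = 2 * w + (w' - w)); last by ring.
    apply: le_trans (ler_normD _ _) _; rewrite ger0_norm ?mulr_ge0// lerD2l; apply: le_trans ww _.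
    by rewrite -ler_pdivlMr// div1r.
  have h4 : `|w' - w| * k <= e by rewrite -ler_pdivlMr//; exact: le_trans ww d2.
  apply: le_trans h4; rewrite /k mulrDr mulr1 mulrCA; apply: ler_wpDr => //.
  by apply: ler_wpM2l => //; rewrite ler_wpM2l.
move: hth; rewrite /doubled/= -/w -/w'.
have eE : 4 * e = r - (u x - v y - th * w ^+ 2) by rewrite /e /doubled/= -/w; field.
lra.
Qed.

(** Periodicity brings the first variable into a ball; a distant second variable is penalized by
    more than the oscillation of [u] and [v]. *)
Lemma doubled_max u v th (B : R) : usc u -> lsc v -> periodic_fun u -> periodic_fun v ->
  (forall x, `|u x| <= B) -> (forall x, `|v x| <= B) -> 1 <= th ->
  exists z, forall z', doubled u v th z' <= doubled u v th z.
Proof.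
move=> hu hv pu pv bu bv th1; have B0 : 0 <= B := le_trans (normr_ge0 _) (bu 0).
pose r := N%:R + 4 * B + 1 : R.
pose K : set (E * E) := [set x | enorm (x - 0) <= N%:R] `*` [set y | enorm (y - 0) <= r].
have cK : compact K by apply: compact_setX; exact: compact_enorm_ball.
have r0 : 0 <= r by rewrite /r !addr_ge0// mulr_ge0.
have K0 : K (0, 0) by split; rewrite /= subrr enorm0.
have [z Kz hz] := @usc_max R _ K (doubled u v th) cK (ex_intro _ _ K0) (fun r => @doubled_open u v th r hu hv).
exists z => -[x y]; have [k hk] := unit_cube_shift x.
have -> : doubled u v th (x, y) = doubled u v th (x + intvec R k, y + intvec R k).
  by rewrite /doubled/= pu pv opprD addrACA subrr addr0.
have nx : enorm (x + intvec R k) <= N%:R.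
  rewrite -[N%:R]mulr1 enorm_le_const// => i.
  by have [h1 h2] := hk i; rewrite ger0_norm// ltW.
move: (x + _) nx (y + _) => {hk}x nx {}y.
have [ny|ny] := lerP (enorm y) r; first by apply: hz; split; rewrite /= subr0.
apply: le_trans (hz _ K0); rewrite /doubled/= subrr enorm0 expr0n/= mulr0 subr0.
have hw : 4 * B + 1 <= enorm (x - y).
  have := enormD (x - y) (- x); rewrite addrAC subrr sub0r !enormN; move: ny nx; rewrite /r; lra.
have h4 : 4 * B + 1 <= th * enorm (x - y) ^+ 2.
  apply: (@le_trans _ _ (enorm (x - y))) => //; move: hw; move: (enorm (x - y)) => w hw.
  have w1 : 1 <= w by lra.
  have ww : 0 <= w ^+ 2 := sqr_ge0 w.
  by apply: (@le_trans _ _ (w ^+ 2)); [rewrite expr2; nra|rewrite ler_peMl].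
have := bu x; have := bv y; have := bu 0; have := bv 0; rewrite !ler_norml => /andP[? ?] /andP[? ?] /andP[? ?] /andP[? ?].
lra.
Qed.


(* Along the penalizations [2 ^ j] the maxima decrease by a bounded total amount, so some step decreases little; there the penalty term is small, although [u] and [v] need not be continuous. *)
Lemma comparison (B eta : R) : 0 <= B -> 0 < eta -> exists Q : R, forall (u v : E -> R) (G : E -> E -> R) (a b : R),
  usc u -> periodic_fun u -> (forall x, `|u x| <= B) -> visc_sub (Ham V) P a u ->
  lsc v -> periodic_fun v -> (forall x, `|v x| <= B) -> visc_super G P b v ->
  (forall y q, enorm q <= Q -> b <= G y q -> b <= Ham V y q) -> b <= a + eta.
Proof.
move=> B0 eta0; pose D := 4 * B + 1; have D0 : 0 < D by rewrite ltr_wpDl// mulr_ge0.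
(* [del] will bound the distance between the two maximum points and [e1] the penalty term; each
   contributes [eta / 2]. *)
pose del := eta / (2 * (L * enorm P + 1)).
have LP : 0 < L * enorm P + 1 by rewrite ltr_wpDl// mulr_ge0// enorm_ge0.
have del0 : 0 < del by rewrite divr_gt0// mulr_gt0.
pose e1 := Num.min (eta / (2 * (2 * L + 1))) (del ^+ 2).
have L21 : 0 < 2 * L + 1 by rewrite ltr_wpDl// mulr_ge0.
have e10 : 0 < e1 by rewrite lt_min exprn_gt0// andbT divr_gt0// mulr_gt0.
(* The maxima decrease by less than [D] in all, so one of [J.+1] steps decreases by at most
   [D / J.+1%:R]. *)
have [J hJ] := natSinv_small (divr_gt0 e10 (mulr_gt0 (ltr0n R 2) D0)).
have J0 : 0 < J.+1%:R :> R by [].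
have {}hJ : 2 * D / J.+1%:R < e1 by rewrite mulrC -ltr_pdivlMr// mulr_gt0.
(* This bounds the test gradients at the selected scale, independently of the solutions and of
   [G]. *)
exists (2 * 2 ^+ J.+1 * (2 * D + 1) + enorm P) => u v G a b hu pu bu su hv pv bv sv hG.
pose th (j : nat) : R := 2 ^+ j.
have th1 j : 1 <= th j by rewrite exprn_ege1// ler1n.
have [z hz] := choice (fun j => doubled_max hu hv pu pv bu bv (th1 j)).
pose M j := doubled u v (th j) (z j).
have uv x y : `|u x - v y| <= 2 * B.
  by apply: le_trans (ler_normB _ _) _; rewrite (_ : 2 * B = B + B) ?lerD//; ring.
have M_ub j : M j <= 2 * B.
  rewrite /M /doubled; have := le_trans (ler_norm _) (uv (z j).1 (z j).2).
  have : 0 <= th j * enorm ((z j).1 - (z j).2) ^+ 2 by rewrite mulr_ge0 ?sqr_ge0// (le_trans _ (th1 j)).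
  lra.
have M_lb j : - (2 * B) <= M j.
  apply: le_trans (hz j (0, 0)); rewrite /doubled/= subrr enorm0 expr0n/= mulr0 subr0.
  by have := uv 0 0; rewrite ler_norml => /andP[].
have [j [jJ hj]] : exists j, (j < J.+1)%N /\ M j - M j.+1 <= D / J.+1%:R.
  apply: contrapT => hn.
  have drop i : (i <= J.+1)%N -> M i <= M 0%N - i%:R * (D / J.+1%:R).
    elim: i => [|i IH] hi; first by rewrite mul0r subr0.
    have := IH (ltnW hi); have : D / J.+1%:R < M i - M i.+1.
      by rewrite ltNge; apply/negP => h; apply: hn; exists i.
    move=> k1 k2; have k3 : M i.+1 <= M i - D / J.+1%:R.
      by rewrite lerBrDr addrC -lerBrDr; exact: ltW k1.
    have e (r : R) : i.+1%:R * r = i%:R * r + r by rewrite -natr1 mulrDl mul1r.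
    by apply: le_trans k3 _; rewrite e opprD addrA; exact: lerB k2 (lexx _).
  have := drop _ (leqnn _); rewrite mulrCA divff ?gt_eqF// mulr1.
  by have := M_lb J.+1; have := M_ub 0%N; rewrite /D; lra.
set x := (z j.+1).1; set y := (z j.+1).2; pose w := enorm (x - y); have w0 : 0 <= w := enorm_ge0 _.
have thS : th j.+1 = 2 * th j by rewrite /th exprS.
(* The maximum point at scale [j.+1] competes at scale [j], where its penalty is halved. *)
have hw : th j * w ^+ 2 <= D / J.+1%:R.
  have := hz j (x, y); rewrite -/(M j); move: hj; rewrite {2}/M /doubled/= -/x -/y -/w thS.
  by move: (D / J.+1%:R) (M j) (th j) (w ^+ 2) (u x) (v y) => r m t w2 a1 a2; lra.
have thw : th j.+1 * w ^+ 2 <= e1.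
  rewrite thS -mulrA; apply: le_trans (ltW hJ); rewrite -mulrA ler_pM2l//.
have w2 : w ^+ 2 <= e1.
  by apply: le_trans thw; rewrite ler_peMl ?sqr_ge0.
have wdel : w <= del.
  have : w ^+ 2 <= del ^+ 2 by apply: le_trans w2 _; rewrite /e1 ge_min lexx orbT.
  by rewrite ler_sqr ?nnegrE ?w0 ?(ltW del0).
have w2D : w <= 2 * D + 1.
  have : w ^+ 2 <= D.
    have : D / J.+1%:R <= D by rewrite ler_pdivrMr// ler_peMr ?(ltW D0)// ler1n.
    apply: le_trans; apply: le_trans hw; by rewrite ler_peMl ?sqr_ge0.
  rewrite expr2; move: w w0 {w2 thw hw wdel} => w' w'0 h; nra.
pose q := (2 * th j.+1) *: (x - y) + P.
have hsub : Ham V x q <= a.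
  have := su (quadratic (th j.+1) y) x (quadratic_C1 _ _); rewrite quadratic_grad; apply.
  apply: (near_enorm ltr01) => x' _; have := hz j.+1 (x', y); rewrite /doubled/= -/x -/y /quadratic; lra.
have hsup : b <= G y q.
  have := sv (quadratic (- th j.+1) x) y (quadratic_C1 _ _); rewrite quadratic_grad.
  rewrite (_ : (2 * - th j.+1) *: (y - x) = (2 * th j.+1) *: (x - y)).
    apply; apply: (near_enorm ltr01) => y' _; have := hz j.+1 (x, y'); rewrite /doubled/= -/x -/y /quadratic.
    by rewrite [enorm (y' - x)]enormB [enorm (y - x)]enormB; lra.
  by rewrite mulrN scaleNr -scalerN opprB.
have th0 : 0 <= th j.+1 by apply: le_trans (th1 _).
have nq : enorm q <= 2 * th j.+1 * w + enorm P.
  by apply: le_trans (enormD _ _) _; rewrite enormZ ger0_norm ?mulr_ge0.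
have hq : enorm q <= 2 * 2 ^+ J.+1 * (2 * D + 1) + enorm P.
  apply: le_trans nq _; rewrite lerD2r; apply: ler_pM => //; first by rewrite mulr_ge0.
  by rewrite ler_pM2l// /th ler_eXn2l// ltr1n.
have hH := hG y q hq hsup.
have hd : Ham V y q - Ham V x q <= enorm q * (L * w).
  rewrite /Ham opprD addrACA subrr add0r -edotBr.
  apply: le_trans (le_trans (ler_norm _) (abs_edot_le _ _)) _; rewrite ler_wpM2l ?enorm_ge0//.
  by rewrite enormB; exact: VL.
have h1 : enorm q * (L * w) <= (2 * th j.+1 * w + enorm P) * (L * w) by rewrite ler_wpM2r// mulr_ge0.
have h2 : (2 * th j.+1 * w + enorm P) * (L * w) = 2 * L * (th j.+1 * w ^+ 2) + L * enorm P * w by rewrite expr2; ring.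
have h3 : 2 * L * (th j.+1 * w ^+ 2) <= eta / 2.
  apply: (@le_trans _ _ ((2 * L + 1) * e1)).
    by apply: ler_pM => //; rewrite ?mulr_ge0 ?sqr_ge0// lerDl.
  apply: (@le_trans _ _ ((2 * L + 1) * (eta / (2 * (2 * L + 1))))).
    by rewrite ler_pM2l// /e1 ge_min lexx.
  by rewrite le_eqVlt; apply/orP; left; apply/eqP; field; rewrite gt_eqF.
have h4 : L * enorm P * w <= eta / 2.
  apply: (@le_trans _ _ ((L * enorm P + 1) * del)).
    by apply: ler_pM => //; rewrite ?mulr_ge0 ?enorm_ge0// lerDl.
  by rewrite le_eqVlt /del; apply/orP; left; apply/eqP; field; rewrite gt_eqF.
rewrite (splitr eta); lra.
Qed.

End Comparison.

(** * Effective Hamiltonians *)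

Section Hamiltonians.
Variables (R : realType) (n : nat) (V : 'rV[R]_n.+1 -> 'rV[R]_n.+1) (L B : R).
Local Notation N := n.+1.
Local Notation E := 'rV[R]_N.
Hypothesis L0 : 0 <= L.
Hypothesis VP : periodic_fun V.
Hypothesis VL : forall x y, enorm (V x - V y) <= L * enorm (x - y).
Hypothesis VB : forall x, enorm (V x) <= B.

(** When [enorm q] exceeds [k >= 0], [Ham_k V k] is at most (B + 2)|q| - k, hence below
    [M * enorm q - k]. *)
Let M := B + 3.
Let B0 : 0 <= B. Proof. exact: le_trans (enorm_ge0 _) (VB 0). Qed.
Let M0 : 0 <= M. Proof. by rewrite addr_ge0. Qed.

(* Dominates [Ham_k V k] and is, like [Ham V], a supremum of finitely many families of controls. *)
Definition Ham_sup (k : R) (x q : E) : R := Num.max (Ham V x q) (M * enorm q - k).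

Lemma Ham_le x q : Ham V x q <= (1 + B) * enorm q.
Proof.
rewrite /Ham mulrDl mul1r lerD2l; apply: le_trans (le_trans (ler_norm _) (abs_edot_le _ _)) _.
by rewrite mulrC ler_wpM2r ?enorm_ge0.
Qed.

Lemma Ham_growth x q : Ham V x q <= M * enorm q.
Proof. by apply: le_trans (Ham_le x q) _; rewrite ler_wpM2r ?enorm_ge0// /M; lra. Qed.

Lemma Ham_sup_growth k x q : 0 <= k -> Ham_sup k x q <= M * enorm q.
Proof. by move=> k0; rewrite ge_max Ham_growth/= gerBl. Qed.

Lemma Ham_sup_periodic k q : periodic_fun ((Ham_sup k)^~ q).
Proof. by move=> z x; rewrite /Ham_sup /Ham VP. Qed.

Lemma Ham_k_le_sup k x q : 0 <= k -> Ham_k V k x q <= Ham_sup k x q.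
Proof.
move=> k0; have q0 := enorm_ge0 q; have hM : 0 <= M * enorm q by exact: mulr_ge0.
rewrite /Ham_k /Ham_sup; have [h|h] := lerP (enorm q) k.
  rewrite [Num.max (enorm q - k) 0]max_r ?subr_le0// addr0 ge_max !le_max lexx/=.
  by rewrite -[X in _ || (X <= _)]add0r lerD2r hM orbT.
rewrite [Num.max (enorm q - k) 0]max_l ?subr_ge0 ?(ltW h)// le_max; apply/orP; right.
have h1 : Num.max (Ham V x q) (- k) <= (1 + B) * enorm q.
  rewrite ge_max Ham_le/=; apply: (@le_trans _ _ 0); first by rewrite oppr_le0.
  by rewrite mulr_ge0// addr_ge0.
have := h1; rewrite /M mulrDl [(B + 3) * _]mulrDl; move: q0; lra.
Qed.

Lemma Ham_le_k k x q : Ham V x q <= Ham_k V k x q.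
Proof.
rewrite /Ham_k -[leLHS]addr0; apply: lerD; first by rewrite le_max lexx.
by rewrite le_max lexx orbT.
Qed.

(** The optimal velocity lies on the boundary of the ball around [V x0]; shrinking its offset by the
    factor [1 - ka] costs at most [e] and leaves a margin for nearby [y]. *)
Lemma Ham_dense x0 q0 (e : R) : 0 < e -> exists v l d, [/\ 0 < d, Ham V x0 q0 - e <= edot v q0 - l &
  forall y, enorm (y - x0) < d -> admissible (Ham V) y v l].
Proof.
move=> e0; pose w := enorm q0; have w0 : 0 <= w := enorm_ge0 _.
pose ka := e / (w + e); have we : 0 < w + e by rewrite ltr_wpDl.
have ka0 : 0 < ka by rewrite divr_gt0.
have ka1 : ka <= 1 by rewrite ler_pdivrMr// mul1r lerDr.
have kw : ka * w <= e.
  by rewrite /ka mulrAC ler_pdivrMr// ler_pM2l// lerDl ltW.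
have L1 : 0 < L + 1 by rewrite ltr_wpDl.
have [z [z1 z2]] : exists z : E, enorm z <= 1 /\ edot z q0 = w.
  have [wz|wn] := eqVneq w 0.
    by exists 0; rewrite enorm0 ler01 edot0l wz.
  exists (w^-1 *: q0); rewrite enormZ ger0_norm ?invr_ge0// -/w mulVf// lexx; split => //.
  by rewrite edotZl -sqr_enorm -/w expr2 mulKf.
exists (V x0 + (1 - ka) *: z), 0, (ka / (L + 1)); split; first exact: divr_gt0.
  rewrite subr0 edotDl edotZl z2 /Ham -/w (edotC q0) mulrBl mul1r; move: kw; lra.
move=> y; rewrite ltr_pdivlMr// => hy; apply: ham_admissible.
rewrite addrAC; apply: le_trans (enormD _ _) _; rewrite enormZ ger0_norm ?subr_ge0//.
have h1 := VL x0 y; rewrite [enorm (x0 - y)]enormB in h1.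
have h2 : (1 - ka) * enorm z <= 1 - ka by rewrite ler_piMr// subr_ge0.
have h3 := enorm_ge0 (y - x0); move: hy h1 h2; rewrite mulrDr mulr1 [_ * L]mulrC; lra.
Qed.

(** The branch that realizes the maximum at (x0, q0) supplies the control; in the second branch it
    is valid at every position. *)
Lemma Ham_sup_dense k x0 q0 (e : R) : 0 < e -> exists v l d, [/\ 0 < d, Ham_sup k x0 q0 - e <= edot v q0 - l &
  forall y, enorm (y - x0) < d -> admissible (Ham_sup k) y v l].
Proof.
move=> e0; rewrite {1}/Ham_sup; case: (leP (M * enorm q0 - k) (Ham V x0 q0)) => h.
  have [v [l [d [d0 h1 h2]]]] := Ham_dense x0 q0 e0; exists v, l, d; split => // y hy q.
  by apply: le_trans (h2 y hy q) _; rewrite le_max lexx.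
pose w := enorm q0; have w0 : 0 <= w := enorm_ge0 _.
have [z [z1 z2]] : exists z : E, enorm z <= 1 /\ edot z q0 = w.
  have [wz|wn] := eqVneq w 0.
    by exists 0; rewrite enorm0 ler01 edot0l wz.
  exists (w^-1 *: q0); rewrite enormZ ger0_norm ?invr_ge0// -/w mulVf// lexx; split => //.
  by rewrite edotZl -sqr_enorm -/w expr2 mulKf.
exists (M *: z), k, 1; split => //; first by rewrite edotZl z2 gerBl ltW.
move=> y _ q; rewrite /Ham_sup le_max lerD2r edotZl; apply/orP; right; apply: ler_wpM2l => //.
apply: le_trans (le_trans (ler_norm _) (abs_edot_le _ _)) _.
by rewrite -[leRHS]mul1r ler_wpM2r ?enorm_ge0.
Qed.

Lemma enorm_sub_le (q q0 : E) : enorm q <= enorm q0 + enorm (q - q0).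
Proof. by rewrite -{1}[q](subrK q0) addrC; exact: enormD. Qed.

Lemma Ham_perturb y y0 q q0 : Ham V y q <= Ham V y0 q0 + M * enorm (q - q0) + L * enorm (y - y0) * enorm q0.
Proof.
have h1 := enorm_sub_le q q0.
have e : edot q (V y) = edot q0 (V y0) + edot (q - q0) (V y) + edot q0 (V y - V y0).
  by rewrite edotBl edotBr; ring.
have h2 : edot (q - q0) (V y) <= B * enorm (q - q0).
  by apply: le_trans (le_trans (ler_norm _) (abs_edot_le _ _)) _; rewrite mulrC ler_wpM2r ?enorm_ge0.
have h3 : edot q0 (V y - V y0) <= L * enorm (y - y0) * enorm q0.
  by apply: le_trans (le_trans (ler_norm _) (abs_edot_le _ _)) _; rewrite mulrC ler_wpM2r ?enorm_ge0.
rewrite /Ham e /M mulrDl; have := enorm_ge0 (q - q0); move: h1 h2 h3; lra.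
Qed.

Lemma usc_from_perturb (G : E -> E -> R) :
  (forall y y0 q q0, G y q <= G y0 q0 + M * enorm (q - q0) + L * enorm (y - y0) * enorm q0) ->
  forall y0 q0 (e : R), 0 < e -> exists2 d : R, 0 < d &
  forall y q, enorm (y - y0) < d -> enorm (q - q0) < d -> G y q <= G y0 q0 + e.
Proof.
move=> hG y0 q0 e e0; pose A := M + L * enorm q0 + 1.
have A0 : 0 < A by rewrite ltr_wpDl// addr_ge0// mulr_ge0// enorm_ge0.
exists (e / A) => [|y q hy hq]; first exact: divr_gt0.
apply: le_trans (hG y y0 q q0) _; rewrite -addrA lerD2l.
have h1 : M * enorm (q - q0) <= M * (e / A) by rewrite ler_wpM2l// ltW.
have h2 : L * enorm (y - y0) * enorm q0 <= L * enorm q0 * (e / A).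
  by rewrite mulrAC ler_wpM2l ?mulr_ge0 ?enorm_ge0// ltW.
have h3 : e / A * A = e by rewrite divfK// gt_eqF.
have h4 : 0 < e / A by exact: divr_gt0.
apply: (@le_trans _ _ (M * (e / A) + L * enorm q0 * (e / A) + e / A)).
  by apply: ler_wpDr; [exact: ltW|exact: lerD].
rewrite le_eqVlt; apply/orP; left; apply/eqP.
by rewrite -mulrDl -[X in _ + X]mul1r -mulrDl mulrC.
Qed.

Lemma Ham_sup_perturb k y y0 q q0 :
  Ham_sup k y q <= Ham_sup k y0 q0 + M * enorm (q - q0) + L * enorm (y - y0) * enorm q0.
Proof.
rewrite {1}/Ham_sup ge_max; apply/andP; split.
  by apply: le_trans (Ham_perturb y y0 q q0) _; rewrite !lerD2r le_max lexx.
have h1 := ler_wpM2l M0 (enorm_sub_le q q0); rewrite mulrDr in h1.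
have h2 : M * enorm q0 - k <= Ham_sup k y0 q0 by rewrite le_max lexx orbT.
have h3 : 0 <= L * enorm (y - y0) * enorm q0 by rewrite !mulr_ge0// enorm_ge0.
lra.
Qed.

End Hamiltonians.

Section EffectiveHamiltonian.
Variables (R : realType) (n : nat).
Local Notation N := n.+1.
Local Notation E := 'rV[R]_N.

Lemma Hbar_ub (G : E -> E -> R) P a (u : E -> R) : usc u -> bdd_fun u -> periodic_fun u -> visc_sub G P a u ->
  (Hbar G P <= a%:E)%E.
Proof. by move=> h1 h2 h3 h4; apply: ereal_inf_lbound; exists a => //; exists u. Qed.

Lemma Hbar_le (G G' : E -> E -> R) P : (forall x q, G x q <= G' x q) -> (Hbar G P <= Hbar G' P)%E.
Proof.
move=> GG; apply: le_ereal_inf_tmp => _ [a [u [h1 h2 h3 h4]] <-].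
by apply: (Hbar_ub h1 h2 h3) => phi x0 hphi hm; apply: le_trans (GG _ _) _; exact: h4.
Qed.

Lemma critical_mono (G G' : E -> E -> R) P : (forall x q, G x q <= G' x q) -> has_inf (bounded_levels G P) ->
  has_inf (bounded_levels G' P) -> critical G P <= critical G' P.
Proof.
move=> GG h h'; apply: lb_le_inf; first exact: h'.1.
move=> a [B hB]; apply: (ge_inf h.2); exists B => x y t c hc.
by apply: hB; exact: chain_le GG hc.
Qed.

End EffectiveHamiltonian.

(* The paper's dimension N is n.+1. *)
Theorem theorem6p5 (R : realType) (n : nat) (V : 'rV[R]_n.+1 -> 'rV[R]_n.+1) (chi : R) :
  periodic_fun V -> lipschitz_map V ->
  isoperimetric_constant n chi ->
  (LN_norm_div V <= (chi^-1)%:E)%E ->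
  forall P : 'rV[R]_n.+1,
    (fun k : nat => Hbar (Ham_k V k.+1%:R) P) @ \oo --> Hbar (Ham V) P
    /\ exists c : R, Hbar (Ham V) P = c%:E /\
       (exists u : 'rV[R]_n.+1 -> R,
          [/\ usc u, bdd_fun u, periodic_fun u & visc_sub (Ham V) P c u]) /\
       (exists v : 'rV[R]_n.+1 -> R,
          [/\ lsc v, bdd_fun v, periodic_fun v & visc_super (Ham V) P c v]).
Proof.
move=> VP [L0 VL0] hchi hdiv P; pose L := `|L0|; have Lp : 0 <= L by exact: normr_ge0.
have VL x y : enorm (V x - V y) <= L * enorm (x - y).
  by apply: le_trans (VL0 x y) _; rewrite ler_wpM2r ?enorm_ge0// ler_norm.
have [B VB] := periodic_lipschitz_bounded VP VL.
have [T' hT'] := controllability Lp VP VL hchi hdiv.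
pose T := Num.max T' 0; have T0 : 0 <= T by rewrite le_max lexx orbT.
have ctrl x y : exists z t, t <= T /\ chain (Ham V) x (y + intvec R z) t 0.
  by have [z [t [h1 h2]]] := hT' x y; exists z, t; split => //; rewrite le_max h1.
pose M := B + 3.
have M0 : 0 <= M by rewrite addr_ge0// (le_trans _ (VB 0))// enorm_ge0.
have Hle k x q : Ham V x q <= Ham_sup V B k x q by rewrite le_max lexx.
(* Raising the Hamiltonian keeps the chains of [Ham V], so one time [T] serves every [k]. *)
have ctrlk k x y : exists z t, t <= T /\ chain (Ham_sup V B k) x (y + intvec R z) t 0.
  by have [z [t [h1 h2]]] := ctrl x y; exists z, t; split => //; exact: chain_le (Hle k) h2.
have HG := Ham_growth VB; have HP := Ham_periodic VP.
have Hd := Ham_dense Lp VL.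
have Hu := usc_from_perturb Lp VB (Ham_perturb VL VB).
have KG k (k0 : 0 <= k) := fun x q => Ham_sup_growth VB x q k0.
have KP k := Ham_sup_periodic B VP k.
have Kd k := @Ham_sup_dense R n V L B Lp VL VB k.
have Ku k := usc_from_perturb Lp VB (Ham_sup_perturb Lp VL VB k).
pose c := critical (Ham V) P; pose ck k := critical (Ham_sup V B k) P.
have infH : has_inf (bounded_levels (Ham V) P) by exact: (bounded_levels_inf P HG HP Hd ctrl).
have infK k : 0 <= k -> has_inf (bounded_levels (Ham_sup V B k) P).
  by move=> k0; exact: (bounded_levels_inf P (KG k k0) (KP k) (Kd k) (ctrlk k)).
have [[u [u1 u2 u3 u4]] [v [v1 v2 v3 v4]]] := critical_solutions P M0 T0 HG HP Hd ctrl Hu.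
have cck k : 0 <= k -> c <= ck k by move=> k0; apply: critical_mono (Hle k) infH (infK k k0).
have ckM k : 0 <= k -> ck k <= M * enorm P.
  by move=> k0; exact: (critical_le_gain P (KG k k0) (KP k) (Kd k) (ctrlk k)).
have MP : 0 <= M * enorm P by rewrite mulr_ge0// enorm_ge0.
(* One bound for all the solutions, uniform in [k] because [ck k] stays between [c] and
   [M * enorm P]; [comparison] then yields a [Q] free of [k]. *)
pose Bd := 1 + (M * T * enorm P + (`|c| + M * enorm P) * T).
have bH : 1 + value_bound (Ham V) M T P <= Bd.
  by rewrite /Bd /value_bound lerD2l lerD2l -/c ler_wpM2r// lerDl.
have bK k : 0 <= k -> 1 + value_bound (Ham_sup V B k) M T P <= Bd.
  move=> k0; rewrite /Bd /value_bound lerD2l lerD2l -/(ck k) ler_wpM2r// ler_norml.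
  have := cck _ k0; have := ckM _ k0; have := ler_norm (- c); rewrite normrN => h1 h2 h3.
  have h4 := normr_ge0 c; apply/andP; split; lra.
have Bd0 : 0 <= Bd.
  by apply: le_trans bH; apply: le_trans (u3 0); exact: normr_ge0.
have bddu : bdd_fun u by exists (1 + value_bound (Ham V) M T P).
(* Comparing the supersolution at level [c] with an arbitrary subsolution shows that no level below
   [c] has one. *)
have HbarE : Hbar (Ham V) P = c%:E.
  apply/eqP; rewrite eq_le; apply/andP; split; first exact: Hbar_ub u1 bddu u2 u4.
  apply: le_ereal_inf_tmp => _ [a [w [w1 [Bw w2] w3 w4]] <-]; rewrite lee_fin.
  apply/ler_addgt0Pr => eta eta0.
  have Bm : 0 <= Num.max Bd Bw by rewrite le_max Bd0.
  have [Q hQ] := comparison P Lp VL Bm eta0.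
  apply: (hQ w v (Ham V) a c) => //.
  - by move=> x; apply: le_trans (w2 x) _; rewrite le_max lexx orbT.
  - by move=> x; apply: le_trans (v3 x) _; rewrite le_max bH.
(* The bound passes through the majorant [Ham_sup], whose critical level has a supersolution to
   compare with [u]. *)
have upper eta : 0 < eta -> exists k0 : R, 0 <= k0 /\ forall k, k0 <= k -> (Hbar (Ham_k V k) P <= (c + eta)%:E)%E.
  move=> eta0; have [Q hQ] := comparison P Lp VL Bd0 eta0.
  (* For [k] this large, [M * enorm q - k] stays below [c <= ck k] when [enorm q <= Q], so the
     supersolution inequality can only come from the branch [Ham V]. *)
  exists (Num.max 0 (M * Q - c + 1)); split; first by rewrite le_max lexx.
  move=> k; rewrite ge_max => /andP[k0 kQ].
  have [[uk [uk1 uk2 uk3 uk4]] [vk [vk1 vk2 vk3 vk4]]] :=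
    critical_solutions P M0 T0 (KG k k0) (KP k) (Kd k) (ctrlk k) (Ku k).
  apply: (@le_trans _ _ (Hbar (Ham_sup V B k) P)); first by apply: Hbar_le => x q; exact: Ham_k_le_sup.
  apply: (@le_trans _ _ (ck k)%:E); first by apply: Hbar_ub uk4 => //; exists (1 + value_bound (Ham_sup V B k) M T P).
  rewrite lee_fin; apply: (hQ u vk (Ham_sup V B k) c (ck k)) => //.
  - by move=> x; apply: le_trans (u3 x) bH.
  - by move=> x; apply: le_trans (vk3 x) (bK _ k0).
  - move=> y q hq; rewrite /Ham_sup le_max => /orP[//|h]; exfalso.
    have h1 := ler_wpM2l M0 hq; have := cck _ k0; move: h kQ; rewrite -/M; lra.
have lower k : (c%:E <= Hbar (Ham_k V k) P)%E by rewrite -HbarE; apply: Hbar_le => x q; exact: Ham_le_k.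
split; last first.
  exists c; split => //; split; first by exists u.
  by exists v; split => //; exists (1 + value_bound (Ham V) M T P).
rewrite HbarE; apply/fine_cvgP; have near_c (eta : R) : 0 < eta ->
    \forall k \near \oo, (Hbar (Ham_k V k.+1%:R) P <= (c + eta)%:E)%E.
  move=> eta0; have [k0 [k00 hk]] := upper eta eta0.
  exists (Num.bound k0) => // k /= kb; apply: hk; apply: ltW; apply: lt_le_trans (archi_boundP k00) _.
  by rewrite ler_nat ltnW.
split.
  have := near_c 1 ltr01; apply: filterS => k hk.
  by rewrite fin_numE; apply/andP; split; apply/eqP => h; move: (lower k.+1%:R) hk; rewrite h.
apply/cvgrPdist_le => e e0; have := near_c e e0; apply: filterS => k hk /=.
have := lower k.+1%:R; move: hk; case: (Hbar (Ham_k V k.+1%:R) P) => [r||]//=.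
by rewrite !lee_fin distrC ler_norml => h1 h2; apply/andP; split; lra.
Qed.
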